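(* Let $f\in L^1$ and $g\in L\log L$ satisfy $fT(g\chi_A)\in L^1$ for every Borel set $A\subseteq(-1,1)$. Then the Poincaré–Bertrand formula $$T\big(g\,T(f)+f\,T(g)\big)=T(f)\,T(g)-fg$$ is valid in $L^0$, i.e. a.e. on $(-1,1)$.
   Context: All functions are complex-valued, Lebesgue measurable on $(-1,1)$, identified when equal a.e.; $L^0$ denotes the space of all of them and $L^1=L^1(-1,1)$. The decreasing rearrangement of $f$ is $f^*(t)=\inf\{\lambda\ge 0: |\{x\in(-1,1):|f(x)|>\lambda\}|\le t\}$, $0<t<2$. The Zygmund space $L\log L=L\log L(-1,1)$ consists of all measurable $f$ with $\|f\|_{L\log L}:=\int_0^2 f^*(t)\log\big(\tfrac{2e}{t}\big)\,dt<\infty$ (equivalently $\int_{-1}^1|f|\log^+|f|<\infty$); it is contained in $L^1$. For $f\in L^1$ the finite Hilbert transform is $$T(f)(t)=\lim_{\varepsilon\to0^+}\frac1\pi\Big(\int_{-1}^{t-\varepsilon}+\int_{t+\varepsilon}^1\Big)\frac{f(x)}{x-t}\,dx ,$$ which exists for a.e. $t\in(-1,1)$ and is measurable. $\chi_A$ is the indicator function of $A$. Under the hypotheses of the claim one also has $gT(f)\in L^1$, so that the left-hand side is well defined. *)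

(* Defs.v *)
From HB Require Import structures.
From mathcomp Require Import all_boot all_order all_algebra.
From mathcomp Require Import complex.
From mathcomp Require Import all_classical all_reals all_analysis.

Set Implicit Arguments.
Unset Strict Implicit.
Unset Printing Implicit Defensive.

Import Order.TTheory GRing.Theory Num.Theory.
Import numFieldNormedType.Exports.

Local Open Scope classical_set_scope.
Local Open Scope ring_scope.
Local Open Scope complex_scope.

(* [R] with the sigma-algebra of Lebesgue measurable sets, on which
   [completed_lebesgue_measure] is defined; [measurableTypeR R] only has the
   Borel sets. *)
Definition lebesgueTypeR (R : realType) :=
  caratheodory_type ((@wlength R idfun)^*)%mu.

Definition leb (R : realType) : {measure set (lebesgueTypeR R) -> \bar R} :=
  @completed_lebesgue_measure R.

Definition I11 (R : realType) : set R := `](-1), 1[%classic.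
Arguments I11 R : clear implicits.

(* The norm of [R[i]] takes its values in [R[i]]. *)
Definition cabs (R : realType) (z : R[i]) : R := complex.Re `|z|.

(* A function on (-1, 1) is a total function on [R] of which only the values
   on [I11 R] matter. *)
Definition cmeasurable (R : realType) (f : R -> R[i]) : Prop :=
  measurable_fun (I11 R : set (lebesgueTypeR R))
    (fun x => complex.Re (f x) : measurableTypeR R) /\
  measurable_fun (I11 R : set (lebesgueTypeR R))
    (fun x => complex.Im (f x) : measurableTypeR R).

Definition cintegral (R : realType) (D : set R) (f : R -> R[i]) : R[i] :=
  (\int[leb R]_(x in D) complex.Re (f x)) +i*
  (\int[leb R]_(x in D) complex.Im (f x)).

Definition L1 (R : realType) (f : R -> R[i]) : Prop :=
  cmeasurable f /\ (\int[leb R]_(x in I11 R) (cabs (f x))%:E < +oo)%E.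

Definition rearrangement (R : realType) (f : R -> R[i]) (t : R) : \bar R :=
  ereal_inf [set l%:E | l in
    [set l : R | 0 <= l /\
      (leb R [set x | I11 R x /\ (l < cabs (f x))%R] <= t%:E)%E]].

Definition LlogL_norm (R : realType) (f : R -> R[i]) : \bar R :=
  (\int[leb R]_(t in `]0%R, 2%R[%classic)
     (rearrangement f t * (ln (2 * expR 1 / t))%:E))%E.

Definition LlogL (R : realType) (f : R -> R[i]) : Prop :=
  cmeasurable f /\ (LlogL_norm f < +oo)%E.

(* [lim] takes a default value where the limit does not exist; for [f] in
   [L1] this concerns only a null set of [t]. *)
Definition finite_hilbert (R : realType) (f : R -> R[i]) (t : R) : R[i] :=
  lim (((pi^-1)%:C *
        (cintegral `](-1), t - e[%classic (fun x => f x / (x - t)%:C) +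
         cintegral `]t + e, 1[%classic (fun x => f x / (x - t)%:C)) : R[i]^o)
       @[e --> (0 : R)^'+]).

(* Main.v *)
Require Import Defs.
From HB Require Import structures.
From mathcomp Require Import all_boot all_order all_algebra.
From mathcomp Require Import complex.
From mathcomp Require Import all_classical all_reals all_analysis.
From mathcomp Require Import measurable_realfun.
From mathcomp Require Import ring lra.

Set Implicit Arguments.
Unset Strict Implicit.
Unset Printing Implicit Defensive.

Import Order.TTheory GRing.Theory Num.Theory.
Import numFieldNormedType.Exports.

Local Open Scope classical_set_scope.
Local Open Scope ring_scope.
Local Open Scope complex_scope.

(* Write F(z) for the integral of f(s) / (s - z), with Im z > 0, and H = pi T.
   For almost every t the boundary value of F at t is Hf(t) + i pi f(t). If
   k = g Hf + f Hg has Cauchy transform F G, comparing boundary values gives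
   Hk + i pi k = (Hf + i pi f)(Hg + i pi g), whose real part is the formula.
   The boundary values also give H(f / (x - z)) = (Hf - F(z)) / (t - z), which
   reduces the identity "Cauchy transform of k = F G" to Parseval's formula:
   the integrals of g Hf and of - f Hg agree.

   For bounded functions Parseval's formula is Fubini's theorem. It passes to g
   in L log L, then to f in L1, by truncation: over every Borel set A the
   integrals of the truncated products converge, so by Nikodym's theorem the
   limit function is integrable and is the limit of the integrals as well. This
   is where f T(g 1_A) in L1 is used for all A.

   The boundary values exist because, for f >= 0, the function 1 / (1 - i F) is
   bounded, hence the Poisson integral of its boundary function; the same
   function gives the weak type inequality, and exp(F) the exponential
   integrability that pairs with L log L. *)

(** * Integrals of complex functions *)

(** For [f] merely in L1 the function Hf need not be locally integrable, so no density argument in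
    norm reaches the products g Hf and f Hg. Truncation preserves less: Hf_k tends to Hf almost
    everywhere, and over each Borel set the integrals of one of the two products converge by
    domination. The order of the truncations matters. While [f] is bounded, exponential
    integrability makes g H(f 1_A) a dominating function; only then is [f] truncated, and the
    dominating functions are the f H(g 1_A) of the hypothesis.

    Multiplying [f] by the bounded kernel 1 / (x - z) preserves that hypothesis, so Parseval's
    formula may be applied to the product.

    The kernel of H is real, so one complex hypothesis controls all four pairs of real components.
    The analysis can thus be done for real Borel functions on the line, extended by zero. Bounded
    boundary functions are not integrable on the line; the weight 1 / (1 + x^2), which is the
    Poisson kernel at i, repairs this. *)

Section Cabs.
Context (R : realType).

Lemma cabs_normc (z : R[i]) : cabs z = Num.sqrt (complex.Re z ^+ 2 + complex.Im z ^+ 2).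
Proof. by case: z. Qed.

Lemma cabs_ge0 (z : R[i]) : 0 <= cabs z.
Proof. by rewrite cabs_normc sqrtr_ge0. Qed.

Lemma cabsM (z w : R[i]) : cabs (z * w) = cabs z * cabs w.
Proof. by rewrite /cabs normrM; case: z w => a b [c d'] /=; rewrite mulr0 subr0. Qed.

Lemma cabsD (z w : R[i]) : cabs (z + w) <= cabs z + cabs w.
Proof.
have := ler_normD z w; rewrite /cabs; case: (z) (w) => a b [c d] /=.
by rewrite lecE /= => /andP[].
Qed.

Lemma cabsN (z : R[i]) : cabs (- z) = cabs z.
Proof. by rewrite /cabs normrN. Qed.

Lemma cabsB (z w : R[i]) : cabs (z - w) <= cabs z + cabs w.
Proof. by rewrite -(cabsN w) cabsD. Qed.

Lemma cabsX (z : R[i]) n : cabs (z ^+ n) = cabs z ^+ n.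
Proof.
elim: n => [|n IH]; last by rewrite !exprS cabsM IH.
by rewrite cabs_normc /= expr1n expr0n addr0 sqrtr1.
Qed.

Lemma cabs_real (x : R) : cabs (x%:C) = `|x|.
Proof. by rewrite cabs_normc /= expr0n addr0 sqrtr_sqr. Qed.

Lemma cabs_Re (z : R[i]) : `|complex.Re z| <= cabs z.
Proof. by rewrite cabs_normc -sqrtr_sqr ler_wsqrtr// lerDl sqr_ge0. Qed.

Lemma cabs_Im (z : R[i]) : `|complex.Im z| <= cabs z.
Proof. by rewrite cabs_normc -sqrtr_sqr ler_wsqrtr// lerDr sqr_ge0. Qed.

Lemma cabs_sum (z : R[i]) : cabs z <= `|complex.Re z| + `|complex.Im z|.
Proof.
rewrite cabs_normc -[leRHS]ger0_norm ?addr_ge0// -sqrtr_sqr ler_wsqrtr//.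
rewrite sqrrD !real_normK ?num_real// lerD2r lerDl mulrn_wge0//.
Qed.

Lemma cabs_eq0 (z : R[i]) : (cabs z == 0) = (z == 0).
Proof.
rewrite cabs_normc sqrtr_eq0 le_eqVlt ltNge addr_ge0 ?sqr_ge0// orbF.
rewrite paddr_eq0 ?sqr_ge0// !sqrf_eq0.
by case: z => a b; rewrite eq_complex.
Qed.

Lemma cabs_gt0 (z : R[i]) : (0 < cabs z) = (z != 0).
Proof. by rewrite lt_def cabs_ge0 andbT cabs_eq0. Qed.

Lemma cabsV (z : R[i]) : cabs z^-1 = (cabs z)^-1.
Proof.
have [->|z0] := eqVneq z 0.
  by rewrite invr0 (_ : cabs 0 = 0) ?invr0//; apply/eqP; rewrite cabs_eq0.
apply: (@mulfI _ (cabs z)); first by rewrite cabs_eq0.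
by rewrite -cabsM divff// divff ?cabs_eq0// -[1]/(1%:C) cabs_real normr1.
Qed.

End Cabs.

Section RealIntegral.
Context d (T : measurableType d) (R : realType).
Variable mu : {measure set T -> \bar R}.
Implicit Types (f g h : T -> R).

(** Integration is always over the whole type: a function on (-1, 1) is extended by zero, and a
    smaller domain is expressed by an indicator. *)
Definition rint f := mu.-integrable setT (EFin \o f).

Lemma rint_measurable f : rint f -> measurable_fun setT f.
Proof. by move=> /measurable_int/measurable_EFinP. Qed.

Lemma rint_le f g : measurable_fun setT f -> rint g ->
  (forall x, `|f x| <= g x) -> rint f.
Proof.
move=> mf ig fg; apply: (le_integrable _ _ _ ig) => //.
  exact/measurable_EFinP.
move=> x _ /=; rewrite lee_fin (le_trans (fg x))// ler_norm//.
Qed.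

Lemma rint_eq f g : f =1 g -> rint f -> rint g.
Proof. by move=> /funext ->. Qed.

Lemma rint0 : rint (fun=> 0).
Proof. exact: integrable0. Qed.

Lemma rintD f g : rint f -> rint g -> rint (fun x => f x + g x).
Proof. by move=> fi gi; apply: (integrableD measurableT fi gi). Qed.

Lemma rintB f g : rint f -> rint g -> rint (fun x => f x - g x).
Proof. by move=> fi gi; apply: (integrableB measurableT fi gi). Qed.

Lemma rintN f : rint f -> rint (fun x => - f x).
Proof. exact: integrableN. Qed.

Lemma rintZl k f : rint f -> rint (fun x => k * f x).
Proof. by move=> fi; apply: (integrableZl measurableT k fi). Qed.

Lemma rint_norm f : rint f -> rint (fun x => `|f x|).
Proof. by move=> fi; apply: (integrable_norm fi). Qed.

Lemma rint_Ml (M : R) h f : measurable_fun setT h -> (forall x, `|h x| <= M) ->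
  rint f -> rint (fun x => h x * f x).
Proof.
move=> mh hM fi; apply: (@rint_le _ (fun x => M * `|f x|)).
- by apply: measurable_funM => //; exact: rint_measurable.
- by apply: rintZl; exact: rint_norm.
- by move=> x; rewrite normrM ler_wpM2r.
Qed.

Lemma rint_Mr (M : R) h f : measurable_fun setT h -> (forall x, `|h x| <= M) ->
  rint f -> rint (fun x => f x * h x).
Proof.
by move=> mh hM /(rint_Ml mh hM); apply: rint_eq => x; rewrite mulrC.
Qed.

Lemma rintE f : rint f -> (\int[mu]_x (f x)%:E)%E = (\int[mu]_x f x)%:E.
Proof.
by move=> fi; rewrite fineK//; apply: integrable_fin_num => //.
Qed.

Lemma rint_lty f : measurable_fun setT f ->
  (\int[mu]_x (`|f x|)%:E < +oo)%E -> rint f.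
Proof. by move=> mf fi; apply/integrableP; split=> //; exact/measurable_EFinP. Qed.

Lemma rIntD f g : rint f -> rint g ->
  \int[mu]_x (f x + g x) = \int[mu]_x f x + \int[mu]_x g x.
Proof. exact: RintegralD. Qed.

Lemma rIntB f g : rint f -> rint g ->
  \int[mu]_x (f x - g x) = \int[mu]_x f x - \int[mu]_x g x.
Proof. exact: RintegralB. Qed.

Lemma rIntZl k f : rint f -> \int[mu]_x (k * f x) = k * \int[mu]_x f x.
Proof. exact: RintegralZl. Qed.

Lemma rIntN f : rint f -> \int[mu]_x (- f x) = - \int[mu]_x f x.
Proof.
move=> fi; rewrite -mulN1r -rIntZl//; apply: eq_Rintegral => x _.
by rewrite mulN1r.
Qed.

Lemma rInt_le f g : rint f -> rint g -> (forall x, f x <= g x) ->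
  \int[mu]_x f x <= \int[mu]_x g x.
Proof. by move=> fi gi fg; apply: le_Rintegral. Qed.

Lemma rInt_norm f : rint f -> `|\int[mu]_x f x| <= \int[mu]_x `|f x|.
Proof. exact: le_normr_Rintegral. Qed.

Lemma rInt_eq f g : f =1 g -> \int[mu]_x f x = \int[mu]_x g x.
Proof. by move=> fg; apply: eq_Rintegral => x _. Qed.

Lemma rInt_ge0 f : (forall x, 0 <= f x) -> 0 <= \int[mu]_x f x.
Proof. by move=> f0; apply: Rintegral_ge0. Qed.

Lemma rInt_normle f g : measurable_fun setT f -> rint g ->
  (forall x, `|f x| <= g x) -> `|\int[mu]_x f x| <= \int[mu]_x g x.
Proof.
move=> mf gi fg; have fi := rint_le mf gi fg.
by apply: (le_trans (rInt_norm fi)); apply: rInt_le => //; exact: rint_norm.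
Qed.

Lemma rint_ae f g : measurable_fun setT g -> rint f ->
  {ae mu, forall x, f x = g x} -> rint g.
Proof.
move=> mg fi fg; apply: rint_lty => //.
rewrite -(@ge0_ae_eq_integral _ _ _ mu setT (fun x => `|f x|%:E)%E) //.
- by have /integrableP[] := fi.
- by apply/measurable_EFinP/measurableT_comp => //; exact: rint_measurable.
- by apply/measurable_EFinP/measurableT_comp.
- by apply: filterS fg => x -> _.
Qed.

Lemma rInt_ae f g : measurable_fun setT f -> measurable_fun setT g ->
  {ae mu, forall x, f x = g x} -> \int[mu]_x f x = \int[mu]_x g x.
Proof.
move=> mf mg fg; congr fine; apply: ae_eq_integral => //;
 try exact/measurable_EFinP.
by apply: filterS fg => x -> _.
Qed.

Lemma rInt_dct (u : nat -> T -> R) f g : (forall n, measurable_fun setT (u n)) ->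
  measurable_fun setT f -> rint g -> (forall n x, `|u n x| <= g x) ->
  {ae mu, forall x, u n x @[n --> \oo] --> f x} ->
  rint f /\ \int[mu]_x u n x @[n --> \oo] --> \int[mu]_x f x.
Proof.
move=> mu_ mf gi ug uf.
have ui n : rint (u n) by exact: (rint_le (mu_ n) gi (ug n)).
have [fi _ H] : [/\ mu.-integrable setT (EFin \o f),
    (fun n => \int[mu]_x (`|(u n x)%:E - (f x)%:E|))%E @ \oo --> 0%E &
    (fun n => \int[mu]_x (u n x)%:E)%E @ \oo --> (\int[mu]_x (f x)%:E)%E].
  apply: (@dominated_convergence _ _ _ mu setT measurableT
    (fun n => EFin \o u n) (EFin \o f) (EFin \o g)) => //.
  - by move=> n; apply/measurable_EFinP.
  - exact/measurable_EFinP.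
  - by apply: filterS uf => x xu _; apply: cvg_EFin => //; exact: nearW.
  - by apply: nearW => x n _ /=; rewrite lee_fin.
split=> //; apply: fine_cvg; rewrite -rintE //.
Qed.

Lemma rInt_dct_cvg (u : nat -> T -> R) f g : (forall n, measurable_fun setT (u n)) ->
  measurable_fun setT f -> rint g -> (forall n x, `|u n x| <= g x) ->
  {ae mu, forall x, u n x @[n --> \oo] --> f x} ->
  \int[mu]_x u n x @[n --> \oo] --> \int[mu]_x f x.
Proof. by move=> mu_ mf gi ug uf; have [] := rInt_dct mu_ mf gi ug uf. Qed.

(** Fatou's lemma as a source of integrability. The bound is on [|f|] because the limit is known to
    be nonnegative only almost everywhere. *)
Lemma rInt_fatou (u : nat -> T -> R) f (C : R) : (forall n, rint (u n)) ->
  measurable_fun setT f -> (forall n x, 0 <= u n x) ->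
  {ae mu, forall x, u n x @[n --> \oo] --> f x} ->
  (forall n, \int[mu]_x u n x <= C) ->
  rint f /\ \int[mu]_x `|f x| <= C.
Proof.
move=> ui mf u0 uf uC.
have H : (\int[mu]_x `|f x|%:E <= C%:E)%E.
  apply: (@le_trans _ _ (\int[mu]_x limn_einf (fun n => (u n x)%:E))%E).
    rewrite le_eqVlt; apply/orP; left; apply/eqP.
    apply: ae_eq_integral => //.
    - by apply/measurable_EFinP/measurableT_comp.
    - apply: measurableT_comp => //; apply: measurable_fun_limn_esup => n.
      apply: measurableT_comp => //.
      by apply/measurable_EFinP; exact: rint_measurable.
    - apply: filterS uf => x xu _.
      have f0 : 0 <= f x.
        have <- : lim (u n x @[n --> \oo]) = f x by exact: cvg_lim.
        by apply: limr_ge; [exact: cvgP xu|exact: nearW].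
      rewrite ger0_norm//; apply/esym.
      have xu' : (u n x)%:E @[n --> \oo] --> (f x)%:E.
        by apply: cvg_EFin => //; exact: nearW.
      by have [] := cvg_limn_einf_sup xu'.
  apply: (le_trans (@fatou _ _ _ mu setT measurableT (fun n x => (u n x)%:E) _ _)) => //.
  - by move=> n; apply/measurable_EFinP; exact: rint_measurable.
  - by move=> n x _; rewrite lee_fin.
  - have -> : (fun n => \int[mu]_x (u n x)%:E)%E = (fun n => (\int[mu]_x u n x)%:E).
      by apply/funext => n; rewrite rintE.
    rewrite limn_einf_lim; apply: lime_le; first exact: is_cvg_einfs.
    apply: nearW => n; apply: (le_trans (ereal_inf_lbound _) (_ : (\int[mu]_x u n x)%:E <= _)%E); last by rewrite lee_fin.
    by exists n => //=.
have fi : rint f.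
  by apply: rint_lty => //; apply: (le_lt_trans H); rewrite ltry.
split=> //.
by rewrite -lee_fin -rintE//; exact: rint_norm.
Qed.

Definition cint (f : T -> R[i]) :=
  rint (fun x => complex.Re (f x)) /\ rint (fun x => complex.Im (f x)).

Definition cInt (f : T -> R[i]) : R[i] :=
  (\int[mu]_x complex.Re (f x)) +i* (\int[mu]_x complex.Im (f x)).

Definition cmeas (f : T -> R[i]) :=
  measurable_fun setT (fun x => complex.Re (f x)) /\
  measurable_fun setT (fun x => complex.Im (f x)).

Lemma cint_cmeas (f : T -> R[i]) : cint f -> cmeas f.
Proof. by move=> [/rint_measurable ? /rint_measurable ?]. Qed.

Lemma cmeas_cst c : cmeas (fun=> c).
Proof. by split; exact: measurable_cst. Qed.

Lemma cmeasD (f g : T -> R[i]) : cmeas f -> cmeas g -> cmeas (fun x => f x + g x).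
Proof.
move=> [fr fi] [gr gi]; split.
- apply: (eq_measurable_fun (fun x => complex.Re (f x) + complex.Re (g x))).
    by move=> x _; case: (f x) (g x) => ? ? [].
  exact: measurable_funD.
- apply: (eq_measurable_fun (fun x => complex.Im (f x) + complex.Im (g x))).
    by move=> x _; case: (f x) (g x) => ? ? [].
  exact: measurable_funD.
Qed.

Lemma cmeasM (f g : T -> R[i]) : cmeas f -> cmeas g -> cmeas (fun x => f x * g x).
Proof.
move=> [fr fi] [gr gi]; split.
- apply: (eq_measurable_fun (fun x => complex.Re (f x) * complex.Re (g x) -
      complex.Im (f x) * complex.Im (g x))).
    by move=> x _; case: (f x) (g x) => ? ? [].
  by apply: measurable_funB; exact: measurable_funM.
- apply: (eq_measurable_fun (fun x => complex.Re (f x) * complex.Im (g x) +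
      complex.Im (f x) * complex.Re (g x))).
    by move=> x _; case: (f x) (g x) => ? ? [].
  by apply: measurable_funD; exact: measurable_funM.
Qed.

Lemma cmeas_real h : measurable_fun setT h -> cmeas (fun x => (h x)%:C).
Proof. by move=> mh; split=> //=. Qed.

Lemma cint_le (f : T -> R[i]) h : cmeas f -> rint h ->
  (forall x, cabs (f x) <= h x) -> cint f.
Proof.
move=> [mr mi] hi fh; split; apply: (@rint_le _ h) => // x;
  apply: le_trans (fh x); [exact: cabs_Re|exact: cabs_Im].
Qed.

Lemma cint_eq (f g : T -> R[i]) : f =1 g -> cint f -> cint g.
Proof. by move=> /funext ->. Qed.

Lemma measurable_cabs (f : T -> R[i]) : cmeas f ->
  measurable_fun setT (fun x => cabs (f x)).
Proof.
move=> [mr mi]; under eq_fun do rewrite cabs_normc.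
have : measurable_fun setT (@Num.sqrt R).
  by apply: continuous_measurable_fun; exact: sqrt_continuous.
by move=> /measurableT_comp; apply; apply: measurable_funD;
  exact: measurable_funX.
Qed.

Lemma cint_cabs (f : T -> R[i]) : cint f -> rint (fun x => cabs (f x)).
Proof.
move=> fi; have [ri ii] := fi.
apply: (@rint_le _ (fun x => `|complex.Re (f x)| + `|complex.Im (f x)|)).
- by apply: measurable_cabs; exact: cint_cmeas.
- by apply: rintD; exact: rint_norm.
- by move=> x; rewrite ger0_norm ?cabs_ge0 ?cabs_sum.
Qed.

Lemma cint_Ml (M : R) (h f : T -> R[i]) : cmeas h -> (forall x, cabs (h x) <= M) ->
  cint f -> cint (fun x => h x * f x).
Proof.
move=> mh hM fi; apply: (@cint_le _ (fun x => M * cabs (f x))).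
- by apply: cmeasM => //; exact: cint_cmeas.
- by apply: rintZl; exact: cint_cabs.
- by move=> x; rewrite cabsM ler_wpM2r// cabs_ge0.
Qed.

Lemma cintD (f g : T -> R[i]) : cint f -> cint g -> cint (fun x => f x + g x).
Proof.
move=> [fr fi] [gr gi]; split.
  by apply: rint_eq (rintD fr gr) => x; case: (f x) (g x) => ? ? [].
by apply: rint_eq (rintD fi gi) => x; case: (f x) (g x) => ? ? [].
Qed.

Lemma cintZ c (f : T -> R[i]) : cint f -> cint (fun x => c * f x).
Proof. by apply: (cint_Ml (cmeas_cst c)) => x; exact: lexx. Qed.

Lemma cIntD (f g : T -> R[i]) : cint f -> cint g ->
  cInt (fun x => f x + g x) = cInt f + cInt g.
Proof.
move=> [fr fi] [gr gi]; apply/eqP; rewrite /cInt eq_complex /=.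
rewrite -(rIntD fr gr) -(rIntD fi gi).
by apply/andP; split; apply/eqP/rInt_eq => x; case: (f x) (g x) => ? ? [].
Qed.

Lemma cIntZ c (f : T -> R[i]) : cint f ->
  cInt (fun x => c * f x) = c * cInt f.
Proof.
move=> [fr fi]; case: c => a b; apply/eqP; rewrite /cInt eq_complex /=.
rewrite -!rIntZl// -rIntB ?rintZl// -rIntD ?rintZl//.
by apply/andP; split; apply/eqP/rInt_eq => x; case: (f x) => ? ? /=; rewrite ?[_ * a]mulrC.
Qed.

Lemma cInt_eq (f g : T -> R[i]) : f =1 g -> cInt f = cInt g.
Proof. by move=> /funext ->. Qed.

Lemma cintN (f : T -> R[i]) : cint f -> cint (fun x => - f x).
Proof. by move=> /(@cintZ (-1)); apply: cint_eq => x; rewrite mulN1r. Qed.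

Lemma cIntN (f : T -> R[i]) : cint f -> cInt (fun x => - f x) = - cInt f.
Proof. by move=> fi; rewrite -mulN1r -cIntZ//; apply: cInt_eq => x; rewrite mulN1r. Qed.

Lemma cintB (f g : T -> R[i]) : cint f -> cint g -> cint (fun x => f x - g x).
Proof. by move=> fi /cintN gi; exact: cintD. Qed.

Lemma cIntB (f g : T -> R[i]) : cint f -> cint g ->
  cInt (fun x => f x - g x) = cInt f - cInt g.
Proof. by move=> fi gi; rewrite cIntD ?cIntN//; exact: cintN. Qed.

(** The factor 2 comes from bounding the real and the imaginary part separately; it reappears in the
    bounds on Cauchy transforms. *)
Lemma cabs_cInt (f : T -> R[i]) h : cmeas f -> rint h ->
  (forall x, cabs (f x) <= h x) -> cabs (cInt f) <= 2 * \int[mu]_x h x.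
Proof.
move=> [mr mi] hi fh; apply: (le_trans (cabs_sum _)) => /=.
rewrite mulr_natl mulr2n lerD//; apply: rInt_normle => // x;
  apply: le_trans (fh x); [exact: cabs_Re|exact: cabs_Im].
Qed.

End RealIntegral.

Lemma measurable_inv_fun d (T : measurableType d) (R : realType) (f : T -> R) :
  measurable_fun setT f -> measurable_fun setT (fun x => (f x)^-1).
Proof.
move=> mf.
(* 1 / a is a times the power -1 of the nonnegative number a^2, and real powers are measurable; both
   sides are 0 at a = 0. *)
have -> : (fun x => (f x)^-1) = (fun x => f x * (f x ^+ 2) `^ (-1)).
  apply/funext => x; rewrite powR_inv1 ?sqr_ge0//.
  have [->|fx0] := eqVneq (f x) 0; first by rewrite invr0 mul0r.
  by field.
apply: measurable_funM => //.
apply: (measurableT_comp (measurable_powR (-1))).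
exact: measurable_funX.
Qed.

Lemma complex_invE (R : realType) (z : R[i]) :
  z^-1 = (complex.Re z / (complex.Re z ^+ 2 + complex.Im z ^+ 2)) -i*
         (complex.Im z / (complex.Re z ^+ 2 + complex.Im z ^+ 2)).
Proof. by case: z. Qed.

Lemma cmeasV d (T : measurableType d) (R : realType) (f : T -> R[i]) :
  cmeas f -> cmeas (fun x => (f x)^-1).
Proof.
move=> [mr mi].
have mn : measurable_fun setT
    (fun x => (complex.Re (f x) ^+ 2 + complex.Im (f x) ^+ 2)^-1).
  by apply: measurable_inv_fun; apply: measurable_funD; exact: measurable_funX.
split; under eq_fun do rewrite complex_invE /=.
- exact: measurable_funM.
- by apply: measurable_funN; exact: measurable_funM.
Qed.

(** * Improper integrals on the line *)

Section Line.
Context (R : realType).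
Notation mu := (@lebesgue_measure R).
Implicit Types (f G : R -> R).

Lemma FTC_segment f G (n : nat) : continuous f ->
  (forall x, is_derive x (1 : R) G (f x)) -> (0 < n)%N ->
  rint mu (fun x => f x * \1_(`[(- n%:R), n%:R]%classic : set R) x) /\
  \int[mu]_x (f x * \1_(`[(- n%:R), n%:R]%classic : set R) x) =
    G n%:R - G (- n%:R).
Proof.
move=> cf dG n0.
have nn : - n%:R < n%:R :> R by rewrite -subr_gt0 opprK addr_gt0// ltr0n.
have fE : (fun x => f x * \1_(`[(- n%:R), n%:R]%classic : set R) x) =
    f \_ (`[(- n%:R), n%:R]%classic).
  by apply/funext => x; rewrite patchE indicE; case: ifP; rewrite ?mulr1 ?mulr0.
have fi : mu.-integrable `[(- n%:R), n%:R] (EFin \o f).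
  apply: continuous_compact_integrable; first exact: segment_compact.
  exact: continuous_subspaceT.
have cG : continuous G.
  by move=> x; apply/differentiable_continuous/derivable1_diffP; have [] := dG x.
split.
  rewrite fE /rint -restrict_EFin.
  have /integrable_mkcond := fi; exact.
rewrite fE -Rintegral_mkcond /Rintegral (@continuous_FTC2 _ f G)//.
- exact: continuous_subspaceT.
- split=> [x _| |]; first by have [] := dG x.
    by apply: cvg_at_right_filter; exact: cG.
  by apply: cvg_at_left_filter; exact: cG.
- by move=> x _; rewrite derive1E; have [] := dG x.
Qed.

Lemma cvg_indic_segment x :
  \1_(`[(- n%:R), n%:R]%classic : set R) x @[n --> \oo] --> (1 : R).
Proof.
apply: cvg_near_cst; near=> n.
rewrite indicE mem_set//= in_itv /= -ler_norml.
by near: n; exact: nbhs_infty_ger.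
Unshelve. all: by end_near. Qed.

Lemma FTC_line f G (l1 l2 : R) : continuous f -> rint mu f ->
  (forall x, is_derive x (1 : R) G (f x)) ->
  G n%:R @[n --> \oo] --> l1 -> G (- n%:R) @[n --> \oo] --> l2 ->
  \int[mu]_x f x = l1 - l2.
Proof.
move=> cf fi dG Gl1 Gl2.
have H : \int[mu]_x (f x * \1_(`[(- n%:R), n%:R]%classic : set R) x)
    @[n --> \oo] --> \int[mu]_x f x.
  apply: (@rInt_dct_cvg _ _ _ mu (fun n x => f x * \1_(`[(- n%:R), n%:R]%classic : set R) x)
    f (fun x => `|f x|)).
  - move=> n; apply: measurable_funM; first exact: rint_measurable fi.
    exact: measurable_indic.
  - exact: rint_measurable fi.
  - exact: rint_norm.
  - move=> n x; rewrite normrM indicE; case: (_ \in _); rewrite ?normr1 ?normr0 ?mulr1//.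
    by rewrite mulr0.
  - apply: nearW => x; rewrite -[X in _ --> X]mulr1.
    by apply: cvgM; [exact: cvg_cst|exact: cvg_indic_segment].
have H2 : G n%:R - G (- n%:R) @[n --> \oo] --> l1 - l2 by exact: cvgB.
suff H3 : G n%:R - G (- n%:R) @[n --> \oo] --> \int[mu]_x f x.
  by apply: (cvg_unique _ H3 H2).
apply: cvg_trans H; apply: near_eq_cvg; near=> n.
by have [] := @FTC_segment f G n cf dG _; [near: n; exists 1%N|].
Unshelve. all: by end_near. Qed.

(** The integrals over [-n, n] are differences of values of [G], hence at most [C + C], and Fatou's
    lemma applies. *)
Lemma rint_FTC f G (C : R) : continuous f -> (forall x, 0 <= f x) ->
  (forall x, is_derive x (1 : R) G (f x)) -> (forall x, `|G x| <= C) ->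
  rint mu f.
Proof.
move=> cf f0 dG GC.
have [|||||//] := @rInt_fatou _ _ R mu
  (fun n x => f x * \1_(`[(- n.+1%:R), n.+1%:R]%classic : set R) x) f (C + C).
- by move=> n; have [] := @FTC_segment f G n.+1 cf dG.
- exact: continuous_measurable_fun.
- by move=> n x; rewrite mulr_ge0// indicE.
- apply: nearW => x; rewrite -[X in _ --> X]mulr1.
  apply: cvgM; first exact: cvg_cst.
  have := @cvg_indic_segment x.
  by rewrite -(cvg_shiftS (fun n => \1_(`[(- n%:R), n%:R]%classic : set R) x : R)).
- move=> n; have [//|_ ->] := @FTC_segment f G n.+1 cf dG.
  by rewrite (le_trans (ler_norm _))// (le_trans (ler_normB _ _))// lerD.
Qed.

(* [kap x dx] is the finite measure used on the whole line. *)
Definition kap (x : R) : R := (1 + x ^+ 2)^-1.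

Lemma kap_gt0 x : 0 < kap x.
Proof. by rewrite invr_gt0 ltr_pwDl// sqr_ge0. Qed.

Lemma continuous_kap : continuous kap.
Proof. exact: (@continuous_oneDsqrV R). Qed.

Lemma atan_bound x : `|@atan R x| <= pi / 2.
Proof. by rewrite ler_norml (ltW (atan_ltpi2 x)) (ltW (atan_gtNpi2 x)). Qed.

Lemma rint_kap : rint mu kap.
Proof.
apply: (@rint_FTC kap atan (pi / 2)).
- exact: continuous_kap.
- by move=> x; exact: ltW (kap_gt0 x).
- exact: atan_bound.
Qed.

Lemma cvg_atan_nat (a b : R) : 0 < b ->
  atan ((n%:R - a) / b) @[n --> \oo] --> (pi / 2 : R).
Proof.
move=> b0; apply: (cvg_comp _ _ _ (@cvgy_atan R)).
apply/cvgryPge => A; near=> n; rewrite ler_pdivlMr// lerBrDr.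
by near: n; exact: nbhs_infty_ger.
Unshelve. all: by end_near. Qed.

Lemma cvg_atan_natN (a b : R) : 0 < b ->
  atan ((- n%:R - a) / b) @[n --> \oo] --> (- (pi / 2) : R).
Proof.
move=> b0; apply: cvg_trans (cvgN (cvg_atan_nat (- a) b0)); apply: near_eq_cvg; apply: nearW => n /=.
by rewrite -[RHS]opprK -atanN -mulNr !opprD !opprK.
Qed.

Lemma is_derive_atan_affine (a b x : R) : 0 < b ->
  is_derive x (1 : R) (fun x => atan ((x - a) / b)) (b / ((x - a) ^+ 2 + b ^+ 2)).
Proof.
move=> b0.
have d1 : is_derive x (1 : R) (fun x : R => (x - a) / b) (b^-1).
  by apply: is_derive_eq; rewrite /GRing.scale/= subr0 mulr1 mulr0 add0r ?mul1r.
have := @is_derive1_comp R atan (fun x : R => (x - a) / b) x _ _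
  (is_derive1_atan ((x - a) / b)) d1.
move=> h; apply: is_derive_eq h _.
have ? : (x - a) ^+ 2 + b ^+ 2 != 0.
  by rewrite gt_eqF// ltr_wpDl ?sqr_ge0// exprn_gt0.
have ? : b != 0 by rewrite gt_eqF.
field; apply/andP; split => //.
Qed.

Lemma is_derive_ln_affine (a b x : R) : 0 < b ->
  is_derive x (1 : R) (fun x => ln ((x - a) ^+ 2 + b ^+ 2) / 2)
   ((x - a) / ((x - a) ^+ 2 + b ^+ 2)).
Proof.
move=> b0.
have h0 : 0 < (x - a) ^+ 2 + b ^+ 2 by rewrite ltr_wpDl ?sqr_ge0// exprn_gt0.
have d1 : is_derive x (1 : R) (fun x : R => (x - a) ^+ 2 + b ^+ 2) (2 * (x - a)).
  by apply: is_derive_eq; rewrite /GRing.scale/=; ring.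
have d2 := @is_derive1_comp R (@ln R) (fun x : R => (x - a) ^+ 2 + b ^+ 2) x _ _
  (is_derive1_ln h0) d1.
have := @is_deriveZ _ _ _ _ (2^-1 : R) _ _ _ d2.
rewrite (_ : _ \*: _ = fun x => ln ((x - a) ^+ 2 + b ^+ 2) / 2); last first.
  by apply/funext => y /=; rewrite /GRing.scale/= mulrC.
move=> h; apply: is_derive_eq h _; rewrite /GRing.scale/=.
by field; rewrite gt_eqF.
Qed.

(** With [s] equal to 1 or -1 this serves both ends of the line. The two logarithms diverge
    separately; dividing their arguments by n^2 leaves logarithms of quantities that tend to 1. *)
Lemma cvg_ln_ratio (a b c e s : R) : 0 < b -> 0 < e -> s ^+ 2 = 1 ->
  ln ((s * n%:R - a) ^+ 2 + b ^+ 2) / 2 - ln ((s * n%:R - c) ^+ 2 + e ^+ 2) / 2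
    @[n --> \oo] --> (0 : R).
Proof.
move=> b0 e0 s1.
have i0 : (n%:R^-1 : R) @[n --> \oo] --> (0 : R) 
  by rewrite -(cvg_shiftS (fun n => n%:R^-1 : R)); exact: cvg_harmonic.
pose q a b n : R := (s - a * n%:R^-1) ^+ 2 + (b * n%:R^-1) ^+ 2.
have q1 a' b' : q a' b' n @[n --> \oo] --> (1 : R).
  have h1 : s - a' * n%:R^-1 @[n --> \oo] --> s.
    rewrite -[X in _ --> X]subr0 -[X in _ - X](mulr0 a').
    by apply: cvgB; [exact: cvg_cst|apply: cvgM => //; exact: cvg_cst].
  have h2 : b' * n%:R^-1 @[n --> \oo] --> (0 : R).
    by rewrite -[X in _ --> X](mulr0 b'); apply: cvgM => //; exact: cvg_cst.
  have -> : (1 : R) = s * s + 0 * 0 by rewrite -expr2 s1; ring.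
  by apply: cvgD; [exact: (cvgM h1 h1)|exact: (cvgM h2 h2)].
have : (ln (q a b n) - ln (q c e n)) / 2 @[n --> \oo] --> ((ln 1 - ln 1) / 2 : R).
  apply: cvgM; last exact: cvg_cst.
  by apply: cvgB; apply: (cvg_comp _ _ (q1 _ _)); exact: continuous_ln.
rewrite subrr mul0r; apply: cvg_trans; apply: near_eq_cvg; near=> n.
have n0 : (0 : R) < n%:R by rewrite ltr0n; near: n; exists 1%N.
have E a' b' : (s * n%:R - a') ^+ 2 + b' ^+ 2 = n%:R ^+ 2 * q a' b' n.
  by rewrite /q; field; rewrite gt_eqF.
have q0 a' b' : 0 < b' -> 0 < q a' b' n.
  move=> b'0; rewrite ltr_wpDl ?sqr_ge0// exprn_gt0// divr_gt0//.
rewrite !E !lnM ?posrE ?q0 ?exprn_gt0//; ring.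
Unshelve. all: by end_near. Qed.

End Line.

(** * Boundary functions on the upper half plane *)

Section Hardy.
Context (R : realType).
Notation mu := (@lebesgue_measure R).
Implicit Types (z p : R[i]).

(** Chosen so that |x - z|^-2 is at most [kapbound z * kap x]. With z = a + ib this amounts to x^2
    <= 2 (x - a)^2 + 2 a^2, that is, (x - 2a)^2 >= 0. *)
Definition kapbound z : R :=
  2 + (1 + 2 * complex.Re z ^+ 2) / complex.Im z ^+ 2.

Lemma sqr_cabs z : cabs z ^+ 2 = complex.Re z ^+ 2 + complex.Im z ^+ 2.
Proof. by rewrite cabs_normc sqr_sqrtr// addr_ge0 ?sqr_ge0. Qed.

Lemma kapbound_gt0 z : 0 < kapbound z.
Proof. by rewrite ltr_pwDl// divr_ge0 ?sqr_ge0// addr_ge0// mulr_ge0// sqr_ge0. Qed.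

Lemma subC_eq0 (x : R) z : complex.Im z != 0 -> x%:C - z != 0.
Proof. by case: z => a b /= b0; rewrite eq_complex /= add0r oppr_eq0 (negbTE b0) andbF. Qed.

Lemma cabs_kernel_sqr (x : R) z : complex.Im z != 0 ->
  cabs (x%:C - z)^-1 ^+ 2 <= kapbound z * kap x.
Proof.
move=> z0; rewrite cabsV exprVn sqr_cabs /kap.
case: z z0 => a b /= b0; rewrite add0r sqrrN /kapbound /=.
have b2 : 0 < b ^+ 2 by rewrite lt_def sqr_ge0 sqrf_eq0 b0.
have h : 0 < (x - a) ^+ 2 + b ^+ 2 by rewrite ltr_wpDl// sqr_ge0.
rewrite -[leLHS]mul1r ler_pdivrMr// mulrAC ler_pdivlMr ?mul1r; last first.
  by rewrite ltr_pwDl// sqr_ge0.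
rewrite mulrDl mulrDr -mulrA [_^-1 * _]mulrDr mulVf ?gt_eqF//.
have : 0 <= (1 + 2 * a ^+ 2) * ((b ^+ 2)^-1 * (x - a) ^+ 2).
  apply: mulr_ge0; first by rewrite addr_ge0// mulr_ge0// sqr_ge0.
  by rewrite mulr_ge0 ?sqr_ge0// ltW// invr_gt0.
rewrite mulrDr mulr1; have := sqr_ge0 (x - 2 * a); nra.
Qed.

Lemma cabs_kernel2 (x : R) z p : complex.Im z != 0 -> complex.Im p != 0 ->
  cabs ((x%:C - z) * (x%:C - p))^-1 <= (kapbound z + kapbound p) * kap x.
Proof.
move=> /(cabs_kernel_sqr x) hz /(cabs_kernel_sqr x) hp.
rewrite invfM cabsM mulrDl; apply: le_trans (lerD hz hp).
set u := cabs _; set v := cabs _.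
have := sqr_ge0 (u - v); have : 0 <= u by exact: cabs_ge0.
have : 0 <= v by exact: cabs_ge0.
nra.
Qed.

Lemma cmeas_subC d (T : measurableType d) (h : T -> R) z :
  measurable_fun setT h -> cmeas (fun x => (h x)%:C - z).
Proof. by move=> mh; apply: cmeasD; [exact: cmeas_real|exact: cmeas_cst]. Qed.

Lemma cmeas_kernel2 z p : cmeas (fun x : R => ((x%:C - z) * (x%:C - p))^-1).
Proof. by apply/cmeasV/cmeasM; exact: cmeas_subC. Qed.

Lemma rint_kapZ (c : R) : rint mu (fun x => c * kap x).
Proof. by apply: rintZl; exact: rint_kap. Qed.

Lemma cint_kernel2 z p : complex.Im z != 0 -> complex.Im p != 0 ->
  cint mu (fun x : R => ((x%:C - z) * (x%:C - p))^-1).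
Proof.
move=> z0 p0; apply: cint_le (rint_kapZ (kapbound z + kapbound p)) _.
  exact: cmeas_kernel2.
by move=> x; exact: cabs_kernel2.
Qed.

Lemma cint_bounded_kernel2 (w : R -> R[i]) (M : R) z p :
  cmeas w -> (forall x, cabs (w x) <= M) ->
  complex.Im z != 0 -> complex.Im p != 0 ->
  cint mu (fun x : R => w x / ((x%:C - z) * (x%:C - p))).
Proof. by move=> mw wM z0 p0; apply: (@cint_Ml _ _ _ mu M w) => //; exact: cint_kernel2. Qed.

Lemma continuous_kernel_Re (a b : R) : 0 < b ->
  continuous (fun x : R => (x - a) / ((x - a) ^+ 2 + b ^+ 2)).
Proof.
move=> b0 x; apply: cvgM; first by apply: cvgB => //; exact: cvg_cst.
apply: cvgV; first by rewrite gt_eqF// ltr_wpDl ?sqr_ge0// exprn_gt0.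
apply: cvgD; last exact: cvg_cst.
rewrite expr2; under eq_cvg do rewrite expr2.
by apply: cvgM; apply: cvgB => //; exact: cvg_cst.
Qed.

Lemma continuous_kernel_Im (a b : R) : 0 < b ->
  continuous (fun x : R => b / ((x - a) ^+ 2 + b ^+ 2)).
Proof.
move=> b0 x; apply: cvgM; first exact: cvg_cst.
apply: cvgV; first by rewrite gt_eqF// ltr_wpDl ?sqr_ge0// exprn_gt0.
apply: cvgD; last exact: cvg_cst.
rewrite expr2; under eq_cvg do rewrite expr2.
by apply: cvgM; apply: cvgB => //; exact: cvg_cst.
Qed.

Lemma continuousDfun (f g : R -> R) : continuous f -> continuous g ->
  continuous (fun x => f x + g x).
Proof. by move=> cf cg x; apply: cvgD; [exact: cf|exact: cg]. Qed.

Lemma continuousBfun (f g : R -> R) : continuous f -> continuous g ->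
  continuous (fun x => f x - g x).
Proof. by move=> cf cg x; apply: cvgB; [exact: cf|exact: cg]. Qed.

Definition twopii : R[i] := 0 +i* (2 * pi).

Lemma kernel_split (x : R) z p : complex.Im z != 0 -> complex.Im p != 0 ->
  z - p != 0 ->
  ((x%:C - z) * (x%:C - p))^-1 = (z - p)^-1 * ((x%:C - z)^-1 - (x%:C - p)^-1).
Proof.
by move=> /(subC_eq0 x) z0 /(subC_eq0 x) p0 zp; field; rewrite z0 p0 zp.
Qed.

Lemma sub_half_planes_neq0 z p : 0 < complex.Im z -> complex.Im p < 0 -> z - p != 0.
Proof.
move=> z0 p0; rewrite subr_eq0; apply/eqP => zp.
by move: z0; rewrite zp ltNge ltW.
Qed.

(** Cauchy's formula for the constant 1, evaluated by primitives after a partial fraction expansion: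
    the logarithms cancel at both ends, and each pole contributes pi through an arctangent. The
    formula for every other boundary function is built from this one by algebra, Fubini's theorem
    and limits. *)
Lemma cInt_kernel2 z p : 0 < complex.Im z -> complex.Im p < 0 ->
  cInt mu (fun x : R => ((x%:C - z) * (x%:C - p))^-1) = twopii / (z - p).
Proof.
move=> z0 p0; have zn0 := gt_eqF z0; have pn0 := lt_eqF p0.
have zp := sub_half_planes_neq0 z0 p0.
have E x := @kernel_split x z p (negbT zn0) (negbT pn0) zp.
have iD : cint mu (fun x : R => (x%:C - z)^-1 - (x%:C - p)^-1).
  apply: cint_eq (cintZ (z - p) (cint_kernel2 (negbT zn0) (negbT pn0))) => x /=.
  by rewrite E mulrA divff// mul1r.
rewrite (cInt_eq mu E) cIntZ// mulrC; congr (_ / _).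
case: iD => iR iI.
move: z0 p0 iR iI => {E zn0 pn0 zp}; case: z => a b; case: p => c e /= b0 e0 iR iI.
have e'0 : 0 < - e by rewrite oppr_gt0.
apply/eqP; rewrite /cInt eq_complex /=; apply/andP; split; apply/eqP.
- have eqR x : complex.Re ((x%:C - (a +i* b))^-1 - (x%:C - (c +i* e))^-1) =
    (x - a) / ((x - a) ^+ 2 + b ^+ 2) - (x - c) / ((x - c) ^+ 2 + (- e) ^+ 2).
    by rewrite !complex_invE /= !add0r sqrrN.
  rewrite (rInt_eq mu eqR) -(subrr (0 : R)).
  apply: (@FTC_line _ _ (fun x => ln ((x - a) ^+ 2 + b ^+ 2) / 2 -
     ln ((x - c) ^+ 2 + (- e) ^+ 2) / 2)).
  + by apply: continuousBfun; exact: continuous_kernel_Re.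
  + by apply: rint_eq iR; exact: eqR.
  + by move=> x; apply: is_deriveB; exact: is_derive_ln_affine.
  + have := @cvg_ln_ratio R a b c (- e) 1 b0 e'0 (expr1n _ _).
    by under eq_fun do rewrite mul1r.
  + have := @cvg_ln_ratio R a b c (- e) (- 1) b0 e'0.
    rewrite sqrrN expr1n => /(_ erefl).
    by under eq_fun do rewrite mulN1r.
- have eqI x : complex.Im ((x%:C - (a +i* b))^-1 - (x%:C - (c +i* e))^-1) =
    b / ((x - a) ^+ 2 + b ^+ 2) + (- e) / ((x - c) ^+ 2 + (- e) ^+ 2).
    by rewrite !complex_invE /= !add0r sqrrN; ring.
  rewrite (rInt_eq mu eqI).
  rewrite (_ : 2 * pi = (pi / 2 + pi / 2) - (- (pi / 2) + - (pi / 2))); last by field.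
  apply: (@FTC_line _ _ (fun x => atan ((x - a) / b) + atan ((x - c) / (- e)))).
  + by apply: continuousDfun; exact: continuous_kernel_Im.
  + by apply: rint_eq iI; exact: eqI.
  + by move=> x; apply: is_deriveD; exact: is_derive_atan_affine.
  + by apply: cvgD; exact: cvg_atan_nat.
  + by apply: cvgD; exact: cvg_atan_natN.
Qed.

(* [w] is the boundary function of the bounded holomorphic function [W]. Cauchy's
   formula for these kernels stands in for holomorphy, and is stable under
   bounded limits. *)
Record hardy (w : R -> R[i]) (W : R[i] -> R[i]) : Prop := Hardy {
  hardy_meas : cmeas w ;
  hardy_bounded : exists M, forall x, cabs (w x) <= M ;
  hardy_cauchy : forall z p, 0 < complex.Im z -> complex.Im p < 0 ->
    cInt mu (fun x : R => w x / ((x%:C - z) * (x%:C - p))) =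
      twopii * W z / (z - p) }.

Lemma hardy_cint w W z p : hardy w W -> 0 < complex.Im z -> complex.Im p < 0 ->
  cint mu (fun x : R => w x / ((x%:C - z) * (x%:C - p))).
Proof.
move=> [mw [M wM] _] z0 p0.
exact: cint_bounded_kernel2 mw wM (lt0r_neq0 z0) (ltr0_neq0 p0).
Qed.

Lemma hardy1 : hardy (fun=> 1) (fun=> 1).
Proof.
split.
- exact: cmeas_cst.
- by exists (cabs 1).
- move=> z p z0 p0; rewrite mulr1 -cInt_kernel2//.
  by apply: cInt_eq => x; rewrite mul1r.
Qed.

Lemma hardyD w1 W1 w2 W2 : hardy w1 W1 -> hardy w2 W2 ->
  hardy (fun x => w1 x + w2 x) (fun z => W1 z + W2 z).
Proof.
move=> h1 h2; split.
- exact: cmeasD (hardy_meas h1) (hardy_meas h2).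
- have [M1 w1M] := hardy_bounded h1; have [M2 w2M] := hardy_bounded h2.
  by exists (M1 + M2) => x; apply: le_trans (cabsD _ _) _; exact: lerD.
- move=> z p z0 p0; rewrite mulrDr mulrDl -(hardy_cauchy h1)// -(hardy_cauchy h2)//.
  rewrite -cIntD; [|exact: hardy_cint h1 z0 p0|exact: hardy_cint h2 z0 p0].
  by apply: cInt_eq => x; rewrite mulrDl.
Qed.

Lemma hardyZ c w W : hardy w W -> hardy (fun x => c * w x) (fun z => c * W z).
Proof.
move=> h; split.
- by apply: cmeasM (hardy_meas h); exact: cmeas_cst.
- have [M wM] := hardy_bounded h; exists (cabs c * M) => x.
  by rewrite cabsM ler_wpM2l// cabs_ge0.
- move=> z p z0 p0; rewrite mulrCA -mulrA -(hardy_cauchy h)// -cIntZ.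
    by apply: cInt_eq => x; rewrite mulrA.
  exact: hardy_cint h z0 p0.
Qed.

Lemma hardy_eq w W w' W' : (forall x, w x = w' x) ->
  (forall z, 0 < complex.Im z -> W z = W' z) -> hardy w W -> hardy w' W'.
Proof.
move=> /funext <- WW' h; split.
- exact: hardy_meas h.
- exact: hardy_bounded h.
- by move=> z p z0 p0; rewrite -WW'//; exact: hardy_cauchy h _ _ z0 p0.
Qed.

(** Componentwise, so that the limit theorems for real functions apply directly. The topology of
    [R[i]] itself enters only with the limit that defines [finite_hilbert]. *)
Definition ccvg (u : nat -> R[i]) (l : R[i]) :=
  complex.Re (u n) @[n --> \oo] --> complex.Re l /\
  complex.Im (u n) @[n --> \oo] --> complex.Im l.

Lemma ccvg_cst l : ccvg (fun=> l) l.
Proof. by split; exact: cvg_cst. Qed.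

Lemma ccvgD u v k l : ccvg u k -> ccvg v l -> ccvg (fun n => u n + v n) (k + l).
Proof.
move=> [ur ui] [vr vi]; split.
- have -> : complex.Re (k + l) = complex.Re k + complex.Re l.
    by case: (k) (l) => ? ? [].
  rewrite (_ : (fun n => complex.Re (u n + v n)) =
    (fun n => complex.Re (u n) + complex.Re (v n))); first exact: cvgD.
  by apply/funext => n; case: (u n) (v n) => ? ? [].
- have -> : complex.Im (k + l) = complex.Im k + complex.Im l.
    by case: (k) (l) => ? ? [].
  rewrite (_ : (fun n => complex.Im (u n + v n)) =
    (fun n => complex.Im (u n) + complex.Im (v n))); first exact: cvgD.
  by apply/funext => n; case: (u n) (v n) => ? ? [].
Qed.

Lemma ccvgM u v k l : ccvg u k -> ccvg v l -> ccvg (fun n => u n * v n) (k * l).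
Proof.
move=> [ur ui] [vr vi]; split.
- have -> : complex.Re (k * l) = complex.Re k * complex.Re l - complex.Im k * complex.Im l.
    by case: (k) (l) => ? ? [].
  rewrite (_ : (fun n => complex.Re (u n * v n)) =
    (fun n => complex.Re (u n) * complex.Re (v n) - complex.Im (u n) * complex.Im (v n))).
    by apply: cvgB; exact: cvgM.
  by apply/funext => n; case: (u n) (v n) => ? ? [].
- have -> : complex.Im (k * l) = complex.Re k * complex.Im l + complex.Im k * complex.Re l.
    by case: (k) (l) => ? ? [].
  rewrite (_ : (fun n => complex.Im (u n * v n)) =
    (fun n => complex.Re (u n) * complex.Im (v n) + complex.Im (u n) * complex.Re (v n))).
    by apply: cvgD; exact: cvgM.
  by apply/funext => n; case: (u n) (v n) => ? ? [].
Qed.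

Lemma ccvg_unique u k l : ccvg u k -> ccvg u l -> k = l.
Proof.
move=> [kr ki] [lr li]; apply/eqP; rewrite eq_complex.
by rewrite (cvg_unique _ kr lr)// (cvg_unique _ ki li)// !eqxx.
Qed.

Lemma cInt_dct d (T : measurableType d) (nu : {measure set T -> \bar R})
    (u : nat -> T -> R[i]) (f : T -> R[i]) (g : T -> R) :
  (forall n, cmeas (u n)) -> cmeas f -> rint nu g ->
  (forall n x, cabs (u n x) <= g x) ->
  {ae nu, forall x, ccvg (fun n => u n x) (f x)} ->
  cint nu f /\ ccvg (fun n => cInt nu (u n)) (cInt nu f).
Proof.
move=> mu_ [mfr mfi] ig ug uf.
have [|||fr cr] := @rInt_dct _ _ _ nu (fun n x => complex.Re (u n x))
  (fun x => complex.Re (f x)) g _ mfr ig.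
- by move=> n; have [] := mu_ n.
- by move=> n x; apply: le_trans (cabs_Re _) (ug n x).
- by apply: filterS uf => x [].
have [|||fi ci] := @rInt_dct _ _ _ nu (fun n x => complex.Im (u n x))
  (fun x => complex.Im (f x)) g _ mfi ig.
- by move=> n; have [] := mu_ n.
- by move=> n x; apply: le_trans (cabs_Im _) (ug n x).
- by apply: filterS uf => x [].
by [].
Qed.

Lemma hardy_lim (u : nat -> R -> R[i]) (U : nat -> R[i] -> R[i]) w W (M : R) :
  (forall n, hardy (u n) (U n)) -> cmeas w ->
  (forall x, cabs (w x) <= M) ->
  (forall n x, cabs (u n x) <= M) ->
  {ae mu, forall x, ccvg (fun n => u n x) (w x)} ->
  (forall z, 0 < complex.Im z -> ccvg (fun n => U n z) (W z)) ->
  hardy w W.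
Proof.
move=> hu mw wM uM uw UW; split; [by []|by exists M|move=> z p z0 p0].
have [|||||_ H] := @cInt_dct _ _ mu
  (fun n x => u n x / ((x%:C - z) * (x%:C - p)))
  (fun x => w x / ((x%:C - z) * (x%:C - p)))
  (fun x => M * ((kapbound z + kapbound p) * kap x)).
- by move=> n; apply: cmeasM; [exact: hardy_meas (hu n)|exact: cmeas_kernel2].
- by apply: cmeasM => //; exact: cmeas_kernel2.
- by apply: rintZl; exact: rint_kapZ.
- move=> n x; rewrite cabsM ler_pM ?cabs_ge0//.
  exact: cabs_kernel2 (lt0r_neq0 z0) (ltr0_neq0 p0).
- apply: (@filterS _ _ (ae_filter_ringOfSetsType mu) _ _ _ uw) => x ux; apply: ccvgM => //; exact: ccvg_cst.
apply: ccvg_unique H _.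
rewrite (_ : (fun _ => _) = (fun n => twopii * U n z / (z - p))); last first.
  by apply/funext => n; rewrite (hardy_cauchy (hu n)).
apply: ccvgM; last exact: ccvg_cst.
by apply: ccvgM; [exact: ccvg_cst|exact: UW].
Qed.

End Hardy.

Lemma ae_imp d (T : measurableType d) (R : realType)
    (nu : {measure set T -> \bar R}) (P Q : T -> Prop) :
  {ae nu, forall x, P x} -> (forall x, P x -> Q x) -> {ae nu, forall x, Q x}.
Proof. by move=> h PQ; apply: filterS h. Qed.

Lemma ae_imp2 d (T : measurableType d) (R : realType)
    (nu : {measure set T -> \bar R}) (P1 P2 Q : T -> Prop) :
  {ae nu, forall x, P1 x} -> {ae nu, forall x, P2 x} ->
  (forall x, P1 x -> P2 x -> Q x) -> {ae nu, forall x, Q x}.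
Proof. by move=> h1 h2 PQ; apply: filterS2 h1 h2. Qed.

Lemma ae_all d (T : measurableType d) (R : realType)
    (nu : {measure set T -> \bar R}) (P : nat -> T -> Prop) :
  (forall n, {ae nu, forall x, P n x}) -> {ae nu, forall x, forall n, P n x}.
Proof.
move=> h; rewrite /prop_near1 /= /nbhs/= /almost_everywhere.
have -> : ~` [set x | forall n, P n x] = \bigcup_n ~` [set x | P n x].
  by rewrite -setC_bigcap; congr (~` _); apply/seteqP; split => [x Hx n _|x Hx n]; [exact: Hx|exact: (Hx n I)].
exact: negligible_bigcup.
Qed.

Lemma cmeas_comp d1 d2 (T1 : measurableType d1) (T2 : measurableType d2)
    (R : realType) (f : T2 -> R[i]) (h : T1 -> T2) :
  cmeas f -> measurable_fun setT h -> cmeas (fun x => f (h x)).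
Proof. by move=> [mr mi] mh; split; [exact: (measurableT_comp mr)|exact: (measurableT_comp mi)]. Qed.

Lemma cmeas_eq d (T : measurableType d) (R : realType) (f g : T -> R[i]) :
  f =1 g -> cmeas f -> cmeas g.
Proof. by move=> /funext ->. Qed.

(** * Fubini's theorem for complex functions *)

Section ComplexFubini.
Context d1 d2 (T1 : measurableType d1) (T2 : measurableType d2) (R : realType).
Variables (m1 : {sigma_finite_measure set T1 -> \bar R})
  (m2 : {sigma_finite_measure set T2 -> \bar R}).

Lemma rint_prod (g : T1 -> R) (h : T2 -> R) : rint m1 g -> rint m2 h ->
  rint (m1 \x m2)%E (fun z => g z.1 * h z.2).
Proof.
move=> gi hi; have mg := rint_measurable gi; have mh := rint_measurable hi.
have mgh : measurable_fun setT (fun z : T1 * T2 => g z.1 * h z.2).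
  by apply: measurable_funM; exact: measurableT_comp.
apply/integrable12ltyP; first exact/measurable_EFinP.
have hE : (\int[m2]_y `|h y|%:E)%E = (\int[m2]_y `|h y|)%:E by rewrite rintE//; exact: rint_norm.
under eq_integral.
  move=> x _; under eq_integral do rewrite /= normrM EFinM.
  rewrite ge0_integralZl//; last by apply/measurable_EFinP/measurableT_comp.
  rewrite hE; over.
rewrite ge0_integralZr//.
- by rewrite (rintE (rint_norm gi)) -EFinM ltry.
- by apply/measurable_EFinP/measurableT_comp.
- by rewrite lee_fin; exact: rInt_ge0.
Qed.

(** The inner integral is finite only for almost every x. Where it is infinite its real version
    takes the value 0, which affects neither integrability nor the outer integral. *)
Lemma rint_Fubini1 (f : T1 * T2 -> R) : rint (m1 \x m2)%E f ->
  rint m1 (fun x => \int[m2]_y f (x, y)) /\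
  \int[m1]_x \int[m2]_y f (x, y) = fine (\int[m1]_x \int[m2]_y (f (x, y))%:E)%E.
Proof.
move=> fi; have Fi := integrable_fubini_F fi.
have mF : measurable_fun setT (fun x => \int[m2]_y f (x, y)).
  by apply: (measurableT_comp (@fine_measurable R setT measurableT)); exact: measurable_int Fi.
split.
  apply: (le_integrable measurableT _ _ Fi); first exact/measurable_EFinP.
  move=> x _ /=; rewrite /Rintegral /fubini_F /=.
  by case: (\int[m2]_y _)%E => //=; rewrite normr0 leey.
congr fine; apply: ae_eq_integral => //; first exact/measurable_EFinP.
  exact: measurable_int Fi.
have := integrable_ae measurableT Fi.
by apply: filterS => x /(_ I) h _; rewrite /Rintegral fineK.
Qed.

Lemma rint_Fubini2 (f : T1 * T2 -> R) : rint (m1 \x m2)%E f ->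
  rint m2 (fun y => \int[m1]_x f (x, y)) /\
  \int[m2]_y \int[m1]_x f (x, y) = fine (\int[m2]_y \int[m1]_x (f (x, y))%:E)%E.
Proof.
move=> fi; have mf := measurable_int _ fi.
have mH : measurable_fun setT (fun y => \int[m1]_x `|f (x, y)|%:E)%E.
  apply: (measurable_fun_fubini_tonelli_G (fun z => `|f z|%:E)%E) => //.
  by apply/measurable_EFinP/measurableT_comp => //; exact/measurable_EFinP.
have Gi : m2.-integrable setT (fubini_G m1 (EFin \o f)).
  apply/integrableP; split; first exact: (@measurable_fubini_G _ _ _ _ _ m1 m2 (EFin \o f) fi).
  apply: le_lt_trans ((integrable21ltyP m1 m2 mf).1 fi).
  apply: ge0_le_integral => //.
    by apply: measurableT_comp => //; exact: (@measurable_fubini_G _ _ _ _ _ m1 m2 (EFin \o f) fi).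
  by move=> y _; apply: le_abse_integral => //; exact: (measurableT_comp mf).
have mG : measurable_fun setT (fun y => \int[m1]_x f (x, y)).
  by apply: (measurableT_comp (@fine_measurable R setT measurableT)); exact: measurable_int Gi.
split.
  apply: (le_integrable measurableT _ _ Gi); first exact/measurable_EFinP.
  move=> y _ /=; rewrite /Rintegral /fubini_G /=.
  by case: (\int[m1]_x _)%E => //=; rewrite normr0 leey.
congr fine; apply: ae_eq_integral => //; first exact/measurable_EFinP.
  exact: measurable_int Gi.
have := integrable_ae measurableT Gi.
by apply: filterS => x /(_ I) h _; rewrite /Rintegral fineK.
Qed.

Lemma rint_Fubini (f : T1 * T2 -> R) : rint (m1 \x m2)%E f ->
  \int[m1]_x \int[m2]_y f (x, y) = \int[m2]_y \int[m1]_x f (x, y).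
Proof.
move=> fi; have [_ ->] := rint_Fubini1 fi; have [_ ->] := rint_Fubini2 fi.
by congr fine; rewrite (Fubini fi).
Qed.

Lemma cint_Fubini (f : T1 * T2 -> R[i]) : cint (m1 \x m2)%E f ->
  [/\ cint m1 (fun x => cInt m2 (fun y => f (x, y))),
      cint m2 (fun y => cInt m1 (fun x => f (x, y))) &
      cInt m1 (fun x => cInt m2 (fun y => f (x, y))) =
      cInt m2 (fun y => cInt m1 (fun x => f (x, y)))].
Proof.
move=> [fr fi]; have [r1 _] := rint_Fubini1 fr; have [r2 _] := rint_Fubini2 fr.
have [i1 _] := rint_Fubini1 fi; have [i2 _] := rint_Fubini2 fi.
split => //; apply/eqP; rewrite eq_complex /=.
by rewrite (rint_Fubini fr) (rint_Fubini fi) !eqxx.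
Qed.

End ComplexFubini.

Lemma cInt_ae d (T : measurableType d) (R : realType)
    (nu : {measure set T -> \bar R}) (f g : T -> R[i]) : cmeas f -> cmeas g ->
  {ae nu, forall x, f x = g x} -> cInt nu f = cInt nu g.
Proof.
move=> [fr fi] [gr gi] fg; apply/eqP; rewrite eq_complex /=.
apply/andP; split; apply/eqP; apply: rInt_ae => //;
  by apply: ae_imp fg _ => x ->.
Qed.

Lemma ae_neq (R : realType) (a : R) : {ae @lebesgue_measure R, forall x : R, x <> a}.
Proof.
exists [set a]; split => [||x /= /contrapT//]; first exact: measurable_set1.
exact: lebesgue_measure_set1.
Qed.

Lemma partial_fraction1 (K : fieldType) (w f x z p q : K) :
  x - z != 0 -> x - p != 0 -> x - q != 0 -> q - p != 0 ->
  w / ((x - z) * (x - p)) * (f / (q - x)) =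
  (q - p)^-1 * f * (w / ((x - z) * (x - p)) - w / ((x - z) * (x - q))).
Proof.
move=> xz xp xq qp; have qx : q - x != 0 by rewrite -opprB oppr_eq0.
by field; rewrite xz xp qp xq qx.
Qed.

Lemma partial_fraction2 (K : fieldType) (w f z p q : K) :
  z - p != 0 -> z - q != 0 -> q - p != 0 ->
  (q - p)^-1 * f * (w / (z - p) - w / (z - q)) = w / (z - p) * (f / (q - z)).
Proof.
move=> zp zq qp; have qz : q - z != 0 by rewrite -opprB oppr_eq0.
by field; rewrite zp qp zq qz.
Qed.

(** * Cauchy transforms *)

Section Cauchy.
Context (R : realType).
Notation mu := (@lebesgue_measure R).
Implicit Types (z p q : R[i]) (f : R -> R[i]).

Definition cauchy f z := cInt mu (fun s : R => f s / (s%:C - z)).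

Lemma cabs_kernel_le (s : R) z : 0 < complex.Im z ->
  cabs (s%:C - z)^-1 <= (complex.Im z)^-1.
Proof.
move=> z0; rewrite cabsV lef_pV2 ?posrE//; last first.
  by rewrite cabs_gt0 subC_eq0// gt_eqF.
rewrite (le_trans _ (cabs_Im _))//; case: z z0 => a b /= b0.
by rewrite add0r normrN ger0_norm// ltW.
Qed.

Lemma cint_cauchy f z : cint mu f -> 0 < complex.Im z ->
  cint mu (fun s : R => f s / (s%:C - z)).
Proof.
move=> fi z0.
have := @cint_Ml _ _ _ mu (complex.Im z)^-1 (fun s : R => (s%:C - z)^-1) f.
move=> h; apply: cint_eq (h _ _ fi) => [x||x]; first by rewrite mulrC.
  by apply: cmeasV; exact: cmeas_subC.
exact: cabs_kernel_le.
Qed.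

Lemma cabs_cauchy f z : cint mu f -> 0 < complex.Im z ->
  cabs (cauchy f z) <= 2 * ((complex.Im z)^-1 * \int[mu]_s cabs (f s)).
Proof.
move=> fi z0; rewrite -rIntZl; last exact: cint_cabs.
apply: cabs_cInt.
- by have := cint_cauchy fi z0; exact: cint_cmeas.
- by apply: rintZl; exact: cint_cabs.
- by move=> x; rewrite cabsM mulrC ler_wpM2r ?cabs_ge0// cabs_kernel_le.
Qed.

Lemma shift_Im (x : R) (e : R) : complex.Im (x%:C + e *i) = e.
Proof. by rewrite /= add0r. Qed.

Lemma shift_ImD z (e : R) : 0 < complex.Im z -> 0 < e -> 0 < complex.Im (z + e *i).
Proof. by case: z => a b /= b0 e0; rewrite addr_gt0. Qed.

Lemma cint_cauchy_prod (w f : R -> R[i]) (e : R) : cint mu w -> cint mu f -> 0 < e ->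
  cint (mu \x mu)%E (fun t : R * R => w t.1 * (f t.2 / (t.2%:C - (t.1%:C + e *i)))).
Proof.
move=> wi fi e0.
apply: (@cint_le _ _ _ (mu \x mu)%E _ (fun t : R * R => cabs (w t.1) * (e^-1 * cabs (f t.2)))).
- apply: cmeasM; first by apply: (@cmeas_comp _ _ _ _ _ w) => //; exact: cint_cmeas wi.
  apply: cmeasM; first by apply: (@cmeas_comp _ _ _ _ _ f) => //; exact: cint_cmeas fi.
  apply: cmeasV.
  rewrite (_ : (fun x : R * R => _) = fun x => (x.2 - x.1)%:C - e *i); last first.
    by apply/funext => -[x s]; congr (_ +i* _) => /=; ring.
  apply: cmeas_subC; exact: measurable_funB.
- apply: (@rint_prod _ _ _ _ _ mu mu (fun x : R => cabs (w x))
    (fun s : R => e^-1 * cabs (f s))); first exact: cint_cabs.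
  by apply: rintZl; exact: cint_cabs.
- move=> [x s] /=; rewrite !cabsM ler_wpM2l ?cabs_ge0// mulrC.
  rewrite ler_wpM2r ?cabs_ge0//.
  by rewrite -[X in _ <= X^-1](shift_Im x) cabs_kernel_le// shift_Im.
Qed.

Lemma cauchyZ c f z : cint mu f -> 0 < complex.Im z ->
  cInt mu (fun s : R => c * (f s / (s%:C - z))) = c * cauchy f z.
Proof. by move=> fi z0; apply: cIntZ; exact: cint_cauchy. Qed.

(** Measurability of this parameter integral is obtained from Fubini's theorem, which asks for an
    integrable function of x as well: the weight [kap] is inserted for that purpose and then divided
    out. *)
Lemma cmeas_cauchy f (e : R) : cint mu f -> 0 < e ->
  cmeas (fun x : R => cauchy f (x%:C + e *i)).
Proof.
move=> fi e0.
have ki : cint mu (fun x : R => (kap x)%:C).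
  by split; [exact: rint_kap|exact: rint0].
have [h _ _] := cint_Fubini (cint_cauchy_prod ki fi e0).
have mk : cmeas (fun x : R => (kap x)%:C^-1).
  by apply: cmeasV; exact: cint_cmeas ki.
apply: cmeas_eq (cmeasM mk (cint_cmeas h)) => x /=.
have xe : 0 < complex.Im (x%:C + e *i) by rewrite shift_Im.
have -> := cauchyZ (kap x)%:C fi xe.
apply: mulKf; rewrite eq_complex /= eqxx andbT.
by rewrite gt_eqF// kap_gt0.
Qed.

(* As a function of [x], the kernel [1 / (s - (x + i e))] has its pole at
   [q = s - i e], in the lower half plane: partial fractions in [p] and [q]. *)
Lemma hardyM w W f (e : R) : hardy w W -> cint mu f -> 0 < e ->
  hardy (fun x => w x * cauchy f (x%:C + e *i)) (fun z => W z * cauchy f (z + e *i)).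
Proof.
move=> hw fi e0; have [mw [M wM] Cw] := hw.
have M0 : 0 <= M by apply: le_trans (cabs_ge0 _) (wM 0).
split.
- by apply: cmeasM => //; exact: cmeas_cauchy.
- exists (M * (2 * (e^-1 * \int[mu]_s cabs (f s)))) => x.
  rewrite cabsM ler_pM ?cabs_ge0//.
  by rewrite -[X in X^-1](shift_Im x) cabs_cauchy// shift_Im.
move=> z p z0 p0.
have ki := hardy_cint hw z0 p0.
have [i1 i2 E] := cint_Fubini (cint_cauchy_prod ki fi e0).
transitivity (cInt mu (fun x : R => cInt mu (fun s : R =>
    w x / ((x%:C - z) * (x%:C - p)) * (f s / (s%:C - (x%:C + e *i)))))).
  apply: cInt_eq => x.
  have xe : 0 < complex.Im (x%:C + e *i) by rewrite shift_Im.
  have -> := cauchyZ (w x / ((x%:C - z) * (x%:C - p))) fi xe.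
  exact: mulrAC.
rewrite [LHS]E /=.
have zp := sub_half_planes_neq0 z0 p0.
transitivity (cInt mu (fun s : R =>
    (twopii R * W z / (z - p)) * (f s / (s%:C - (z + e *i))))); last first.
  have -> := cauchyZ (twopii R * W z / (z - p)) fi (shift_ImD z0 e0).
  by rewrite mulrAC mulrA.
apply: cInt_ae.
- exact: cint_cmeas i2.
- apply: cmeasM; first exact: cmeas_cst.
  exact: cint_cmeas (cint_cauchy fi (shift_ImD z0 e0)).
(* The partial fractions need q different from p, which can fail only for the single value s = Re
   p. *)
- apply: ae_imp (ae_neq (complex.Re p)) _ => s sp.
  pose q : R[i] := s -i* e.
  have q0 : complex.Im q < 0 by rewrite /= oppr_lt0.
  have qp : q - p != 0.
    rewrite subr_eq0; apply/eqP => qp; apply: sp; by rewrite -qp.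
  have zq := sub_half_planes_neq0 z0 q0.
  transitivity ((q - p)^-1 * f s * (cInt mu (fun x : R => w x / ((x%:C - z) * (x%:C - p)))
      - cInt mu (fun x : R => w x / ((x%:C - z) * (x%:C - q))))).
    have iq := hardy_cint hw z0 q0.
    rewrite -(cIntB ki iq) -(cIntZ ((q - p)^-1 * f s) (cintB ki iq)).
    apply: cInt_eq => x.
    have -> : s%:C - (x%:C + e *i) = q - x%:C by congr (_ +i* _) => /=; ring.
    exact: partial_fraction1 (subC_eq0 x (lt0r_neq0 z0)) (subC_eq0 x (ltr0_neq0 p0))
      (subC_eq0 x (ltr0_neq0 q0)) qp.
  rewrite (Cw _ _ z0 p0) (Cw _ _ z0 q0).
  have -> : s%:C - (z + e *i) = q - z.
    by case: (z) => a b; congr (_ +i* _) => /=; ring.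
  exact: (partial_fraction2 (twopii R * W z) (f s) zp zq qp).
Qed.

End Cauchy.

(** * The geometric series and the exponential as limits of polynomials *)

Section ComplexLimits.
Context (R : realType).
Implicit Types (u v : nat -> R[i]) (z k l : R[i]).

Lemma ccvg_cabs u l : cabs (u n - l) @[n --> \oo] --> (0 : R) -> ccvg u l.
Proof.
have Re_sub (x y : R[i]) : complex.Re x - complex.Re y = complex.Re (x - y).
  by case: x y => ? ? [].
have Im_sub (x y : R[i]) : complex.Im x - complex.Im y = complex.Im (x - y).
  by case: x y => ? ? [].
move=> h; split; apply/cvgrPdist_lt => e e0; move/cvgrPdist_lt : h => /(_ e e0);
  apply: filterS => n; rewrite sub0r normrN ger0_norm ?cabs_ge0//; apply: le_lt_trans.
- by rewrite distrC Re_sub cabs_Re.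
- by rewrite distrC Im_sub cabs_Im.
Qed.

Lemma cvg_cabs u l : ccvg u l -> cabs (u n - l) @[n --> \oo] --> (0 : R).
Proof.
have Re_sub (x y : R[i]) : complex.Re (x - y) = complex.Re x - complex.Re y.
  by case: x y => ? ? [].
have Im_sub (x y : R[i]) : complex.Im (x - y) = complex.Im x - complex.Im y.
  by case: x y => ? ? [].
move=> [ur ui].
apply: (@squeeze_cvgr _ _ _ _ (fun=> 0)
  (fun n => `|complex.Re (u n) - complex.Re l| + `|complex.Im (u n) - complex.Im l|)).
- by apply: nearW => n; rewrite cabs_ge0 -Re_sub -Im_sub cabs_sum.
- exact: cvg_cst.
- rewrite -[X in _ --> X]addr0; apply: cvgD.
    by rewrite -(normr0 R) -{1}(subrr (complex.Re l)); apply: cvg_norm; apply: cvgB => //; exact: cvg_cst.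
  by rewrite -(normr0 R) -{1}(subrr (complex.Im l)); apply: cvg_norm; apply: cvgB => //; exact: cvg_cst.
Qed.

Lemma ccvg_eq u v l : (forall n, u n = v n) -> ccvg u l -> ccvg v l.
Proof. by move=> /funext ->. Qed.

Lemma cvg_geometric0 (r : R) : 0 <= r -> r < 1 -> r ^+ n @[n --> \oo] --> (0 : R).
Proof. by move=> r0 r1; apply: cvg_expr; rewrite ger0_norm. Qed.

Lemma ccvg_geometric (r : R[i]) (q : R) : cabs r <= q -> q < 1 ->
  ccvg (fun n => \sum_(i < n) r ^+ i) (1 - r)^-1.
Proof.
move=> rq q1; have r1 : 1 - r != 0.
  rewrite subr_eq0; apply/eqP => h; move: rq; rewrite -h.
  by rewrite (cabs_real 1) normr1 leNgt q1.
apply: ccvg_cabs.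
have E n : \sum_(i < n) r ^+ i - (1 - r)^-1 = - ((1 - r)^-1 * r ^+ n).
  apply: (mulfI r1); rewrite mulrBr mulrN mulrA divff// mul1r.
  rewrite -[X in X * _]opprB mulNr -subrX1 opprB addrAC subrr.
  exact: sub0r.
rewrite (_ : (fun n => _) = fun n => cabs (1 - r)^-1 * cabs r ^+ n); last first.
  by apply/funext => n; rewrite E cabsN cabsM cabsX.
rewrite -[X in _ --> X](mulr0 (cabs (1 - r)^-1)); apply: cvgM; first exact: cvg_cst.
by apply: cvg_geometric0; [exact: cabs_ge0|exact: le_lt_trans rq q1].
Qed.

Lemma cabs1 : cabs (1 : R[i]) = 1.
Proof. by rewrite (cabs_real 1) normr1. Qed.

Lemma cabs_sum_geometric (r : R[i]) (q : R) n : cabs r <= q -> q < 1 ->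
  cabs (\sum_(i < n) r ^+ i) <= (1 - q)^-1.
Proof.
move=> rq q1; have q0 : 0 <= q by apply: le_trans (cabs_ge0 r) rq.
have h : cabs (\sum_(i < n) r ^+ i) <= \sum_(i < n) q ^+ i.
  elim: n => [|n IH]; first by rewrite !big_ord0 (cabs_real 0) normr0.
  rewrite !big_ord_recr /=; apply: le_trans (cabsD _ _) _.
  by rewrite lerD// cabsX lerXn2r// ?nnegrE ?cabs_ge0.
apply: (le_trans h); have q1' : 0 < 1 - q by rewrite subr_gt0.
rewrite -[leRHS]mul1r ler_pdivlMr// mulrC -opprB mulNr -subrX1 opprB.
by rewrite gerBl exprn_ge0.
Qed.

Definition cexp z : R[i] :=
  (expR (complex.Re z) * cos (complex.Im z)) +i*
  (expR (complex.Re z) * sin (complex.Im z)).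

Lemma cexpD z k : cexp (z + k) = cexp z * cexp k.
Proof.
case: z k => a b [c d]; rewrite /cexp /= expRD cosD sinD.
by congr (_ +i* _) => /=; ring.
Qed.

Lemma cexp0 : cexp 0 = 1.
Proof. by rewrite /cexp /= expR0 cos0 sin0 mulr0 mulr1. Qed.

Lemma cexp_iter z n : cexp (z *+ n) = cexp z ^+ n.
Proof.
elim: n => [|n IH]; first by rewrite mulr0n expr0 cexp0.
by rewrite mulrS exprS cexpD IH.
Qed.

Lemma cabs_cexp z : cabs (cexp z) = expR (complex.Re z).
Proof.
rewrite cabs_normc /= !exprMn -mulrDr cos2Dsin2 mulr1 sqrtr_sqr.
by rewrite ger0_norm// expR_ge0.
Qed.

Lemma cabs_subX z k (M : R) n : cabs z <= M -> cabs k <= M ->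
  cabs (z ^+ n.+1 - k ^+ n.+1) <= n.+1%:R * M ^+ n * cabs (z - k).
Proof.
move=> zM kM; have M0 : 0 <= M by apply: le_trans (cabs_ge0 z) zM.
elim: n => [|n IH]; first by rewrite !expr1 expr0 mulr1 mul1r.
have -> : z ^+ n.+2 - k ^+ n.+2 = z * (z ^+ n.+1 - k ^+ n.+1) + (z - k) * k ^+ n.+1.
  by rewrite mulrBr mulrBl -!exprS addrA subrK.
apply: le_trans (cabsD _ _) _; rewrite !cabsM cabsX.
have -> : n.+2%:R * M ^+ n.+1 * cabs (z - k) =
    M * (n.+1%:R * M ^+ n * cabs (z - k)) + cabs (z - k) * M ^+ n.+1.
  by rewrite -natr1 exprS; ring.
apply: lerD; first by apply: ler_pM => //; exact: cabs_ge0.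
by rewrite ler_wpM2l ?cabs_ge0// lerXn2r// ?nnegrE ?cabs_ge0.
Qed.

Lemma derive_scale_nat (f : R -> R) (l : R) : is_derive (0 : R) (1 : R) f l ->
  n.+1%:R * (f n.+1%:R^-1 - f 0) @[n --> \oo] --> l.
Proof.
move=> df; have [d e] := df; rewrite -e.
have h0 : (n.+1%:R^-1 : R) @[n --> \oo] --> (0 : R)^'.
  move=> A /= [e0 /= e00 hA].
  have := @cvg_harmonic R; move=> /cvgrPdist_lt /(_ e0 e00) [N _ hN].
  exists N => // n nN /=; apply: hA; last by rewrite invr_neq0.
  by have := hN n nN; rewrite /= /harmonic.
have := cvg_comp _ _ h0 d; apply: cvg_trans; apply: near_eq_cvg; apply: nearW => n /=.
by rewrite /GRing.scale /= invrK mulr1 addr0.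
Qed.

Lemma is_derive_expcos (a b : R) :
  is_derive (0 : R) (1 : R) (fun t => expR (t * a) * cos (t * b)) a.
Proof.
have h1 (c x : R) : is_derive x (1 : R) (fun t : R => t * c) c.
  by apply: is_derive_eq; rewrite /GRing.scale/= mulr0 add0r mulr1.
have d1 := @is_derive1_comp R (@expR R) (fun t => t * a) 0 _ _ (is_derive_expR (0 * a)) (h1 a 0).
have d2 := @is_derive1_comp R (@cos R) (fun t => t * b) 0 _ _ (is_derive_cos (0 * b)) (h1 b 0).
apply: (is_derive_eq (is_deriveM d1 d2)); rewrite /GRing.scale /=.
by rewrite !mul0r expR0 cos0 sin0; ring.
Qed.

Lemma is_derive_expsin (a b : R) :
  is_derive (0 : R) (1 : R) (fun t => expR (t * a) * sin (t * b)) b.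
Proof.
have h1 (c x : R) : is_derive x (1 : R) (fun t : R => t * c) c.
  by apply: is_derive_eq; rewrite /GRing.scale/= mulr0 add0r mulr1.
have d1 := @is_derive1_comp R (@expR R) (fun t => t * a) 0 _ _ (is_derive_expR (0 * a)) (h1 a 0).
have d2 := @is_derive1_comp R (@sin R) (fun t => t * b) 0 _ _ (is_derive_sin (0 * b)) (h1 b 0).
apply: (is_derive_eq (is_deriveM d1 d2)); rewrite /GRing.scale /=.
by rewrite !mul0r expR0 cos0 sin0; ring.
Qed.

(** A polynomial in [z], bounded by [expR (cabs z)] whatever [n]: these are the two properties that
    let the exponential of a Cauchy transform inherit Cauchy's formula through [hardy_lim]. *)
Definition cexp_approx z (n : nat) : R[i] := (1 + (n.+1%:R^-1)%:C * z) ^+ n.+1.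

Lemma cabs_cexp_approx z n : cabs (cexp_approx z n) <= expR (cabs z).
Proof.
rewrite cabsX; have -> : expR (cabs z) = expR (n.+1%:R^-1 * cabs z) ^+ n.+1.
  by rewrite -expRM_natl mulrA divff ?mul1r// pnatr_eq0.
rewrite lerXn2r// ?nnegrE ?cabs_ge0 ?expR_ge0//.
apply: le_trans (cabsD _ _) _; rewrite cabs1 cabsM cabs_real ger0_norm ?invr_ge0//.
exact: expR_ge1Dx.
Qed.

(** Put m = n + 1 and w = z / m, so that exp z = (exp w)^m. The difference of the m-th powers of exp
    w and 1 + w is at most exp |z| times m |exp w - 1 - w|, and m (exp w - 1) tends to z because the
    exponential has derivative 1 at 0. *)
Lemma ccvg_cexp_approx z : ccvg (cexp_approx z) (cexp z).
Proof.
apply: ccvg_cabs.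
pose w n : R[i] := (n.+1%:R^-1)%:C * z.
pose err n : R[i] := (n.+1%:R)%:C * (cexp (w n) - 1) - z.
have errE n : (n.+1%:R)%:C * (cexp (w n) - (1 + w n)) = err n.
  rewrite /err opprD addrA mulrBr; congr (_ - _).
  rewrite /w mulrA -rmorphM /= divff ?pnatr_eq0//.
  exact: mul1r.
have wE n : w n = (n.+1%:R^-1 * complex.Re z) +i* (n.+1%:R^-1 * complex.Im z).
  by rewrite /w; case: (z) => a b /=; congr (_ +i* _); ring.
have err0 : cabs (err n) @[n --> \oo] --> (0 : R).
  apply: (cvg_trans _ (@cvg_cabs (fun n => (n.+1%:R)%:C * (cexp (w n) - 1)) z _)); first exact: cvg_refl.
  split.
  - have := derive_scale_nat (is_derive_expcos (complex.Re z) (complex.Im z)).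
    rewrite !mul0r expR0 cos0 mulr1; apply: cvg_trans; apply: near_eq_cvg.
    by apply: nearW => n; rewrite wE /cexp /=; ring.
  - have := derive_scale_nat (is_derive_expsin (complex.Re z) (complex.Im z)).
    rewrite !mul0r expR0 sin0 mulr0; apply: cvg_trans; apply: near_eq_cvg.
    by apply: nearW => n; rewrite wE /cexp /=; ring.
apply: (@squeeze_cvgr _ _ _ _ (fun=> 0) (fun n => expR (cabs z) * cabs (err n))).
- apply: nearW => n; rewrite cabs_ge0 /=.
  have -> : cexp z = cexp (w n) ^+ n.+1.
    rewrite -cexp_iter; congr cexp; rewrite /w -mulrnAl -rmorphMn /= -mulr_natl divff ?pnatr_eq0//.
    exact/esym/mul1r.
  have kM : cabs (1 + w n) <= expR (n.+1%:R^-1 * cabs z).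
    apply: le_trans (cabsD _ _) _; rewrite cabs1 cabsM cabs_real ger0_norm ?invr_ge0//.
    exact: expR_ge1Dx.
  have zM : cabs (cexp (w n)) <= expR (n.+1%:R^-1 * cabs z).
    rewrite cabs_cexp ler_expR wE /= ler_wpM2l ?invr_ge0//.
    by apply: le_trans (ler_norm _) (cabs_Re z).
  rewrite -cabsN opprB; apply: le_trans (cabs_subX n zM kM) _.
  rewrite -errE cabsM cabs_real ger0_norm// [leRHS]mulrCA -mulrA ler_wpM2l//.
  rewrite ler_wpM2r ?cabs_ge0//.
  rewrite -expRM_natl ler_expR mulrA ler_piMl ?cabs_ge0//.
  by rewrite ler_pdivrMr ?mul1r ?ler_nat.
- exact: cvg_cst.
- by rewrite -[X in _ --> X](mulr0 (expR (cabs z))); apply: cvgM => //; exact: cvg_cst.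
Qed.

End ComplexLimits.

Lemma affine_geometric (K : fieldType) (a L w : K) (S : K) : L != 0 -> w != 0 ->
  S = (1 - (1 - w / L))^-1 -> L^-1 * S = w^-1.
Proof. by move=> L0 w0 ->; rewrite opprB addrC subrK invf_div mulrA mulVf// mul1r. Qed.

(** * Poisson's formula; resolvents and exponentials of Cauchy transforms *)

Section HardyExamples.
Context (R : realType).
Notation mu := (@lebesgue_measure R).
Implicit Types (z p q : R[i]) (f : R -> R).

Definition cF f z := cauchy (fun s => (f s)%:C) z.

Definition pois (t y x : R) := y / ((x - t) ^+ 2 + y ^+ 2).

Definition cpois (t y x : R) := (x - t) / ((x - t) ^+ 2 + y ^+ 2).

(* Conjugate Poisson and Poisson integrals, without the factor [1 / pi]. *)
Definition Qf f (y t : R) := complex.Re (cF f (t +i* y)).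

Definition Pf f (y t : R) := complex.Im (cF f (t +i* y)).

Lemma cint_realC f : rint mu f -> cint mu (fun s : R => (f s)%:C).
Proof. by move=> fi; split=> //; exact: rint0. Qed.

Lemma cF_eta f y t : cF f (t +i* y) = Qf f y t +i* Pf f y t.
Proof. by rewrite /Qf /Pf; case: (cF _ _). Qed.

Lemma shiftE (x e : R) : x%:C + e *i = x +i* e.
Proof. by congr (_ +i* _) => /=; rewrite ?addr0 ?add0r. Qed.

Lemma pois_gt0 t y x : 0 < y -> 0 < pois t y x.
Proof. by move=> y0; rewrite divr_gt0// ltr_wpDl ?sqr_ge0// exprn_gt0. Qed.

Lemma pois01 x : pois 0 1 x = kap x.
Proof. by rewrite /pois /kap subr0 expr1n addrC mul1r. Qed.

Lemma QfE f y t : Qf f y t = \int[mu]_s (f s * cpois t y s).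
Proof.
apply: rInt_eq => s; rewrite complex_invE /cpois /=.
by rewrite sub0r sqrrN mul0r subr0.
Qed.

Lemma PfE f y t : Pf f y t = \int[mu]_s (f s * pois t y s).
Proof.
apply: rInt_eq => s; rewrite complex_invE /pois /=.
by rewrite sub0r sqrrN mul0r addr0 mulNr opprK.
Qed.

Lemma rint_cF f y t : rint mu f -> 0 < y ->
  rint mu (fun s : R => f s * cpois t y s) /\ rint mu (fun s : R => f s * pois t y s).
Proof.
move=> fi y0; have [r1 r2] := @cint_cauchy R _ (t +i* y) (cint_realC fi) y0.
split.
  apply: rint_eq r1 => s; rewrite complex_invE /cpois /=.
  by rewrite sub0r sqrrN mul0r subr0.
apply: rint_eq r2 => s; rewrite complex_invE /pois /=.
by rewrite sub0r sqrrN mul0r addr0 mulNr opprK.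
Qed.

Lemma cF_lin f g h (a : R) z : rint mu f -> rint mu g -> 0 < complex.Im z ->
  (forall s, h s = f s + a * g s) -> cF h z = cF f z + a%:C * cF g z.
Proof.
move=> /cint_realC fi /cint_realC gi z0 hE.
have i1 := cint_cauchy fi z0; have i2 := cint_cauchy gi z0.
rewrite /cF /cauchy -(cIntZ a%:C i2) -(cIntD i1 (cintZ a%:C i2)).
by apply: cInt_eq => s; rewrite hE rmorphD rmorphM /= mulrDl mulrA.
Qed.

Lemma cFZ f h (a : R) z : rint mu f -> 0 < complex.Im z ->
  (forall s, h s = a * f s) -> cF h z = a%:C * cF f z.
Proof.
move=> /cint_realC fi z0 hE; have i1 := cint_cauchy fi z0.
rewrite /cF /cauchy -(cIntZ a%:C i1).
by apply: cInt_eq => s; rewrite hE rmorphM /= mulrA.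
Qed.

Lemma cabs_cF f z : rint mu f -> 0 < complex.Im z ->
  cabs (cF f z) <= 2 * ((complex.Im z)^-1 * \int[mu]_s `|f s|).
Proof.
move=> fi z0; apply: le_trans (cabs_cauchy (cint_realC fi) z0) _.
by rewrite (_ : \int[mu]_s cabs _ = \int[mu]_s `|f s|)//; apply: rInt_eq => s; rewrite cabs_real.
Qed.

Lemma Pf_ge0 f y t : 0 < y -> (forall s, 0 <= f s) -> 0 <= Pf f y t.
Proof.
move=> y0 f0; rewrite PfE; apply: rInt_ge0 => s.
by rewrite mulr_ge0// ltW// pois_gt0.
Qed.

Lemma poisC t y x : 0 < y -> (pois t y x)%:C =
  y%:C * ((x%:C - (t +i* y)) * (x%:C - (t -i* y)))^-1.
Proof.
move=> y0; have -> : (x%:C - (t +i* y)) * (x%:C - (t -i* y)) = ((x - t) ^+ 2 + y ^+ 2)%:C.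
  by congr (_ +i* _) => /=; ring.
by rewrite /pois rmorphM fmorphV.
Qed.

(** Cauchy's formula with [p] the conjugate of [z]: the product of the two kernels is then |x -
    z|^-2, the Poisson kernel up to the factor y. *)
Lemma hardy_poisson w W t y : hardy w W -> 0 < y ->
  cint mu (fun x : R => w x * (pois t y x)%:C) /\
  cInt mu (fun x : R => w x * (pois t y x)%:C) = pi%:C * W (t +i* y).
Proof.
move=> hw y0; pose z : R[i] := t +i* y; pose p : R[i] := t -i* y.
have z0 : 0 < complex.Im z by [].
have p0 : complex.Im p < 0 by rewrite /= oppr_lt0.
have E x : w x * (pois t y x)%:C = y%:C * (w x / ((x%:C - z) * (x%:C - p))).
  by rewrite (poisC t x y0) mulrCA.
have ki := hardy_cint hw z0 p0.
split; first by apply: cint_eq (cintZ y%:C ki) => x; exact: esym (E x).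
have -> := cInt_eq mu E; have -> := cIntZ y%:C ki.
have -> := hardy_cauchy hw z0 p0.
have zp := sub_half_planes_neq0 z0 p0.
have e1 : y%:C * twopii R = pi%:C * (z - p).
  by rewrite /z /p /twopii; congr (_ +i* _) => /=; ring.
rewrite mulrA mulrA e1 -!mulrA; congr (_ * _); rewrite mulrC -mulrA mulVf//.
exact: mulr1.
Qed.

Lemma hardy_poisson_Re w W t y : hardy w W -> 0 < y ->
  rint mu (fun x : R => complex.Re (w x) * pois t y x) /\
  \int[mu]_x (complex.Re (w x) * pois t y x) = pi * complex.Re (W (t +i* y)).
Proof.
move=> hw y0; have [[h1 _] h2] := hardy_poisson t hw y0.
have E x : complex.Re (w x * (pois t y x)%:C) = complex.Re (w x) * pois t y x.
  by case: (w x) => a b /=; rewrite mulr0 subr0.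
split; first by apply: rint_eq h1; exact: E.
have := congr1 (@complex.Re R) h2; rewrite /cInt /=; have -> := rInt_eq mu E.
by move=> ->; case: (W _) => a b /=; rewrite mul0r subr0.
Qed.

(** Since [kap] is the Poisson kernel at the point i, an integral against it is the value of a
    bounded holomorphic function at i. The estimates for [Qf] are all obtained by bounding such a
    value. *)
Lemma hardy_kap_Re w W : hardy w W ->
  rint mu (fun x : R => complex.Re (w x) * kap x) /\
  \int[mu]_x (complex.Re (w x) * kap x) = pi * complex.Re (W 'i).
Proof.
move=> /(@hardy_poisson_Re _ _ 0 1) /(_ ltr01).
by rewrite (_ : pois 0 1 = @kap R)//; apply/funext => x; exact: pois01.
Qed.

Lemma rint_pois t y : 0 < y -> rint mu (pois t y).
Proof.
move=> /(hardy_poisson_Re t (hardy1 R)) [h _].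
by apply: rint_eq h => x /=; rewrite mul1r.
Qed.

Lemma int_pois t y : 0 < y -> \int[mu]_x pois t y x = pi.
Proof.
move=> /(hardy_poisson_Re t (hardy1 R)) [_ h].
by rewrite -[RHS]mulr1 -h; apply: rInt_eq => x /=; rewrite mul1r.
Qed.

Lemma int_kap : \int[mu]_x kap x = pi.
Proof. by rewrite -(int_pois 0 ltr01); apply: rInt_eq => x; rewrite pois01. Qed.

Lemma measurable_pois t y : 0 < y -> measurable_fun setT (pois t y).
Proof. by move=> y0; have := rint_measurable (rint_pois t y0). Qed.

Lemma Pf_bound f (M : R) y t : rint mu f -> 0 < y -> (forall s, `|f s| <= M) ->
  `|Pf f y t| <= M * pi.
Proof.
move=> fi y0 fM; rewrite PfE -(int_pois t y0) -rIntZl; last exact: rint_pois.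
apply: rInt_normle.
- by have [_ /rint_measurable] := rint_cF t fi y0.
- by apply: rintZl; exact: rint_pois.
- by move=> s; rewrite normrM (gtr0_norm (pois_gt0 _ _ y0)) ler_wpM2r// ltW// pois_gt0.
Qed.

Lemma hardy_affine w W f (e : R) (a b : R[i]) : hardy w W -> rint mu f -> 0 < e ->
  hardy (fun x => (a + b * cF f (x +i* e)) * w x)
        (fun z => (a + b * cF f (z + e *i)) * W z).
Proof.
move=> hw fi e0.
apply: hardy_eq (hardyD (hardyZ a hw) (hardyZ b (hardyM hw (cint_realC fi) e0))).
- by move=> x; rewrite shiftE /cF [in RHS]mulrDl -mulrA; congr (_ + _ * _); exact: mulrC.
- by move=> z z0; rewrite /cF [in RHS]mulrDl -mulrA; congr (_ + _ * _); exact: mulrC.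
Qed.

Lemma hardy_affineX f (e : R) (a b : R[i]) n : rint mu f -> 0 < e ->
  hardy (fun x => (a + b * cF f (x +i* e)) ^+ n)
        (fun z => (a + b * cF f (z + e *i)) ^+ n).
Proof.
move=> fi e0; elim: n => [|n IH].
  by apply: hardy_eq (hardy1 R) => [x|z _]; rewrite expr0.
by apply: hardy_eq (hardy_affine a b IH fi e0) => [x|z _]; rewrite exprS.
Qed.

Lemma hardy0 : hardy (fun=> 0 : R[i]) (fun=> 0).
Proof.
by apply: hardy_eq (hardyZ 0 (hardy1 R)) => [x|z _]; exact: mul0r.
Qed.

Lemma hardy_geometric f (e : R) (a b : R[i]) n : rint mu f -> 0 < e ->
  hardy (fun x => \sum_(i < n) (a + b * cF f (x +i* e)) ^+ i)
        (fun z => \sum_(i < n) (a + b * cF f (z + e *i)) ^+ i).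
Proof.
move=> fi e0; elim: n => [|n IH].
  by apply: hardy_eq hardy0 => [x|z _]; rewrite big_ord0.
by apply: hardy_eq (hardyD IH (hardy_affineX a b n fi e0)) => [x|z _];
  rewrite big_ord_recr.
Qed.

Lemma cmeas_cF f e : rint mu f -> 0 < e -> cmeas (fun x : R => cF f (x +i* e)).
Proof.
move=> fi e0; apply: cmeas_eq (cmeas_cauchy (cint_realC fi) e0) => x.
by rewrite /cF shiftE.
Qed.

Lemma cabs_cF_shift f (e : R) z : rint mu f -> 0 < e -> 0 <= complex.Im z ->
  cabs (cF f (z + e *i)) <= 2 * (e^-1 * \int[mu]_s `|f s|).
Proof.
move=> fi e0; case: z => a b /= b0.
have h : 0 < b + e by rewrite ltr_wpDl.
apply: le_trans (@cabs_cF f ((a +i* b) + e *i) fi h) _ => /=.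
rewrite ler_wpM2l// ler_wpM2r//; first by apply: rInt_ge0.
by rewrite lef_pV2 ?posrE// lerDr.
Qed.

Lemma Im_cF_ge0 f z : 0 < complex.Im z -> (forall s, 0 <= f s) ->
  0 <= complex.Im (cF f z).
Proof. by case: z => t y y0 f0; exact: (Pf_ge0 t y0 f0). Qed.

(** Let w = 1 - iF, N = K + 1 and c = 1 / N^2. Then Re w >= 1 and |w| <= N, so that |1 - cw|^2 = 1 -
    2c Re w + c^2 |w|^2 <= 1 - 2c + c = 1 - c, which is at most (1 - c/2)^2. *)
Lemma resolvent_contraction (F : R[i]) (K : R) : 0 <= complex.Im F -> cabs F <= K ->
  cabs (1 - (1 - 'i * F) / ((K + 1) ^+ 2)%:C) <= 1 - (2 * (K + 1) ^+ 2)^-1.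
Proof.
move=> F0 FK; pose N := K + 1; rewrite -/N; have K0 : 0 <= K by apply: le_trans (cabs_ge0 F) FK.
have N1 : 1 <= N by rewrite lerDr.
have N0 : 0 < N by exact: lt_le_trans N1.
have NN1 : 1 <= N ^+ 2 by exact: exprn_ege1.
have NN0 : 0 < N ^+ 2 by exact: lt_le_trans NN1.
set w := 1 - 'i * F.
have w1 : 1 <= complex.Re w.
  by move: F0; rewrite /w; case: (F) => a b /= b0; rewrite mul0r mul1r sub0r opprK lerDl.
have wN : cabs w <= N.
  by apply: le_trans (cabsB _ _) _; rewrite cabs1 cabsM addrC lerD2r
    (_ : cabs 'i = 1) ?mul1r// cabs_normc /= expr0n expr1n add0r sqrtr1.
have w2 : complex.Re w ^+ 2 + complex.Im w ^+ 2 <= N ^+ 2.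
  by rewrite -sqr_cabs lerXn2r// ?nnegrE ?cabs_ge0// ltW.
set c := (N ^+ 2)^-1.
have c0 : 0 < c by rewrite invr_gt0.
have c1 : c <= 1 by rewrite invf_le1.
have rE : 1 - (2 * N ^+ 2)^-1 = 1 - c / 2 by rewrite invfM mulrC.
have wE : w / (N ^+ 2)%:C = (complex.Re w * c) +i* (complex.Im w * c).
  rewrite -fmorphV -/c; case: (w) => a b.
  by congr (_ +i* _) => /=; ring.
have q0 : 0 <= 1 - c / 2 by rewrite subr_ge0 ler_pdivrMr// mul1r (le_trans c1)// ler1n.
rewrite rE -(@ler_pXn2r _ 2) ?nnegrE ?cabs_ge0// sqr_cabs wE /=.
have cN : c * N ^+ 2 = 1 by rewrite mulVf// gt_eqF.
move: w1 w2; set a := complex.Re w; set b := complex.Im w => w1 w2.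
have h1 : (a ^+ 2 + b ^+ 2) * c ^+ 2 <= c.
  apply: (@le_trans _ _ (N ^+ 2 * c ^+ 2)); first by rewrite ler_wpM2r// sqr_ge0.
  by rewrite expr2 mulrA [N ^+ 2 * c]mulrC cN mul1r.
have h2 : c <= a * c by rewrite ler_peMl// ltW.
have h3 : 0 <= (c / 2) ^+ 2 by exact: sqr_ge0.
rewrite sub0r sqrrN; nra.
Qed.

Lemma cabs_resolvent_le1 (F : R[i]) : 0 <= complex.Im F -> cabs (1 - 'i * F)^-1 <= 1.
Proof.
case: F => a b /= b0; rewrite cabsV invf_le1; last first.
  rewrite cabs_gt0 eq_complex /=; apply/nandP; left.
  by rewrite mul0r mul1r sub0r opprK gt_eqF// ltr_pwDl.
apply: le_trans (_ : `|complex.Re (1 - 'i * (a +i* b))| <= _); last exact: cabs_Re.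
by rewrite /= mul0r mul1r sub0r opprK ger0_norm ?addr_ge0// lerDl.
Qed.

Lemma resolvent_neq0 (F : R[i]) : 0 <= complex.Im F -> 1 - 'i * F != 0.
Proof.
case: F => a b /= b0; rewrite eq_complex /=; apply/nandP; left.
by rewrite mul0r mul1r sub0r opprK gt_eqF// ltr_pwDl.
Qed.

(* Neumann series: dividing [1 - i F], whose real part is at least 1, by a large
   [L] makes [1 - (1 - i F) / L] a strict contraction. *)
Lemma hardy_resolvent f (e : R) : rint mu f -> (forall s, 0 <= f s) -> 0 < e ->
  hardy (fun x => (1 - 'i * cF f (x +i* e))^-1)
        (fun z => (1 - 'i * cF f (z + e *i))^-1).
Proof.
move=> fi f0 e0.
pose K : R := 2 * (e^-1 * \int[mu]_s `|f s|).
pose N := K + 1; pose L : R[i] := (N ^+ 2)%:C.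
pose q : R := 1 - (2 * N ^+ 2)^-1.
have K0 : 0 <= K by rewrite mulr_ge0// mulr_ge0 ?invr_ge0 ?(ltW e0)//; exact: rInt_ge0.
have NN0 : 0 < N ^+ 2 by rewrite exprn_gt0// ltr_wpDl.
have q1 : q < 1 by rewrite gtrDl oppr_lt0 invr_gt0 mulr_gt0.
have L0 : L != 0 by rewrite eq_complex /= negb_and gt_eqF.
(* The ratio 1 - (1 - iF) / L, written as an affine function of F as [hardy_geometric] expects. *)
pose r (F : R[i]) := (1 - L^-1) + ('i / L) * F.
have rE F : r F = 1 - (1 - 'i * F) / L.
  by rewrite /r mulrBl mul1r opprB addrAC addrA mulrAC.
have rq F : 0 <= complex.Im F -> cabs F <= K -> cabs (r F) <= q.
  by move=> F0 FK; rewrite rE; exact: resolvent_contraction.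
have lim F : 0 <= complex.Im F -> cabs F <= K ->
    ccvg (fun n => L^-1 * \sum_(i < n) r F ^+ i) (1 - 'i * F)^-1.
  move=> F0 FK.
  have -> : (1 - 'i * F)^-1 = L^-1 * (1 - r F)^-1.
    apply/esym; apply: (@affine_geometric _ 0 L) => //; first exact: resolvent_neq0.
    by rewrite rE.
  by apply: ccvgM; [exact: ccvg_cst|exact: ccvg_geometric (rq _ F0 FK) q1].
have FxK x : cabs (cF f (x +i* e)) <= K.
  by rewrite -shiftE; exact: (@cabs_cF_shift f e x%:C).
have Fx0 x : 0 <= complex.Im (cF f (x +i* e)) by exact: Im_cF_ge0.
have FzK z : 0 < complex.Im z -> cabs (cF f (z + e *i)) <= K.
  by move=> z0; apply: cabs_cF_shift => //; exact: ltW.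
have Fz0 z : 0 < complex.Im z -> 0 <= complex.Im (cF f (z + e *i)).
  by move=> z0; apply: Im_cF_ge0 => //; exact: shift_ImD.
apply: (@hardy_lim R
  (fun n x => L^-1 * \sum_(i < n) r (cF f (x +i* e)) ^+ i)
  (fun n z => L^-1 * \sum_(i < n) r (cF f (z + e *i)) ^+ i) _ _ (Num.max 1 (cabs L^-1 * (1 - q)^-1))).
- by move=> n; apply: hardyZ; exact: hardy_geometric.
- apply: cmeasV; apply: cmeasD; first exact: cmeas_cst.
  apply: (@cmeas_eq _ _ _ (fun x : R => - 'i * cF f (x +i* e))).
    by move=> x; exact: mulNr.
  by apply: cmeasM; [exact: cmeas_cst|exact: cmeas_cF].
- by move=> x; rewrite le_max; apply/orP; left; exact: cabs_resolvent_le1.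
- move=> n x; rewrite le_max; apply/orP; right.
  rewrite cabsM ler_wpM2l ?cabs_ge0//.
  by apply: cabs_sum_geometric => //; apply: rq.
- by apply: nearW => x; apply: lim.
- by move=> z z0; apply: lim; [exact: Fz0|exact: FzK].
Qed.

Lemma hardy_cexp f (e : R) : rint mu f -> 0 < e ->
  hardy (fun x => cexp (cF f (x +i* e))) (fun z => cexp (cF f (z + e *i))).
Proof.
move=> fi e0; pose K : R := 2 * (e^-1 * \int[mu]_s `|f s|).
have FxK x : cabs (cF f (x +i* e)) <= K.
  by rewrite -shiftE; exact: (@cabs_cF_shift f e x%:C).
apply: (@hardy_lim R
  (fun n x => cexp_approx (cF f (x +i* e)) n)
  (fun n z => cexp_approx (cF f (z + e *i)) n) _ _ (expR K)).
- by move=> n; exact: hardy_affineX.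
- have [mr mi] := cmeas_cF fi e0.
  split; apply: measurable_funM; try exact: (measurableT_comp (@measurable_expR R)).
  + apply: (measurableT_comp _ mi); apply: continuous_measurable_fun; exact: continuous_cos.
  + apply: (measurableT_comp _ mi); apply: continuous_measurable_fun; exact: continuous_sin.
- move=> x; rewrite cabs_cexp ler_expR (le_trans (ler_norm _))//.
  by rewrite (le_trans (cabs_Re _)).
- by move=> n x; apply: le_trans (cabs_cexp_approx _ _) _; rewrite ler_expR.
- by apply: nearW => x; exact: ccvg_cexp_approx.
- by move=> z z0; exact: ccvg_cexp_approx.
Qed.

End HardyExamples.

Lemma add_quadruple (R : realFieldType) (p e a b : R) :
  a <= 2 * (p * e) -> b <= 2 * (p * e) -> a + b <= 4 * p * e.
Proof. lra. Qed.

(** * Weak type and exponential estimates *)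

Section Estimates.
Context (R : realType).
Notation mu := (@lebesgue_measure R).
Implicit Types (f u v : R -> R).

Lemma kap_ge0 (x : R) : 0 <= kap x. Proof. exact: ltW (kap_gt0 x). Qed.

(* A gauge for convergence in measure. *)
Definition rho u := \int[mu]_x (Num.min 1 `|u x| * kap x).

Lemma rint_min1_kap u : measurable_fun setT u ->
  rint mu (fun x => Num.min 1 `|u x| * kap x).
Proof.
move=> mu_; apply: (@rint_le _ _ _ mu _ (@kap R)); last 2 first.
- exact: rint_kap.
- move=> x; rewrite normrM (gtr0_norm (kap_gt0 x)) ler_piMl ?kap_ge0//.
  by rewrite ger0_norm ?le_min ?ler01//= ge_min lexx.
- apply: measurable_funM; last exact: rint_measurable (rint_kap R).
  by apply: measurable_minr => //; exact: measurableT_comp.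
Qed.

Lemma min1D (a b : R) : 0 <= a -> 0 <= b ->
  Num.min 1 (a + b) <= Num.min 1 a + Num.min 1 b.
Proof. by move=> a0 b0; rewrite /Num.min; do ! case: ifPn; lra. Qed.

Lemma rhoD u v : measurable_fun setT u -> measurable_fun setT v ->
  rho (fun x => u x + v x) <= rho u + rho v.
Proof.
move=> mu_ mv; rewrite /rho -rIntD; [|exact: rint_min1_kap..].
apply: rInt_le.
- by apply: rint_min1_kap; exact: measurable_funD.
- by apply: rintD; exact: rint_min1_kap.
- move=> x; rewrite -mulrDl ler_wpM2r ?kap_ge0//.
  apply: le_trans (min1D (normr_ge0 (u x)) (normr_ge0 (v x))).
  by rewrite le_min !ge_min lexx /= ler_normD orbT.
Qed.

Lemma rho_eq u v : u =1 v -> rho u = rho v.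
Proof. by move=> /funext ->. Qed.

Lemma rho_le u (l : R) (h : R -> R) : 0 <= l -> measurable_fun setT u ->
  rint mu (fun x => h x * kap x) ->
  (forall x, Num.min 1 `|u x| <= l + h x) ->
  rho u <= pi * l + \int[mu]_x (h x * kap x).
Proof.
move=> l0 mu_ ih uh.
have -> : pi * l = \int[mu]_x (l * kap x).
  by rewrite rIntZl ?int_kap 1?mulrC//; exact: rint_kap.
rewrite -rIntD//; last exact: rint_kapZ.
apply: rInt_le; [exact: rint_min1_kap| |].
  by apply: rintD => //; exact: rint_kapZ.
by move=> x; rewrite -mulrDl ler_wpM2r ?kap_ge0.
Qed.

(** If [|a| <= 1], the term [l] suffices. Otherwise the left side is at most 1, and with D = (1 +
    b)^2 + a^2 the last term is 2 (D - (1 + b)) / D, which is at least 1 because D >= (1 + b)^2 + 1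
    >= 2 (1 + b). *)
Lemma min1_resolvent (l a b : R) : 0 <= l -> 0 <= b ->
  Num.min 1 `|l * a| <=
    l + 2 * complex.Re (1 - (1 - 'i * (a +i* b))^-1).
Proof.
move=> l0 b0; rewrite complex_invE /= mul0r mul1r sub0r opprK.
rewrite (_ : (0 - (0 * b + 1 * a)) ^+ 2 = a ^+ 2); last by ring.
rewrite normrM (ger0_norm l0) /=.
set D := (1 + b) ^+ 2 + a ^+ 2.
have D0 : 0 < D by rewrite ltr_pwDl ?sqr_ge0// exprn_gt0// ltr_pwDl.
have -> : 1 - (1 + b) / D = (D - (1 + b)) / D by rewrite mulrBl divff// gt_eqF.
have h0 : 0 <= (D - (1 + b)) / D.
  by rewrite divr_ge0 ?(ltW D0)// /D; have := sqr_ge0 a; nra.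
have [a1|a1] := leP `|a| 1.
  rewrite (@le_trans _ _ l)//; last by rewrite lerDl mulr_ge0.
  by rewrite ge_min; apply/orP; right; rewrite ler_piMr.
rewrite (@le_trans _ _ 1)//; first by rewrite ge_min lexx.
have : 1 <= 2 * ((D - (1 + b)) / D).
  rewrite mulrA ler_pdivlMr// mul1r.
  have : 1 < a ^+ 2.
    by rewrite -(real_normK (num_real a)) -[1](expr1n _ 2) ltrXn2r// ?nnegrE.
  by rewrite /D; nra.
by lra.
Qed.

(* Kolmogorov's weak type inequality: [Re (1 - 1 / (1 - i F))] is nonnegative,
   and at least 1/2 where [|Re F| >= 1]. *)
Lemma rho_Qf f (l e : R) : rint mu f -> (forall s, 0 <= f s) -> 0 < l -> 0 < e ->
  rho (Qf f e) <= pi * l + 4 * pi * (l^-1 * \int[mu]_s f s).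
Proof.
move=> fi f0 l0 e0.
(* Dividing by [l] moves the threshold [|Qf f e x| = l] to 1. *)
pose g s := l^-1 * f s.
have gi : rint mu g by exact: rintZl.
have g0 s : 0 <= g s by rewrite mulr_ge0// invr_ge0 ltW.
have gE z : 0 < complex.Im z -> cF g z = (l^-1)%:C * cF f z.
  by move=> z0; apply: cFZ => //.
pose W z : R[i] := 1 - (1 - 'i * cF g (z + e *i))^-1.
have hW : hardy (fun x => 1 - (1 - 'i * cF g (x +i* e))^-1) W.
  apply: hardy_eq (hardyD (hardy1 R) (hardyZ (- 1) (hardy_resolvent gi g0 e0))) => [x|z _];
    by congr (_ + _); exact: mulN1r.
have [ih hE] := hardy_kap_Re hW.
have ih2 : rint mu (fun x => 2 * complex.Re (1 - (1 - 'i * cF g (x +i* e))^-1) * kap x).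
  by apply: rint_eq (rintZl 2 ih) => x; rewrite mulrA.
have [mQ _] := cmeas_cF fi e0.
have QE x : Qf f e x = l * Qf g e x.
  rewrite /Qf gE//; case: (cF f _) => a b /=.
  by rewrite mul0r subr0 mulrA divff ?mul1r// gt_eqF.
have step : rho (Qf f e) <= pi * l +
    \int[mu]_x (2 * complex.Re (1 - (1 - 'i * cF g (x +i* e))^-1) * kap x).
  apply: rho_le (ltW l0) mQ ih2 _ => x; rewrite -/(Qf f e x) QE (cF_eta g).
  by apply: min1_resolvent (ltW l0) _; exact: Pf_ge0.
apply: (le_trans step); rewrite lerD2l.
have -> : \int[mu]_x (2 * complex.Re (1 - (1 - 'i * cF g (x +i* e))^-1) * kap x) =
    2 * (pi * complex.Re (W 'i)).
  by rewrite -hE -rIntZl//; apply: rInt_eq => x; rewrite mulrA.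
have ie : 0 < complex.Im ('i + e *i : R[i]) by rewrite /= addr_gt0.
have Fi0 : 0 <= complex.Im (cF g ('i + e *i)) by exact: Im_cF_ge0.
(* In this form W(i) is a Cauchy transform times a factor of modulus at most 1, which makes the
   bound linear in the integral of [f]. *)
have WE : W 'i = - 'i * cF g ('i + e *i) * (1 - 'i * cF g ('i + e *i))^-1.
  rewrite /W; have := resolvent_neq0 Fi0; set w := 'i * _ => w0.
  rewrite mulNr -/w -[X in X - _](divff w0) -[X in _ - X]mul1r -mulrBl addrAC subrr.
  by congr (_ / _); exact: sub0r.
have WF : complex.Re (W 'i) <= cabs (cF g ('i + e *i)).
  apply: le_trans (ler_norm _) _; apply: le_trans (cabs_Re _) _.
  rewrite WE !cabsM cabsN (_ : cabs 'i = 1) ?mul1r; last first.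
    by rewrite cabs_normc /= expr0n expr1n add0r sqrtr1.
  by rewrite ler_piMr ?cabs_ge0// cabs_resolvent_le1.
have FE : cabs (cF g ('i + e *i)) <= 2 * (l^-1 * \int[mu]_s f s).
  apply: le_trans (cabs_cF gi ie) _.
  rewrite ler_wpM2l//.
  have -> : \int[mu]_s `|g s| = l^-1 * \int[mu]_s f s.
    by rewrite -rIntZl//; apply: rInt_eq => s; rewrite ger0_norm.
  rewrite ler_piMl//.
    by rewrite mulr_ge0 ?invr_ge0 ?(ltW l0)//; exact: rInt_ge0.
  by rewrite invf_le1//= lerDl ltW.
have pi0 : 0 <= pi :> R by exact: pi_ge0.
have := le_trans WF FE; nra.
Qed.

Lemma hardy_diff f (e1 e2 : R) : rint mu f -> 0 < e1 -> 0 < e2 ->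
  hardy (fun x => (cF f (x +i* e1) - cF f (x +i* e2)) ^+ 2)
        (fun z => (cF f (z + e1 *i) - cF f (z + e2 *i)) ^+ 2).
Proof.
move=> fi e10 e20.
have step w W : hardy w W -> hardy
    (fun x => (cF f (x +i* e1) - cF f (x +i* e2)) * w x)
    (fun z => (cF f (z + e1 *i) - cF f (z + e2 *i)) * W z).
  move=> hw.
  apply: hardy_eq (hardyD (hardy_affine 0 1 hw fi e10) (hardy_affine 0 (-1) hw fi e20))
    => [x|z _]; rewrite -mulrDl; congr (_ * _); rewrite !add0r mulN1r;
    by congr (_ - _); exact: mul1r.
apply: hardy_eq (step _ _ (step _ _ (hardy1 R))) => [x|z _]; rewrite expr2;
  by congr (_ * _); exact: mulr1.
Qed.

(* [(F(z + i e1) - F(z + i e2)) ^ 2] has real part [dQ ^ 2 - dP ^ 2]. *)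
Lemma Qf_L2 f (e1 e2 : R) : rint mu f -> 0 < e1 -> 0 < e2 ->
  (exists M, forall s, `|f s| <= M) ->
  rint mu (fun x => (Qf f e1 x - Qf f e2 x) ^+ 2 * kap x) /\
  \int[mu]_x ((Qf f e1 x - Qf f e2 x) ^+ 2 * kap x) =
  \int[mu]_x ((Pf f e1 x - Pf f e2 x) ^+ 2 * kap x) +
  pi * complex.Re ((cF f ('i + e1 *i) - cF f ('i + e2 *i)) ^+ 2).
Proof.
move=> fi e10 e20 [M fM].
have [ih hE] := hardy_kap_Re (hardy_diff fi e10 e20).
have [_ mP1] := cmeas_cF fi e10; have [_ mP2] := cmeas_cF fi e20.
have iP : rint mu (fun x => (Pf f e1 x - Pf f e2 x) ^+ 2 * kap x).
  apply: (@rint_Ml _ _ _ mu ((M * pi + M * pi) ^+ 2)).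
  - by apply: measurable_funX; exact: measurable_funB.
  - move=> x; rewrite normrX lerXn2r ?nnegrE//.
      have : 0 <= M * pi by apply: le_trans (Pf_bound 0 fi e10 fM); exact: normr_ge0.
      by move=> h; rewrite addr_ge0.
    by apply: le_trans (ler_normB _ _) _; apply: lerD; exact: Pf_bound.
  - exact: rint_kap.
have E x : complex.Re ((cF f (x +i* e1) - cF f (x +i* e2)) ^+ 2) * kap x +
    (Pf f e1 x - Pf f e2 x) ^+ 2 * kap x = (Qf f e1 x - Qf f e2 x) ^+ 2 * kap x.
  rewrite -mulrDl; congr (_ * _); rewrite !cF_eta expr2 /=.
  by ring.
split; first by apply: rint_eq (rintD ih iP) => x; exact: E.
by rewrite -(rInt_eq mu E) rIntD// hE addrC.
Qed.

Lemma cos_ge_half (b : R) : `|b| <= pi / 4 -> 1 / 2 <= cos b.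
Proof.
move=> hb; have pi0 : 0 <= pi :> R by exact: pi_ge0.
move: hb; rewrite ler_norml => /andP[b1 b2].
have c0 : 0 <= cos b by apply: cos_ge0_pihalf; lra.
have c2 : 0 <= cos (b + b) by apply: cos_ge0_pihalf; lra.
move: c2; rewrite cosD -!expr2 => c2.
have := cos2Dsin2 b; have := cos_le1 b; nra.
Qed.

(* [|Im F| <= pi / 4], so that [exp (Re F) <= 2 Re (exp F)]. *)
Lemma expR_Qf f (e : R) : rint mu f -> 0 < e -> (forall s, `|f s| <= 4^-1) ->
  rint mu (fun x => expR (`|Qf f e x|) * kap x) /\
  \int[mu]_x (expR (`|Qf f e x|) * kap x) <=
     4 * pi * expR (2 * \int[mu]_s `|f s|).
Proof.
move=> fi e0 f4.
have one g : rint mu g -> (forall s, `|g s| <= 4^-1) ->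
    rint mu (fun x => expR (Qf g e x) * kap x) /\
    \int[mu]_x (expR (Qf g e x) * kap x) <= 2 * (pi * expR (2 * \int[mu]_s `|g s|)).
  move=> gi g4; have [ih hE] := hardy_kap_Re (hardy_cexp gi e0).
  have [mQ _] := cmeas_cF gi e0.
  have H x : expR (Qf g e x) * kap x <= 2 * (complex.Re (cexp (cF g (x +i* e))) * kap x).
    rewrite mulrA ler_wpM2r ?kap_ge0// cF_eta /=.
    have := @Pf_bound _ g 4^-1 e x gi e0 g4; rewrite [_ * pi]mulrC => /cos_ge_half h.
    have := expR_gt0 (Qf g e x); nra.
  have i1 : rint mu (fun x => expR (Qf g e x) * kap x).
    apply: rint_le (rintZl 2 ih) _.
    - apply: measurable_funM; last exact: rint_measurable (rint_kap R).
      exact: (measurableT_comp (@measurable_expR R)).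
    - by move=> x; rewrite ger0_norm ?H// mulr_ge0 ?expR_ge0// ltW// kap_gt0.
  split=> //; apply: (le_trans (rInt_le i1 (rintZl 2 ih) H)).
  rewrite rIntZl// hE ler_wpM2l// ler_wpM2l ?pi_ge0//.
  apply: le_trans (ler_norm _) _; apply: le_trans (cabs_Re _) _.
  rewrite cabs_cexp ler_expR; apply: le_trans (ler_norm _) _.
  apply: le_trans (cabs_Re _) _.
  have ie : 0 < complex.Im ('i + e *i : R[i]) by rewrite /= addr_gt0.
  apply: le_trans (cabs_cF gi ie) _; rewrite ler_wpM2l// ler_piMl//.
    exact: rInt_ge0.
  by rewrite invf_le1//= lerDl ltW.
have [i1 h1] := one f fi f4.
have [i2 h2] : rint mu (fun x => expR (- Qf f e x) * kap x) /\
    \int[mu]_x (expR (- Qf f e x) * kap x) <= 2 * (pi * expR (2 * \int[mu]_s `|f s|)).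
  have [||i2 h2] := one (fun s => (- 1) * f s).
  - exact: rintZl.
  - by move=> s; rewrite mulN1r normrN.
  have E x : Qf (fun s => (- 1) * f s) e x = - Qf f e x.
    rewrite /Qf (@cFZ _ f _ (- 1) (x +i* e))//.
    by case: (cF f _) => a b /=; rewrite mul0r subr0 mulN1r.
  have EE x : expR (Qf (fun s => (- 1) * f s) e x) * kap x = expR (- Qf f e x) * kap x.
    by rewrite E.
  split; first by apply: rint_eq i2.
  rewrite -(rInt_eq mu EE); apply: le_trans h2 _; rewrite ler_wpM2l// ler_wpM2l ?pi_ge0//.
  by rewrite (rInt_eq mu (_ : _ =1 (fun s => `|f s|)))// => s; rewrite mulN1r normrN.
have H x : expR `|Qf f e x| * kap x <= expR (Qf f e x) * kap x + expR (- Qf f e x) * kap x.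
  rewrite -mulrDl ler_wpM2r ?kap_ge0//.
  by case: (ger0P (Qf f e x)) => _; [rewrite lerDl|rewrite lerDr]; exact: expR_ge0.
have i3 : rint mu (fun x => expR `|Qf f e x| * kap x).
  apply: rint_le (rintD i1 i2) _.
  - apply: measurable_funM; last exact: rint_measurable (rint_kap R).
    apply: (measurableT_comp (@measurable_expR R)).
    by apply: measurableT_comp => //; have [] := cmeas_cF fi e0.
  - by move=> x; rewrite ger0_norm ?H// mulr_ge0 ?expR_ge0// ltW// kap_gt0.
split=> //; apply: le_trans (rInt_le i3 (rintD i1 i2) H) _.
by rewrite (rIntD i1 i2); exact: add_quadruple h1 h2.
Qed.

End Estimates.

Section FiniteSums.
Context d (T : measurableType d) (R : realType) (nu : {measure set T -> \bar R}).

Lemma rint_sum (f : nat -> T -> R) n : (forall k, rint nu (f k)) ->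
  rint nu (fun x => \sum_(k < n) f k x) /\
  \int[nu]_x (\sum_(k < n) f k x) = \sum_(k < n) \int[nu]_x f k x.
Proof.
move=> fi; elim: n => [|n [IH1 IH2]].
  split; first by apply: rint_eq (rint0 nu) => x; rewrite big_ord0.
  rewrite big_ord0 (_ : (fun x => _) = (fun=> 0)).
    by rewrite /Rintegral integral0.
  by apply/funext => x; rewrite big_ord0.
have E x : \sum_(k < n) f k x + f n x = \sum_(k < n.+1) f k x.
  by rewrite big_ord_recr.
split; first by apply: rint_eq (rintD IH1 (fi n)).
by rewrite -(rInt_eq nu E) rIntD// IH2 big_ord_recr.
Qed.

End FiniteSums.

(** * Poisson integrals at Lebesgue points *)

Section PoissonLebesgue.
Context (R : realType).
Notation mu := (@lebesgue_measure R).
Implicit Types (f : R -> R).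

Definition ind_ball (t r x : R) : R := \1_(ball t r : set R) x.

Lemma ind_ballE t r x : ind_ball t r x = if `|x - t| < r then 1 else 0.
Proof.
rewrite /ind_ball indicE; case: ifP => h.
  by rewrite mem_set// /ball /= distrC.
by rewrite memNset// /ball /= distrC h.
Qed.

Lemma ind_ball_ge0 t r x : 0 <= ind_ball t r x.
Proof. by rewrite ind_ballE; case: ifP. Qed.

Lemma measurable_ind_ball t r : measurable_fun setT (ind_ball t r).
Proof. by apply: measurable_indic; exact: measurable_ball. Qed.

(** In the shell where |x - t| lies between 2^(k-1) y and 2^k y the kernel is at most 1 / (4^(k-1)
    y) = 4 / (4^k y). Indicators of balls replace those of shells because Lebesgue points control
    averages over balls. *)
Lemma pois_dyadic (t y x : R) n : 0 < y -> `|x - t| < 2 ^+ n * y ->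
  pois t y x <= \sum_(k < n.+1) (4 / (4 ^+ k * y)) * ind_ball t (2 ^+ k * y) x.
Proof.
move=> y0; have y2 : 0 < y ^+ 2 by rewrite exprn_gt0.
have t0 k : 0 <= (4 / (4 ^+ k * y)) * ind_ball t (2 ^+ k * y) x.
  by rewrite mulr_ge0 ?ind_ball_ge0// divr_ge0// mulr_ge0// ltW.
have D0 : 0 < (x - t) ^+ 2 + y ^+ 2 by rewrite ltr_wpDl ?sqr_ge0.
elim: n => [|n IH] xt.
  rewrite big_ord1 ind_ballE xt mulr1 expr0 mul1r /pois ler_pdivrMr// mulrAC ler_pdivlMr//.
  by rewrite -expr2; have := sqr_ge0 (x - t); nra.
rewrite big_ord_recr /=; have [h|h] := ltP `|x - t| (2 ^+ n * y).
  by apply: (le_trans (IH h)); rewrite lerDl.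
rewrite -[leLHS]add0r lerD//; first by apply: sumr_ge0.
rewrite ind_ballE xt mulr1 exprS -mulrA invfM mulrA divff// mul1r.
have h2 : 4 ^+ n * y ^+ 2 <= (x - t) ^+ 2.
  rewrite -(real_normK (num_real (x - t))) (_ : 4 = 2 ^+ 2 :> R); last by ring.
  rewrite exprAC -exprMn lerXn2r// ?nnegrE//.
  by rewrite mulr_ge0 ?exprn_ge0// ltW.
have p4 : 0 < 4 ^+ n * y by rewrite mulr_gt0// exprn_gt0.
rewrite /pois -[leRHS]mul1r ler_pdivrMr// mulrAC ler_pdivlMr// mul1r.
by apply: le_trans (_ : 4 ^+ n * y ^+ 2 <= _); rewrite ?lerDl//; nra.
Qed.

(** Away from t the kernel is y times a function dominated by [kap]. The factor y makes the far part
    vanish with y, so integrability against [kap] is enough for [f]. *)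
Lemma pois_far (t y x r : R) : 0 < r -> 0 < y -> r <= `|x - t| ->
  pois t y x <= y * (((1 + 2 * t ^+ 2) / r ^+ 2 + 2) * kap x).
Proof.
move=> r0 y0 rx; have r2 : 0 < r ^+ 2 by rewrite exprn_gt0.
have u2 : r ^+ 2 <= (x - t) ^+ 2.
  by rewrite -(real_normK (num_real (x - t))) lerXn2r// ?nnegrE// ltW.
have D0 : 0 < (x - t) ^+ 2 + y ^+ 2 by rewrite ltr_wpDl ?sqr_ge0// exprn_gt0.
have D1 : 0 < 1 + x ^+ 2 by rewrite ltr_pwDl// sqr_ge0.
rewrite /pois /kap ler_wpM2l ?(ltW y0)// mulrC.
rewrite -[leLHS]mul1r ler_pdivrMr// -mulrA mulrC ler_pdivlMr// mul1r.
have h : 1 + 2 * t ^+ 2 <= ((1 + 2 * t ^+ 2) / r ^+ 2) * (x - t) ^+ 2.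
  rewrite mulrAC ler_pdivlMr// ler_wpM2l//.
  by rewrite addr_ge0// mulr_ge0// sqr_ge0.
set c := _ / r ^+ 2 in h *.
have c0 : 0 <= c by rewrite divr_ge0 ?sqr_ge0// addr_ge0// mulr_ge0// sqr_ge0.
have h2 : 0 <= (c + 2) * y ^+ 2 by rewrite mulr_ge0 ?addr_ge0// sqr_ge0.
have := sqr_ge0 (x - 2 * t); nra.
Qed.

Lemma rint_dev_kap f t : rint mu (fun x => f x * kap x) ->
  rint mu (fun x => `|f x - f t| * kap x).
Proof.
move=> fi; have h := rint_norm (rintB fi (rint_kapZ (f t))).
by apply: rint_eq h => x; rewrite -mulrBl normrM [`|kap x|]ger0_norm// kap_ge0.
Qed.

Lemma measurable_of_kap f : rint mu (fun x => f x * kap x) -> measurable_fun setT f.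
Proof.
move=> /rint_measurable mf.
have mk : measurable_fun setT (fun x : R => (kap x)^-1).
  by apply: measurable_inv_fun; exact: rint_measurable (rint_kap R).
apply: (eq_measurable_fun (fun x => f x * kap x * (kap x)^-1)).
  by move=> x _; rewrite mulfK// gt_eqF// kap_gt0.
exact: measurable_funM mf mk.
Qed.

Lemma kapV_ball (t r x : R) : `|x - t| < r -> 1 <= (1 + (`|t| + r) ^+ 2) * kap x.
Proof.
move=> xt; rewrite /kap ler_pdivlMr ?mul1r; last by rewrite ltr_pwDl// sqr_ge0.
rewrite lerD2l -(real_normK (num_real x)) lerXn2r// ?nnegrE//.
  by rewrite addr_ge0// (le_trans (normr_ge0 (x - t)))// ltW.
by rewrite -[x](subrK t) (le_trans (ler_normD _ _))// addrC lerD2l ltW.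
Qed.

Lemma rint_ball f t r : rint mu (fun x => f x * kap x) ->
  rint mu (fun x => f x * ind_ball t r x).
Proof.
move=> fi; have mf := measurable_of_kap fi.
apply: (@rint_le _ _ _ mu _ (fun x => (1 + (`|t| + r) ^+ 2) * `|f x * kap x|)).
- by apply: measurable_funM => //; exact: measurable_ind_ball.
- by apply: rintZl; exact: rint_norm.
- move=> x; rewrite ind_ballE; case: ifP => [xt|_]; last first.
    by rewrite mulr0 normr0 mulr_ge0// addr_ge0// sqr_ge0.
  rewrite mulr1 normrM mulrCA (ger0_norm (kap_ge0 x)).
  by rewrite -[leLHS]mulr1 ler_wpM2l// kapV_ball.
Qed.

Lemma locally_integrable_kap f : rint mu (fun x => f x * kap x) ->
  locally_integrable setT f.
Proof.
move=> fi; have mf := measurable_of_kap fi.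
split => //; first exact: openT.
move=> K _ cK; have [M [Mr hM]] := compact_bounded cK.
have fb := rint_norm (rint_ball 0 (`|M| + 2) fi).
apply: (@le_lt_trans _ _ (\int[mu]_x (`|f x * ind_ball 0 (`|M| + 2) x|)%:E)%E); last first.
  by rewrite rintE// ltry.
rewrite integral_mkcond; apply: ge0_le_integral => //.
- by move=> x _; apply: erestrict_ge0 => y _; rewrite lee_fin.
- apply/(measurable_restrictT _ _).1; first exact: compact_measurable.
  by apply: measurable_funTS; apply/measurable_EFinP/measurableT_comp.
- by apply/measurable_EFinP; exact: rint_measurable fb.
- move=> x _; rewrite patchE; case: ifPn => [xK|_]; last by rewrite lee_fin.
  rewrite lee_fin ind_ballE ifT ?mulr1// subr0.
  have := hM (`|M| + 1) _ x (set_mem xK); rewrite /= => /(_ _)/le_lt_trans; apply.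
    by rewrite (le_lt_trans (ler_norm M))// ltrDl.
  by rewrite ltrD2l ltr1n.
Qed.

Lemma davg_ball f (t r : R) : rint mu (fun x => f x * kap x) -> 0 < r ->
  davg f t r = ((2 * r)^-1 * \int[mu]_x (`|f x - f t| * ind_ball t r x))%:E.
Proof.
move=> fi r0.
have bi : rint mu (fun x => `|f x - f t| * ind_ball t r x).
  by apply: rint_ball; exact: rint_dev_kap.
rewrite /davg /iavg lebesgue_measure_ball ?ltW// EFinM -rintE//.
congr (_ * _)%E; first by rewrite inver mulrn_eq0/= gt_eqF//= mulr_natl.
have -> : (fun x => (`|f x - f t| * ind_ball t r x)%:E) =
    (fun x => `|f x - f t|%:E) \_ (ball t r).
  apply/funext => x; rewrite patchE ind_ballE; case: ifPn => h; case: ifPn => h'.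
  - by rewrite mulr1.
  - by move: h'; rewrite notin_setE /ball /= distrC.
  - by move: h'; rewrite inE /ball /= distrC (negbTE h).
  - by rewrite mulr0.
by rewrite -integral_mkcond.
Qed.

Lemma lebesgue_pt_ball f t (eta : R) : rint mu (fun x => f x * kap x) ->
  lebesgue_pt f t -> 0 < eta ->
  exists2 r0, 0 < r0 & forall r, 0 < r -> r <= r0 ->
    \int[mu]_x (`|f x - f t| * ind_ball t r x) <= eta * (2 * r).
Proof.
move=> fi /fine_cvgP[_ /cvgrPdist_le /(_ eta)] h eta0.
have [r0 /= r00 H] := h eta0.
exists (r0 / 2); first by rewrite divr_gt0.
move=> r rgt0 rr0; have := H r; rewrite /= sub0r normrN gtr0_norm// => /(_ _ rgt0).
rewrite davg_ball//= sub0r normrN ger0_norm; last first.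
  rewrite mulr_ge0// ?invr_ge0 ?mulr_ge0 ?(ltW rgt0)//.
  by apply: rInt_ge0 => x; rewrite mulr_ge0// ind_ball_ge0.
rewrite mulrC ler_pdivrMr ?mulr_gt0//; apply.
by rewrite (le_lt_trans rr0)// ltr_pdivrMr// ltr_pMr// ltr1n.
Qed.

(** The k-th ball contributes (4 / (4^k y)) eta (2 . 2^k y) = 8 eta / 2^k, and these terms add up to
    at most 16 eta. The remaining term is the part beyond distance r0. *)
Lemma int_dev_pois_near f t (eta r0 y : R) : rint mu (fun x => f x * kap x) ->
  0 < eta -> 0 < r0 -> 0 < y ->
  (forall r, 0 < r -> r <= r0 ->
    \int[mu]_x (`|f x - f t| * ind_ball t r x) <= eta * (2 * r)) ->
  \int[mu]_x (`|f x - f t| * pois t y x) <= 16 * eta +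
    y * (((1 + 2 * t ^+ 2) / r0 ^+ 2 + 2) * \int[mu]_x (`|f x - f t| * kap x)).
Proof.
move=> fi eta0 r00 y0 H.
have pi_ := rint_dev_kap t fi.
have bi r : rint mu (fun x => `|f x - f t| * ind_ball t r x) by exact: rint_ball.
set C := (_ / _ + 2).
have C0 : 0 <= C by rewrite addr_ge0// divr_ge0 ?sqr_ge0// addr_ge0// mulr_ge0// sqr_ge0.
have [N hN] : exists N, r0 <= 2 ^+ N * y.
  exists (Num.trunc (r0 / y)).+1.
  rewrite -ler_pdivrMr//; apply: le_trans (ltW (truncnS_gt _)) _.
  by rewrite -natrX ler_nat ltnW// ltn_expl.
(* The hypothesis on averages reaches only up to radius r0, hence the minimum; at points within r0
   of t it does not change the indicators. *)
pose g k x := (4 / (4 ^+ k * y)) * (`|f x - f t| * ind_ball t (Num.min (2 ^+ k * y) r0) x).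
have gi k : rint mu (g k) by exact: rintZl.
have [si sE] := rint_sum N.+1 gi.
have fari : rint mu (fun x => y * C * (`|f x - f t| * kap x)) by exact: rintZl.
have pw x : `|f x - f t| * pois t y x <=
    \sum_(k < N.+1) g k x + y * C * (`|f x - f t| * kap x).
  have [xt|xt] := ltP `|x - t| r0.
    have -> : \sum_(k < N.+1) g k x = `|f x - f t| *
       \sum_(k < N.+1) (4 / (4 ^+ k * y)) * ind_ball t (2 ^+ k * y) x.
      rewrite mulr_sumr; apply: eq_bigr => k _; rewrite /g mulrCA; congr (_ * (_ * _)).
      by rewrite !ind_ballE lt_min xt andbT.
    rewrite -[leLHS]addr0 lerD//.
      by rewrite ler_wpM2l// pois_dyadic// (lt_le_trans xt).
    by rewrite mulr_ge0 ?mulr_ge0 ?kap_ge0// ltW.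
  rewrite -[leLHS]add0r lerD//.
    apply: sumr_ge0 => k _; rewrite /g mulr_ge0 ?divr_ge0 ?mulr_ge0 ?(ltW y0)//.
  rewrite [leRHS]mulrCA ler_wpM2l// -mulrA; exact: pois_far.
have lhsi : rint mu (fun x => `|f x - f t| * pois t y x).
  apply: rint_le (rintD si fari) _.
    apply: measurable_funM; last exact: measurable_pois.
    apply: measurableT_comp => //; apply: measurable_funB => //.
    exact: measurable_of_kap.
  by move=> x; rewrite ger0_norm ?pw// mulr_ge0// ltW// pois_gt0.
apply: (le_trans (rInt_le lhsi (rintD si fari) pw)).
rewrite rIntD// rIntZl// -mulrA lerD2r sE.
apply: (@le_trans _ _ (\sum_(k < N.+1) 8 * eta * (2^-1) ^+ k)).
  apply: ler_sum => k _; rewrite rIntZl//.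
  have m0 : 0 < Num.min (2 ^+ k * y) r0.
    by rewrite lt_min r00 andbT mulr_gt0// exprn_gt0.
  apply: (@le_trans _ _ ((4 / (4 ^+ k * y)) * (eta * (2 * (2 ^+ k * y))))).
    rewrite ler_wpM2l ?divr_ge0 ?mulr_ge0 ?(ltW y0)//.
    apply: le_trans (H _ m0 _) _; first by rewrite ge_min lexx orbT.
    by rewrite ler_wpM2l ?(ltW eta0)// ler_wpM2l// ge_min lexx.
  rewrite le_eqVlt; apply/orP; left; apply/eqP.
  have -> : 4 ^+ k = 2 ^+ k * 2 ^+ k :> R by rewrite -exprMn; congr (_ ^+ _); ring.
  have P0 : 2 ^+ k != 0 :> R by rewrite expf_neq0.
  by rewrite exprVn; field; rewrite ?P0 ?(gt_eqF y0).
rewrite -mulr_sumr.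
have -> : \sum_(i < N.+1) (2^-1 : R) ^+ i = 2 * (1 - 2^-1 ^+ N.+1).
  have := subrX1 (2^-1 : R) N.+1; set S := \sum_(i < _) _; lra.
have : 0 <= (2^-1 : R) ^+ N.+1 by rewrite exprn_ge0// invr_ge0.
by nra.
Qed.

(** The absolute deviation, and not just the Poisson integral, is shown to vanish: any kernel
    dominated by the Poisson kernel is then controlled as well, which is how truncated principal
    values are compared with [Qf]. *)
Lemma cvg_dev_pois f t : rint mu (fun x => f x * kap x) -> lebesgue_pt f t ->
  \int[mu]_x (`|f x - f t| * pois t y x) @[y --> (0 : R)^'+] --> (0 : R).
Proof.
move=> fi ft; apply/cvgrPdist_le => e e0.
have eta0 : 0 < e / 32 by rewrite divr_gt0.
have [r0 r00 H] := lebesgue_pt_ball fi ft eta0.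
set C := (((1 + 2 * t ^+ 2) / r0 ^+ 2 + 2) * \int[mu]_x (`|f x - f t| * kap x)).
have C0 : 0 <= C.
  rewrite mulr_ge0//; last by apply: rInt_ge0 => x; rewrite mulr_ge0// kap_ge0.
  by rewrite addr_ge0// divr_ge0 ?sqr_ge0// addr_ge0// mulr_ge0// sqr_ge0.
near=> y.
have y0 : 0 < y by near: y; exact: nbhs_right_gt.
rewrite sub0r normrN ger0_norm; last first.
  by apply: rInt_ge0 => x; rewrite mulr_ge0// ltW// pois_gt0.
apply: (le_trans (int_dev_pois_near fi eta0 r00 y0 H)); rewrite -/C.
have : y * (C + 1) <= e / 2.
  rewrite -ler_pdivlMr ?ltr_wpDl//; near: y; apply: nbhs_right_le.
  by rewrite !divr_gt0// ltr_wpDl.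
nra.
Unshelve. all: by end_near. Qed.

Lemma ae_lebesgue_pt f : rint mu (fun x => f x * kap x) ->
  {ae mu, forall t : R, lebesgue_pt f t}.
Proof. by move=> fi; apply: lebesgue_differentiation; exact: locally_integrable_kap. Qed.

Lemma rint_kap_of_rint f : rint mu f -> rint mu (fun x => f x * kap x).
Proof.
move=> fi; apply: (@rint_Mr _ _ _ mu 1) => //; first exact: rint_measurable (rint_kap R).
move=> x; rewrite ger0_norm ?kap_ge0// invf_le1 ?lerDl ?sqr_ge0//.
by rewrite ltr_pwDl// sqr_ge0.
Qed.

Lemma pois_le_kap t y : 0 < y ->
  exists2 C : R, 0 <= C & forall x, pois t y x <= C * kap x.
Proof.
move=> y0; exists (y * kapbound (t +i* y)).
  by rewrite mulr_ge0 ?(ltW y0)// ltW// kapbound_gt0.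
move=> x; have := @cabs_kernel_sqr R x (t +i* y) (lt0r_neq0 y0).
rewrite cabsV exprVn sqr_cabs /= sub0r sqrrN => h.
by rewrite -mulrA ler_wpM2l// ltW.
Qed.

Lemma rint_mul_pois f t y : rint mu (fun x => f x * kap x) -> 0 < y ->
  rint mu (fun x => f x * pois t y x).
Proof.
move=> fi y0; have [C C0 hC] := pois_le_kap t y0.
apply: rint_le (rintZl C (rint_norm fi)) _.
  by apply: measurable_funM; [exact: measurable_of_kap|exact: measurable_pois].
move=> x; rewrite normrM (gtr0_norm (pois_gt0 _ _ y0)).
by rewrite [`|f x * _|]normrM (ger0_norm (kap_ge0 x)) [leRHS]mulrCA ler_wpM2l.
Qed.

Lemma cvg_pois_int f t : rint mu (fun x => f x * kap x) -> lebesgue_pt f t ->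
  \int[mu]_x (f x * pois t y x) @[y --> (0 : R)^'+] --> pi * f t.
Proof.
move=> fi ft; have h := cvg_dev_pois fi ft.
apply/cvgrPdist_le => e e0; move/cvgrPdist_le : h => /(_ e e0) h.
near=> y; have y0 : 0 < y by near: y; exact: nbhs_right_gt.
have ip := rint_mul_pois t fi y0.
have ip2 := rintZl (f t) (rint_pois t y0).
rewrite distrC -(int_pois t y0) mulrC -rIntZl; last exact: rint_pois.
rewrite -rIntB//.
have := near h y; rewrite sub0r normrN => /(_ _)/le_trans => hh.
apply: (le_trans (rInt_norm (rintB ip ip2))).
rewrite (rInt_eq mu (_ : _ =1 (fun x => `|f x - f t| * pois t y x))); last first.
  by move=> x; rewrite -mulrBl normrM (gtr0_norm (pois_gt0 _ _ y0)).
apply: le_trans (ler_norm _) _; apply: hh => //; near: y; exact: h.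
Unshelve. all: by end_near. Qed.

Lemma cvg_Pf f t : rint mu f -> lebesgue_pt f t ->
  Pf f y t @[y --> (0 : R)^'+] --> pi * f t.
Proof.
move=> fi ft; have := cvg_pois_int (rint_kap_of_rint fi) ft.
by under eq_fun do rewrite -PfE.
Qed.

End PoissonLebesgue.

(** * Almost everywhere convergence from summable gauges *)

Section Convergence.
Context (R : realType).
Notation mu := (@lebesgue_measure R).
Implicit Types (f : R -> R) (u : nat -> R -> R).

Lemma sum_pow2_le (C : R) n : 0 <= C -> \sum_(k < n) C * 2^-1 ^+ k <= 2 * C.
Proof.
move=> C0; rewrite -mulr_sumr.
have := subrX1 (2^-1 : R) n; set S := \sum_(i < n) _ => h.
have : 0 <= (2^-1 : R) ^+ n by rewrite exprn_ge0// invr_ge0.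
nra.
Qed.

(** A Borel-Cantelli argument: the series of [min 1 |u k| * kap] has integral at most 2C, hence a
    finite sum almost everywhere. *)
Lemma ae_bounded_sum u (C : R) : 0 <= C ->
  (forall k, measurable_fun setT (u k)) ->
  (forall k, rho (u k) <= C * 2^-1 ^+ k) ->
  {ae mu, forall x : R, exists M : R, forall n,
     \sum_(k < n) Num.min 1 `|u k x| <= M}.
Proof.
move=> C0 mu_ uC.
pose g k x := Num.min 1 `|u k x| * kap x.
have g0 k x : 0 <= g k x by rewrite mulr_ge0 ?kap_ge0// le_min ler01 normr_ge0.
have gi k : rint mu (g k) by exact: rint_min1_kap.
have mg k : measurable_fun setT (fun x => (g k x)%:E).
  by apply/measurable_EFinP; exact: rint_measurable (gi k).
have H : (\int[mu]_x (\sum_(k <oo) (g k x)%:E) <= (2 * C)%:E)%E.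
  rewrite integral_nneseries//; last by move=> k x _; rewrite lee_fin.
  apply: lime_le.
    apply: is_cvg_nneseries => k _ _; apply: integral_ge0 => x _.
    by rewrite lee_fin.
  apply: nearW => n.
  under eq_bigr do rewrite rintE//.
  rewrite sumEFin lee_fin big_mkord; apply: le_trans (sum_pow2_le n C0).
  by apply: ler_sum => k _; exact: uC.
have Hi : mu.-integrable setT (fun x => \sum_(k <oo) (g k x)%:E)%E.
  apply/integrableP; split.
    apply: (@ge0_emeasurable_sum _ _ _ setT (fun k x => (g k x)%:E) xpredT) => //.
    by move=> k x _ _; rewrite lee_fin.
  under eq_integral.
    move=> x _; rewrite gee0_abs; last first.
      by apply: nneseries_ge0 => k _ _; rewrite lee_fin.
    over.
  by apply: (le_lt_trans H); rewrite ltry.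
apply: ae_imp (integrable_ae measurableT Hi) _ => x /(_ I) fx.
exists (fine (\sum_(k <oo) (g k x)%:E)%E / kap x) => n.
rewrite ler_pdivlMr ?kap_gt0// mulr_suml -lee_fin fineK//.
apply: (@le_trans _ _ (\sum_(0 <= k < n) (g k x)%:E)%E).
  by rewrite big_mkord -sumEFin.
by apply: nneseries_lim_ge => k _ _; rewrite lee_fin.
Qed.

(** The terms of the convergent series of minima tend to 0, so from some index on they equal
    [|v k|], and the series of [v] converges absolutely. *)
Lemma cvg_sum_min1 (v : nat -> R) (M : R) :
  (forall n, \sum_(k < n) Num.min 1 `|v k| <= M) ->
  v n @[n --> \oo] --> (0 : R) /\ cvgn (series v).
Proof.
move=> vM.
have c1 : cvgn (series (fun k => Num.min 1 `|v k|)).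
  apply: nondecreasing_is_cvgn.
    apply: nondecreasing_series => k _ _.
    by rewrite le_min ler01 normr_ge0.
  exists M => _ [n _ <-]; rewrite /series /= big_mkord; exact: vM.
have c0 := cvg_series_cvg_0 c1.
have [N _ hN] : \forall n \near \oo, Num.min 1 `|v n| < 1.
  exact: (cvgr_lt 0 c0 _ ltr01).
have vE n : (N <= n)%N -> Num.min 1 `|v n| = `|v n|.
  by move=> /hN /=; rewrite /Num.min; case: ifPn => // _; rewrite ltxx.
have c2 : cvgn [normed series v].
  apply: nondecreasing_is_cvgn; first by apply: nondecreasing_series => k _ _; exact: normr_ge0.
  exists (\sum_(k < N) `|v k| + M) => _ [n _ <-]; rewrite /normed_series_of /series /= big_mkord.
  apply: (@le_trans _ _ (\sum_(k < n) ((if (k < N)%N then `|v k| else 0) + Num.min 1 `|v k|))).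
    apply: ler_sum => k _; case: ltnP => kN.
      by rewrite lerDl le_min ler01 normr_ge0.
    by rewrite add0r vE.
  rewrite big_split /= lerD//.
  have [nN|Nn] := leqP n N.
    rewrite (big_ord_widen N (fun k => if (k < N)%N then `|v k| else 0) nN).
    rewrite big_mkcond; apply: ler_sum => k _.
    by case: ifP => // _; rewrite ltn_ord.
  rewrite -big_mkcond /= (big_ord_widen n (fun k => `|v k|) (ltnW Nn)).
    exact: lexx.
  exact: vM.
split; last exact: normed_cvg.
by apply: cvg_series_cvg_0; exact: normed_cvg.
Qed.

Lemma cvg_telescope (v : nat -> R) : cvgn (series (fun k => v k.+1 - v k)) -> cvgn v.
Proof.
move=> h; have -> : v = (fun n => v 0%N + series (fun k => v k.+1 - v k) n).
  by apply/funext => n; exact: eq_sum_telescope.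
by apply: is_cvgD => //; exact: is_cvg_cst.
Qed.

Lemma ae_cvg_rho u (C : R) : 0 <= C ->
  (forall k, measurable_fun setT (u k)) ->
  (forall k, rho (fun x => u k.+1 x - u k x) <= C * 2^-1 ^+ k) ->
  {ae mu, forall x : R, cvgn (u ^~ x)}.
Proof.
move=> C0 mu_ uC.
have md k : measurable_fun setT (fun x => u k.+1 x - u k x) by exact: measurable_funB.
apply: ae_imp (ae_bounded_sum C0 md uC) _ => x [M hM].
by have [_ /cvg_telescope] := @cvg_sum_min1 (fun k => u k.+1 x - u k x) M hM.
Qed.

Lemma ae_cvg0_rho u (C : R) : 0 <= C ->
  (forall k, measurable_fun setT (u k)) ->
  (forall k, rho (u k) <= C * 2^-1 ^+ k) ->
  {ae mu, forall x : R, u k x @[k --> \oo] --> (0 : R)}.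
Proof.
move=> C0 mu_ uC; apply: ae_imp (ae_bounded_sum C0 mu_ uC) _ => x [M hM].
by have [] := @cvg_sum_min1 (u ^~ x) M hM.
Qed.

(** An upper limit, because upper limits of measurable functions are measurable on the whole line,
    also where the sequence diverges. *)
Definition seqlim u (x : R) : R := fine (limn_esup (fun n => (u n x)%:E)).

Lemma measurable_seqlim u : (forall n, measurable_fun setT (u n)) ->
  measurable_fun setT (seqlim u).
Proof.
move=> mu_; apply: (measurableT_comp (@fine_measurable R setT measurableT)).
by apply: measurable_fun_limn_esup => n; exact/measurable_EFinP.
Qed.

Lemma seqlimE u x (l : R) : u n x @[n --> \oo] --> l -> seqlim u x = l.
Proof.
move=> ul; have ul' : (u n x)%:E @[n --> \oo] --> l%:E.
  by apply: cvg_EFin => //; exact: nearW.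
by rewrite /seqlim (cvg_limn_einf_sup ul').2.
Qed.

Lemma rInt_dct_right d (T : measurableType d) (nu : {measure set T -> \bar R})
    (u : R -> T -> R) (f g : T -> R) :
  (forall y, 0 < y -> measurable_fun setT (u y)) -> measurable_fun setT f ->
  rint nu g -> (forall y x, 0 < y -> `|u y x| <= g x) ->
  {ae nu, forall x, u y x @[y --> (0 : R)^'+] --> f x} ->
  \int[nu]_x u y x @[y --> (0 : R)^'+] --> \int[nu]_x f x.
Proof.
move=> mu_ mf gi ug uf; apply/cvg_at_rightP => y [y0 yc].
apply: (@rInt_dct_cvg _ _ _ nu (fun n => u (y n)) f g) => //.
- by move=> n; exact: mu_.
- by move=> n x; exact: ug.
- by apply: ae_imp uf _ => x /cvg_at_rightP; apply.
Qed.

End Convergence.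

Lemma sqr_sub_le (R : realFieldType) (a b c : R) :
  (a - b) ^+ 2 <= 2 * (a - c) ^+ 2 + 2 * (b - c) ^+ 2.
Proof. by have := sqr_ge0 ((a - c) + (b - c)); nra. Qed.

Section Truncation.
Context (R : realType) (T : Type).
Implicit Types (f : T -> R).

Definition trunc (m : R) f (x : T) : R := Num.max (- m) (Num.min (f x) m).

Lemma trunc_bound m f x : 0 <= m -> `|trunc m f x| <= m.
Proof.
move=> m0; rewrite ler_norml /trunc le_max lexx /= ge_max ge_min lexx orbT andbT.
by rewrite (le_trans _ m0)// oppr_le0.
Qed.

Lemma trunc_le m f x : 0 <= m -> `|trunc m f x| <= `|f x|.
Proof.
move=> m0; rewrite /trunc /Num.max /Num.min.
have := ler_norm (f x); have := ler_norm (- f x); rewrite normrN => h1 h2.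
by rewrite ler_norml; do ! case: ifPn; rewrite -?leNgt => *; apply/andP; split; lra.
Qed.

Lemma trunc_id m f x : `|f x| <= m -> trunc m f x = f x.
Proof.
rewrite ler_norml => /andP[h1 h2]; rewrite /trunc min_l//.
by rewrite max_r.
Qed.

Lemma trunc_le_ge0 m f x : 0 <= m -> 0 <= f x -> trunc m f x <= f x.
Proof.
by move=> m0 f0; rewrite ge_max ge_min lexx andbT (le_trans _ f0)// oppr_le0.
Qed.

End Truncation.

Lemma measurable_trunc d (T : measurableType d) (R : realType) (m : R) (f : T -> R) : measurable_fun setT f -> measurable_fun setT (trunc m f).
Proof.
move=> mf; apply: measurable_maxr; first exact: measurable_cst.
by apply: measurable_minr => //; exact: measurable_cst.
Qed.

(** * Conjugate Poisson integrals are Cauchy in measure *)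

Section Existence.
Context (R : realType).
Notation mu := (@lebesgue_measure R).
Implicit Types (f : R -> R) (z : R[i]).

Lemma cF_lipschitz f (b : R) z1 z2 : rint mu f -> 0 < b ->
  b <= complex.Im z1 -> b <= complex.Im z2 ->
  cabs (cF f z1 - cF f z2) <= 2 * (cabs (z1 - z2) * (b^-1 * b^-1) * \int[mu]_s `|f s|).
Proof.
move=> fi b0 h1 h2; have p1 : 0 < complex.Im z1 by exact: lt_le_trans h1.
have p2 : 0 < complex.Im z2 by exact: lt_le_trans h2.
have i1 := cint_cauchy (cint_realC fi) p1.
have i2 := cint_cauchy (cint_realC fi) p2.
rewrite /cF /cauchy -(cIntB i1 i2) -rIntZl; last exact: rint_norm.
apply: cabs_cInt.
- exact: cint_cmeas (cintB i1 i2).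
- by apply: rintZl; exact: rint_norm.
move=> s; have s1 := subC_eq0 s (lt0r_neq0 p1); have s2 := subC_eq0 s (lt0r_neq0 p2).
have -> : (f s)%:C / (s%:C - z1) - (f s)%:C / (s%:C - z2) =
    (f s)%:C * ((z1 - z2) * ((s%:C - z1)^-1 * (s%:C - z2)^-1)).
  by rewrite -mulrBr; congr (_ * _); move: s1 s2; move: (s%:C) => S s1 s2; field; rewrite s1 s2.
rewrite !cabsM cabs_real mulrC ler_wpM2r// ler_wpM2l ?cabs_ge0//.
have k1 : cabs (s%:C - z1)^-1 <= b^-1.
  by apply: le_trans (cabs_kernel_le s p1) _; rewrite lef_pV2.
have k2 : cabs (s%:C - z2)^-1 <= b^-1.
  by apply: le_trans (cabs_kernel_le s p2) _; rewrite lef_pV2.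
by rewrite ler_pM ?cabs_ge0.
Qed.

Lemma cvg_ae_Pf f : rint mu f ->
  {ae mu, forall t : R, Pf f y t @[y --> (0 : R)^'+] --> pi * f t}.
Proof.
move=> fi; apply: ae_imp (ae_lebesgue_pt (rint_kap_of_rint fi)) _ => t.
exact: cvg_Pf.
Qed.

Lemma measurable_Qf f y : rint mu f -> 0 < y -> measurable_fun setT (Qf f y).
Proof. by move=> fi y0; have [] := cmeas_cF fi y0. Qed.

Lemma measurable_Pf f y : rint mu f -> 0 < y -> measurable_fun setT (Pf f y).
Proof. by move=> fi y0; have [] := cmeas_cF fi y0. Qed.

Lemma double_sum_le_half (a b c : R) : a <= c / 8 -> b <= c / 8 ->
  2 * a + 2 * b <= c / 2.
Proof. lra. Qed.

Lemma Pf_L2_cvg f (M : R) : rint mu f -> (forall s, `|f s| <= M) ->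
  \int[mu]_x ((Pf f y x - pi * f x) ^+ 2 * kap x) @[y --> (0 : R)^'+] --> (0 : R).
Proof.
move=> fi fM; have mf := rint_measurable fi.
rewrite [X in _ --> X](_ : (0 : R) = \int[mu]_x (fun=> 0 : R) x); last first.
  by rewrite /Rintegral integral0.
have M0 : 0 <= M by apply: le_trans (fM 0).
apply: (@rInt_dct_right R _ _ mu _ _ (fun x => (M * pi + pi * M) ^+ 2 * kap x)).
- move=> y y0; apply: measurable_funM; last exact: rint_measurable (rint_kap R).
  apply: measurable_funX; apply: measurable_funB; first exact: measurable_Pf.
  exact: measurable_funM.
- exact: measurable_cst.
- exact: rint_kapZ.
- move=> y x y0; rewrite normrM (ger0_norm (kap_ge0 x)) ler_wpM2r ?kap_ge0//.
  rewrite normrX lerXn2r ?nnegrE//.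
    by rewrite addr_ge0// mulr_ge0// pi_ge0.
  apply: le_trans (ler_normB _ _) _; apply: lerD; first exact: Pf_bound.
  by rewrite normrM (ger0_norm (pi_ge0 R)) ler_wpM2l// pi_ge0.
- apply: ae_imp (cvg_ae_Pf fi) _ => x h.
  have h0 : Pf f y x - pi * f x @[y --> (0 : R)^'+] --> (0 : R).
    by rewrite -[X in _ --> X](subrr (pi * f x)); apply: cvgB => //; exact: cvg_cst.
  rewrite -[X in _ --> X](mul0r (kap x)); apply: cvgM; last exact: cvg_cst.
  by rewrite -[X in _ --> X](mulr0 0); under eq_fun do rewrite expr2; exact: cvgM.
Qed.

(** By [Qf_L2] the squared distance of two conjugate Poisson integrals is that of the Poisson
    integrals plus a value at i. The Poisson integrals converge in L2 by domination, since [f] is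
    bounded, and the value at i is small because the Cauchy transform is Lipschitz above height
    1. *)
Lemma Qf_L2_cauchy f (M eta : R) : rint mu f -> (forall s, `|f s| <= M) -> 0 < eta ->
  exists2 d : R, 0 < d & forall e1 e2, 0 < e1 -> e1 < d -> 0 < e2 -> e2 < d ->
  \int[mu]_x ((Qf f e1 x - Qf f e2 x) ^+ 2 * kap x) <= eta.
Proof.
move=> fi fM eta0; have mf := rint_measurable fi.
have eta8 : 0 < eta / 8 by rewrite divr_gt0.
have /cvgrPdist_le /(_ _ eta8) [d1 /= d10 H1] := Pf_L2_cvg fi fM.
pose N := \int[mu]_s `|f s|.
have N0 : 0 <= N by exact: rInt_ge0.
pose K := pi * (2 * N) ^+ 2 : R.
have K0 : 0 <= K by rewrite mulr_ge0 ?pi_ge0// sqr_ge0.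
(* The value at i is at most d2^2 K. The bound d2 <= 1 reduces this to d2 K, and the second bound
   makes it at most eta / 8. *)
pose d2 := Num.min 1 (eta / (8 * (K + 1))).
have d20 : 0 < d2.
  by rewrite lt_min ltr01/= divr_gt0// mulr_gt0// ltr_wpDl.
have PL y : 0 < y -> y < d1 -> rint mu (fun x => (Pf f y x - pi * f x) ^+ 2 * kap x) /\
    \int[mu]_x ((Pf f y x - pi * f x) ^+ 2 * kap x) <= eta / 8.
  move=> y0 yd; split; last first.
    apply: le_trans (ler_norm _) _.
    by have := H1 y; rewrite /= !sub0r !normrN gtr0_norm// => /(_ yd y0).
  apply: (@rint_Ml _ _ _ mu ((M * pi + pi * M) ^+ 2)); last exact: rint_kap.
    apply: measurable_funX; apply: measurable_funB; first exact: measurable_Pf.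
    exact: measurable_funM.
  move=> x; have M0 : 0 <= M by apply: le_trans (fM 0).
  rewrite normrX lerXn2r ?nnegrE//.
    by rewrite addr_ge0// mulr_ge0// pi_ge0.
  apply: le_trans (ler_normB _ _) _; apply: lerD; first exact: Pf_bound.
  by rewrite normrM (ger0_norm (pi_ge0 R)) ler_wpM2l// pi_ge0.
exists (Num.min d1 d2); first by rewrite lt_min d10.
move=> e1 e2 e10; rewrite lt_min => /andP[e1d e1d2] e20; rewrite lt_min => /andP[e2d e2d2].
have [|_ ->] := Qf_L2 fi e10 e20; first by exists M.
have [i1 l1] := PL _ e10 e1d; have [i2 l2] := PL _ e20 e2d.
have P12 : \int[mu]_x ((Pf f e1 x - Pf f e2 x) ^+ 2 * kap x) <= eta / 2.
  apply: (@le_trans _ _ (\int[mu]_x (2 * ((Pf f e1 x - pi * f x) ^+ 2 * kap x) +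
     2 * ((Pf f e2 x - pi * f x) ^+ 2 * kap x)))).
    have i12 : rint mu (fun x => 2 * ((Pf f e1 x - pi * f x) ^+ 2 * kap x) +
      2 * ((Pf f e2 x - pi * f x) ^+ 2 * kap x)) by apply: rintD; exact: rintZl.
    have H x : (Pf f e1 x - Pf f e2 x) ^+ 2 * kap x <=
      2 * ((Pf f e1 x - pi * f x) ^+ 2 * kap x) + 2 * ((Pf f e2 x - pi * f x) ^+ 2 * kap x).
      have E (c : R) : 2 * (c ^+ 2 * kap x) = 2 * c ^+ 2 * kap x by rewrite mulrA.
      rewrite !E -mulrDl ler_wpM2r ?kap_ge0//.
      exact: (sqr_sub_le (Pf f e1 x) (Pf f e2 x) (pi * f x)).
    apply: rInt_le => //; apply: rint_le i12 _.
      apply: measurable_funM; last exact: rint_measurable (rint_kap R).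
      by apply: measurable_funX; apply: measurable_funB; exact: measurable_Pf.
    by move=> x; rewrite ger0_norm ?H// mulr_ge0 ?kap_ge0// sqr_ge0.
  rewrite (rIntD (rintZl 2 i1) (rintZl 2 i2)) (rIntZl 2 i1) (rIntZl 2 i2).
  exact: double_sum_le_half l1 l2.
have F12 : cabs (cF f ('i + e1 *i) - cF f ('i + e2 *i)) <= 2 * (d2 * N).
  apply: le_trans (cF_lipschitz fi ltr01 _ _) _; rewrite /= ?lerDl ?(ltW e10) ?(ltW e20)//.
  rewrite invr1 !mulr1.
  rewrite ler_wpM2l// ler_wpM2r//.
  have -> : 'i + e1 *i - ('i + e2 *i) = 0 +i* (e1 - e2) :> R[i].
    by congr (_ +i* _) => /=; ring.
  rewrite cabs_normc /= expr0n add0r sqrtr_sqr ler_norml; clear -e10 e1d2 e20 e2d2; lra.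
have F2 : pi * complex.Re ((cF f ('i + e1 *i) - cF f ('i + e2 *i)) ^+ 2) <= eta / 2.
  apply: (@le_trans _ _ (pi * (2 * (d2 * N)) ^+ 2)).
    rewrite ler_wpM2l ?pi_ge0//; apply: le_trans (ler_norm _) _.
    apply: le_trans (cabs_Re _) _; rewrite cabsX lerXn2r// ?nnegrE ?cabs_ge0//.
    by rewrite mulr_ge0// mulr_ge0// ltW.
  have -> : pi * (2 * (d2 * N)) ^+ 2 = d2 * d2 * K by rewrite /K; ring.
  have d21 : d2 <= 1 by rewrite ge_min lexx.
  have d2e : d2 * (8 * (K + 1)) <= eta.
    by rewrite -ler_pdivlMr ?mulr_gt0 ?ltr_wpDl// ge_min lexx orbT.
  have : d2 * d2 * K <= d2 * K by rewrite ler_wpM2r// ler_piMr// ltW.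
  by clear -d2e d20 K0 eta0; nra.
apply: (le_trans (lerD P12 F2)); clear; lra.
Qed.

(** Chebyshev's inequality for the gauge, from |v| <= l + v^2 / l for |v| <= l and for |v| > l. *)
Lemma rho_L2 (v : R -> R) (l : R) : 0 < l -> measurable_fun setT v ->
  rint mu (fun x => v x ^+ 2 * kap x) ->
  rho v <= pi * l + l^-1 * \int[mu]_x (v x ^+ 2 * kap x).
Proof.
move=> l0 mv iv; rewrite -rIntZl//.
have -> : \int[mu]_x (l^-1 * (v x ^+ 2 * kap x)) = \int[mu]_x (l^-1 * v x ^+ 2 * kap x).
  by apply: rInt_eq => x; rewrite mulrA.
apply: rho_le; [exact: ltW|by []| |].
  by apply: rint_eq (rintZl l^-1 iv) => x; rewrite mulrA.
move=> x; apply: (@le_trans _ _ `|v x|); first by rewrite ge_min lexx orbT.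
have [h|h] := leP `|v x| l.
  by rewrite (le_trans h)// lerDl mulr_ge0 ?sqr_ge0// invr_ge0 ltW.
rewrite -[leLHS]add0r lerD ?(ltW l0)// mulrC ler_pdivlMr//.
by rewrite -(real_normK (num_real (v x))) expr2 ler_wpM2l// ltW.
Qed.

Lemma cF_sub f g h (z : R[i]) : rint mu f -> rint mu g -> 0 < complex.Im z ->
  (forall s, h s = f s - g s) -> cF h z = cF f z - cF g z.
Proof.
move=> fi gi z0 hE; rewrite (@cF_lin _ f g h (-1) z fi gi z0).
  have -> : (-1)%:C = -1 :> R[i] by congr (_ +i* _); rewrite oppr0.
  by rewrite mulN1r.
by move=> s; rewrite mulN1r.
Qed.

Lemma Qf_sub f g h y t : rint mu f -> rint mu g -> 0 < y ->
  (forall s, h s = f s - g s) -> Qf h y t = Qf f y t - Qf g y t.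
Proof.
move=> fi gi y0 hE; rewrite /Qf (@cF_sub f g h (t +i* y) fi gi y0 hE).
by case: (cF f _) (cF g _) => ? ? [].
Qed.

Lemma rint_trunc m f : 0 <= m -> rint mu f -> rint mu (trunc m f).
Proof.
move=> m0 fi; apply: rint_le (rint_norm fi) _.
  by apply: measurable_trunc; exact: rint_measurable fi.
by move=> x; exact: trunc_le.
Qed.

Lemma cvg_int_trunc f : rint mu f ->
  \int[mu]_x `|f x - trunc n%:R f x| @[n --> \oo] --> (0 : R).
Proof.
move=> fi; have mf := rint_measurable fi.
have -> : (0 : R) = \int[mu]_x (fun=> 0 : R) x by rewrite /Rintegral integral0.
apply: (@rInt_dct_cvg _ _ _ mu (fun n x => `|f x - trunc n%:R f x|) _
  (fun x => 2 * `|f x|)).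
- move=> n; apply: measurableT_comp => //; apply: measurable_funB => //.
  exact: measurable_trunc.
- exact: measurable_cst.
- by apply: rintZl; exact: rint_norm.
- move=> n x; rewrite normr_id (le_trans (ler_normB _ _))// mulr_natl mulr2n.
  by rewrite lerD2l trunc_le.
- apply: nearW => x; apply: cvg_near_cst; near=> n.
  rewrite trunc_id ?subrr ?normr0//.
  by near: n; exact: nbhs_infty_ger.
Unshelve. all: by end_near. Qed.

Lemma eighth_cancel (p k c : R) : 0 < p -> 0 < k ->
  4 * p * (k^-1 * (k * c / (32 * p))) = c / 8.
Proof. by move=> p0 k0; field; rewrite !lt0r_neq0. Qed.

(** The truncation [g] is treated in L2, and the remainder [h], small in L1, by the weak type
    inequality. Since [f] is nonnegative, so is [h], as [rho_Qf] requires. *)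
Lemma Qf_rho_cauchy f (eta : R) : rint mu f -> (forall s, 0 <= f s) -> 0 < eta ->
  exists2 d : R, 0 < d & forall e1 e2, 0 < e1 -> e1 < d -> 0 < e2 -> e2 < d ->
  rho (fun x => Qf f e1 x - Qf f e2 x) <= eta.
Proof.
move=> fi f0 eta0.
have pi0 : 0 < pi :> R by exact: pi_gt0.
(* The L2 part and each of the two remainders cost at most eta / 4. In each case pi l = eta / 8 is
   one half; [c] is chosen so that the weak type term 4 pi c / l is the other half, and the L2 bound
   l^2 becomes l <= eta / 8 after division by l. *)
pose l := eta / (8 * pi).
have l0 : 0 < l by rewrite divr_gt0// mulr_gt0.
have lE : pi * l = eta / 8 by
  rewrite /l; move: pi0; move: (@pi R) => p p0; field; exact: lt0r_neq0.
pose c := l * eta / (32 * pi).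
have c0 : 0 < c by apply: divr_gt0; exact: mulr_gt0.
have cE : 4 * pi * (l^-1 * c) = eta / 8.
  exact: eighth_cancel.
have [n hn] : exists n : nat, \int[mu]_x `|f x - trunc n%:R f x| <= c.
  have /cvgrPdist_le /(_ _ c0) [n _ hn] := cvg_int_trunc fi.
  exists n; have := hn n (leqnn n); rewrite /= sub0r normrN.
  by apply: le_trans; exact: ler_norm.
set g := trunc n%:R f in hn; pose h x := f x - g x.
have gi : rint mu g by exact: rint_trunc.
have hi : rint mu h by exact: rintB.
have h0 x : 0 <= h x by rewrite subr_ge0 trunc_le_ge0.
have hI : \int[mu]_x h x <= c.
  by apply: le_trans hn; rewrite (rInt_eq mu (_ : _ =1 h))// => x; rewrite ger0_norm ?h0.
have [d d0 Hd] := Qf_L2_cauchy gi (fun s => trunc_bound f s (ler0n R n)) (mulr_gt0 l0 l0).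
exists d => // e1 e2 e10 e1d e20 e2d.
have rh e : 0 < e -> rho (Qf h e) <= eta / 4.
  move=> e0; apply: le_trans (rho_Qf hi h0 l0 e0) _.
  have : 4 * pi * (l^-1 * \int[mu]_s h s) <= eta / 8.
    rewrite -cE; apply: ler_wpM2l; first by rewrite mulr_ge0// ltW.
    by rewrite ler_wpM2l// invr_ge0 ltW.
  move=> hh; apply: (le_trans (lerD (lexx _) hh)); rewrite lE; clear -eta0; lra.
have mQ e : 0 < e -> measurable_fun setT (Qf h e) by move=> ?; exact: measurable_Qf.
have mg e : 0 < e -> measurable_fun setT (Qf g e) by move=> ?; exact: measurable_Qf.
have [|ig _] := Qf_L2 gi e10 e20; first by exists n%:R => s; exact: trunc_bound.
have rg : rho (fun x => Qf g e1 x - Qf g e2 x) <= eta / 4.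
  apply: le_trans (rho_L2 l0 _ ig) _; first by apply: measurable_funB; exact: mg.
  have : l^-1 * \int[mu]_x ((Qf g e1 x - Qf g e2 x) ^+ 2 * kap x) <= l.
    by rewrite ler_pdivrMl//; exact: Hd.
  have : l <= eta / 8.
    rewrite -lE ler_peMl ?(ltW l0)//.
    by have := @pi_ge2 R; clear; lra.
  move=> h1 h2; apply: (le_trans (lerD (lexx _) (le_trans h2 h1))); rewrite lE; clear -eta0; lra.
have E x : Qf f e1 x - Qf f e2 x =
    (Qf g e1 x - Qf g e2 x) + (Qf h e1 x - Qf h e2 x).
  by rewrite !(@Qf_sub f g h)//; ring.
rewrite (rho_eq E).
apply: le_trans (rhoD _ _) _.
- by apply: measurable_funB; exact: mg.
- by apply: measurable_funB; exact: mQ.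
have : rho (fun x => Qf h e1 x - Qf h e2 x) <= rho (Qf h e1) + rho (Qf h e2).
  apply: le_trans (rhoD (mQ _ e10) _) _.
    by apply: measurable_funN; exact: mQ.
  rewrite lerD2l le_eqVlt; apply/orP; left; apply/eqP.
  by apply: rInt_eq => x; rewrite normrN.
move=> h3; apply: (le_trans (lerD rg (le_trans h3 (lerD (rh _ e10) (rh _ e20))))); clear -eta0; lra.
Qed.

End Existence.

Lemma ccvgV (R : realType) (u : nat -> R[i]) l : ccvg u l -> l != 0 ->
  ccvg (fun n => (u n)^-1) l^-1.
Proof.
move=> [ur ui] l0.
have N0 : complex.Re l ^+ 2 + complex.Im l ^+ 2 != 0.
  by rewrite -sqr_cabs sqrf_eq0 cabs_eq0.
have Nc : complex.Re (u n) ^+ 2 + complex.Im (u n) ^+ 2 @[n --> \oo] -->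
    complex.Re l ^+ 2 + complex.Im l ^+ 2.
  by rewrite !expr2; under eq_fun do rewrite !expr2; apply: cvgD; exact: cvgM.
split; rewrite complex_invE /=; under eq_fun do rewrite complex_invE /=.
- by apply: cvgM => //; exact: cvgV.
- by apply: cvgN; apply: cvgM => //; exact: cvgV.
Qed.

Lemma Re_mulC (R : realType) (a : R[i]) (r : R) : complex.Re (a * r%:C) = complex.Re a * r.
Proof. by case: a => a b /=; rewrite mulr0 subr0. Qed.

Lemma Im_mulC (R : realType) (a : R[i]) (r : R) : complex.Im (a * r%:C) = complex.Im a * r.
Proof. by case: a => a b /=; rewrite mulr0 add0r. Qed.

Lemma Im_resolvent (R : realType) (F : R[i]) :
  complex.Im (1 - 'i * F) = - complex.Re F.
Proof. by case: F => a b /=; ring. Qed.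

(** * The Hilbert transform *)

Section HilbertTransform.
Context (R : realType).
Notation mu := (@lebesgue_measure R).
Implicit Types (f g h : R -> R) (z : R[i]).

(** Also below 1 / (n + 1), so that the sequence tends to 0. It never increases, so its terms [n]
    and [n + 1] both lie below [d n]; halving makes this strict. *)
Fixpoint vanishing_below (d : nat -> R) n : R :=
  if n is n'.+1 then Num.min (vanishing_below d n') (Num.min (d n) n.+1%:R^-1) / 2
  else Num.min (d 0%N) 1 / 2.

Lemma vanishing_belowP (d : nat -> R) : (forall n, 0 < d n) ->
  [/\ forall n, 0 < vanishing_below d n, forall n, vanishing_below d n < d n,
      forall n, vanishing_below d n.+1 <= vanishing_below d n &
      vanishing_below d n @[n --> \oo] --> (0 : R)].
Proof.
move=> d0; have half (a : R) : 0 < a -> a / 2 < a.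
  by move=> a0; rewrite ltr_pdivrMr// ltr_pMr// ltr1n.
have p n : 0 < vanishing_below d n.
  by elim: n => [|n IH] /=; rewrite divr_gt0// !lt_min ?IH ?d0 /= ?ltr01// invr_gt0.
have q n : vanishing_below d n < d n.
  case: n => [|n] /=.
    by apply: lt_le_trans (half _ _) _; rewrite ?lt_min ?d0 ?ltr01// ge_min lexx.
  apply: lt_le_trans (half _ _) _; rewrite ?lt_min ?p ?d0 /= ?invr_gt0//.
  by rewrite !ge_min lexx orbT.
have r n : vanishing_below d n.+1 <= vanishing_below d n.
  rewrite /=; apply: (@le_trans _ _ (vanishing_below d n / 2)).
    by rewrite ler_wpM2r// ge_min lexx.
  by rewrite ltW// half.
have s n : vanishing_below d n <= n.+1%:R^-1.
  case: n => [|n] /=.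
    rewrite invr1; apply: le_trans (ltW (half _ _)) _; rewrite ?lt_min ?d0 ?ltr01//.
    by rewrite ge_min lexx orbT.
  apply: le_trans (ltW (half _ _)) _; rewrite ?lt_min ?p ?d0 /= ?invr_gt0//.
  by rewrite !ge_min lexx !orbT.
split => //.
apply: (@squeeze_cvgr _ _ _ _ (fun=> 0) (@harmonic R)).
- by apply: nearW => n; rewrite (ltW (p n)) /= s.
- exact: cvg_cst.
- exact: cvg_harmonic.
Qed.

(** Being Cauchy in measure yields pointwise limits only along a fast sequence of heights, here with
    increments of gauge at most 2^-k. The full limit is recovered later from Poisson's formula for
    the resolvent. *)
Lemma ae_cvg_Qf_seq f : rint mu f -> (forall s, 0 <= f s) ->
  exists e : nat -> R, [/\ forall k, 0 < e k, e k @[k --> \oo] --> (0 : R) &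
    {ae mu, forall x : R, cvgn (fun k => Qf f (e k) x)}].
Proof.
move=> fi f0.
have /choice[d hd] : forall k : nat, exists d : R, 0 < d /\
    forall e1 e2, 0 < e1 -> e1 < d -> 0 < e2 -> e2 < d ->
      rho (fun x => Qf f e1 x - Qf f e2 x) <= 2^-1 ^+ k.
  move=> k; have k0 : 0 < (2^-1 : R) ^+ k by rewrite exprn_gt0// invr_gt0.
  by have [d d0 hd] := Qf_rho_cauchy fi f0 k0; exists d.
have [p q r s] := vanishing_belowP (fun n => (hd n).1).
exists (vanishing_below d); split => //.
apply: (@ae_cvg_rho R (fun k => Qf f (vanishing_below d k)) 1 ler01).
  by move=> k; exact: measurable_Qf.
move=> k; rewrite mul1r; apply: (hd k).2 => //.
exact: le_lt_trans (r k) (q k).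
Qed.

Lemma ccvg_cF_shift f z (e : nat -> R) : rint mu f -> 0 < complex.Im z ->
  (forall k, 0 < e k) -> e k @[k --> \oo] --> (0 : R) ->
  ccvg (fun k => cF f (z + (e k) *i)) (cF f z).
Proof.
move=> fi z0 e0 ec; apply: ccvg_cabs.
apply: (@squeeze_cvgr _ _ _ _ (fun=> 0)
  (fun k => 2 * (e k * ((complex.Im z)^-1 * (complex.Im z)^-1) * \int[mu]_s `|f s|))).
- apply: nearW => k; rewrite cabs_ge0 /=.
  apply: le_trans (cF_lipschitz fi z0 _ (lexx _)) _.
    by case: (z) => a b /=; rewrite lerDl ltW.
  rewrite addrAC subrr; have -> : 0 + (e k) *i = 0 +i* e k by exact: add0r.
  by rewrite cabs_normc /= expr0n add0r sqrtr_sqr gtr0_norm.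
- exact: cvg_cst.
- set c := _ * (complex.Im z)^-1; set N := \int[mu]_s _.
  rewrite [X in _ --> X](_ : 0 = 2 * (0 * c * N)); last by rewrite !mul0r mulr0.
  apply: cvgM; first exact: cvg_cst.
  apply: cvgM; last exact: cvg_cst.
  by apply: cvgM => //; exact: cvg_cst.
Qed.

(** Poisson's formula holds for the resolvent of the Cauchy transform shifted by i e_k. As the
    resolvents are bounded by 1, the Poisson kernel dominates and e_k may tend to 0 on the boundary
    and inside at once. *)
Lemma resolvent_poisson f (A : R -> R) (e : nat -> R) t y :
  rint mu f -> (forall s, 0 <= f s) -> measurable_fun setT A ->
  (forall k, 0 < e k) -> e k @[k --> \oo] --> (0 : R) ->
  {ae mu, forall x : R, Qf f (e k) x @[k --> \oo] --> A x} -> 0 < y ->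
  cInt mu (fun x : R => (1 - 'i * (A x +i* (pi * f x)))^-1 * (pois t y x)%:C) =
    pi%:C * (1 - 'i * cF f (t +i* y))^-1.
Proof.
move=> fi f0 mA e0 ec hA y0; have mf := rint_measurable fi.
have piF s : 0 <= pi * f s by rewrite mulr_ge0 ?pi_ge0.
have hk k := hardy_poisson t (hardy_resolvent fi f0 (e0 k)) y0.
have [|||||_ H] := @cInt_dct R _ _ mu
  (fun k x => (1 - 'i * cF f (x +i* e k))^-1 * (pois t y x)%:C)
  (fun x => (1 - 'i * (A x +i* (pi * f x)))^-1 * (pois t y x)%:C) (pois t y).
- by move=> k; have [/cint_cmeas] := hk k.
- apply: cmeasM; last by apply: cmeas_real; exact: measurable_pois.
  apply: cmeasV; apply: (@cmeasD _ _ R (fun=> 1)); first exact: cmeas_cst.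
  split => /=.
    apply: (eq_measurable_fun (fun x => pi * f x)).
      by move=> x _; rewrite /= mul0r mul1r sub0r opprK.
    exact: measurable_funM.
  apply: (eq_measurable_fun (fun x => - A x)).
    by move=> x _; rewrite /= mul0r mul1r add0r.
  exact: measurable_funN.
- exact: rint_pois.
- move=> k x; rewrite cabsM cabs_real (gtr0_norm (pois_gt0 _ _ y0)).
  rewrite ler_piMl ?(ltW (pois_gt0 _ _ y0))//.
  by apply: cabs_resolvent_le1; exact: (Pf_ge0 x (e0 k) f0).
- apply: ae_imp2 hA (cvg_ae_Pf fi) _ => x hAx hPx.
  apply: ccvgM; last exact: ccvg_cst.
  apply: ccvgV; last by apply: resolvent_neq0; exact: piF.
  apply: ccvgD; first exact: ccvg_cst.
  have hF : ccvg (fun k => cF f (x +i* e k)) (A x +i* (pi * f x)).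
    split => //=; move/cvg_at_rightP : hPx; exact.
  apply: (@ccvg_eq _ (fun k => (- 'i) * cF f (x +i* e k))).
    by move=> k; exact: mulNr.
  by rewrite -mulNr; apply: ccvgM hF; exact: ccvg_cst.
apply: ccvg_unique H _.
apply: (@ccvg_eq _ (fun k => pi%:C * (1 - 'i * cF f ((t +i* y) + (e k) *i))^-1)).
  by move=> k; have [_ ->] := hk k.
apply: ccvgM; first exact: ccvg_cst.
apply: ccvgV; last by apply: resolvent_neq0; exact: (Pf_ge0 t y0 f0).
apply: ccvgD; first exact: ccvg_cst.
apply: (@ccvg_eq _ (fun k => (- 'i) * cF f (t +i* y + (e k) *i))).
  by move=> k; exact: mulNr.
by rewrite -mulNr; apply: ccvgM; [exact: ccvg_cst|exact: ccvg_cF_shift].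
Qed.

Lemma bounded_rint_kap g (M : R) : measurable_fun setT g -> (forall x, `|g x| <= M) ->
  rint mu (fun x => g x * kap x).
Proof. move=> mg gM; apply: (@rint_Ml _ _ _ mu M g) => //; exact: rint_kap. Qed.

(* [1 / (1 - i F)] is the Poisson integral of its limit along a sequence, so it
   converges at the Lebesgue points of that limit. *)
Lemma ae_cvg_Qf_ge0 f : rint mu f -> (forall s, 0 <= f s) ->
  {ae mu, forall t : R, exists l : R, Qf f y t @[y --> (0 : R)^'+] --> l}.
Proof.
move=> fi f0; have [e [e0 ec he]] := ae_cvg_Qf_seq fi f0.
pose A := seqlim (fun k => Qf f (e k)).
have mA : measurable_fun setT A by apply: measurable_seqlim => k; exact: measurable_Qf.
have hA : {ae mu, forall x : R, Qf f (e k) x @[k --> \oo] --> A x}.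
  apply: ae_imp he _ => x /cvg_ex[l hl].
  by rewrite /A (seqlimE hl).
have mf := rint_measurable fi.
have piF s : 0 <= pi * f s by rewrite mulr_ge0 ?pi_ge0.
pose w x : R[i] := (1 - 'i * (A x +i* (pi * f x)))^-1.
have wM x : cabs (w x) <= 1 by apply: cabs_resolvent_le1; exact: piF.
have mw : cmeas w.
  apply: cmeasV; apply: (@cmeasD _ _ R (fun=> 1)); first exact: cmeas_cst.
  split => /=.
    apply: (eq_measurable_fun (fun x => pi * f x)).
      by move=> x _; rewrite /= mul0r mul1r sub0r opprK.
    exact: measurable_funM.
  apply: (eq_measurable_fun (fun x => - A x)).
    by move=> x _; rewrite /= mul0r mul1r add0r.
  exact: measurable_funN.
have rk : rint mu (fun x => complex.Re (w x) * kap x).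
  by apply: bounded_rint_kap mw.1 _ => x; apply: le_trans (cabs_Re _) (wM x).
have ik : rint mu (fun x => complex.Im (w x) * kap x).
  by apply: bounded_rint_kap mw.2 _ => x; apply: le_trans (cabs_Im _) (wM x).
apply: ae_imp2 (ae_lebesgue_pt rk) (ae_lebesgue_pt ik) _ => t tr ti.
exists (A t); apply/cvg_at_rightP => y [y0 yc].
have cr : \int[mu]_x (complex.Re (w x) * pois t (y n) x) @[n --> \oo] -->
    pi * complex.Re (w t).
  by have /cvg_at_rightP := cvg_pois_int rk tr; apply.
have ci : \int[mu]_x (complex.Im (w x) * pois t (y n) x) @[n --> \oo] -->
    pi * complex.Im (w t).
  by have /cvg_at_rightP := cvg_pois_int ik ti; apply.
have H : ccvg (fun n => pi%:C * (1 - 'i * cF f (t +i* y n))^-1) (pi%:C * w t).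
  apply: (@ccvg_eq _ (fun n => cInt mu (fun x : R => w x * (pois t (y n) x)%:C))).
    by move=> n; exact: resolvent_poisson.
  split.
  - rewrite [X in _ --> X](_ : _ = pi * complex.Re (w t)); last first.
      by case: (w t) => a b /=; rewrite mul0r subr0.
    apply: cvg_trans cr; apply: near_eq_cvg; apply: nearW => n.
    by apply: rInt_eq => x; rewrite Re_mulC.
  - rewrite [X in _ --> X](_ : _ = pi * complex.Im (w t)); last first.
      by case: (w t) => a b /=; rewrite mul0r addr0.
    apply: cvg_trans ci; apply: near_eq_cvg; apply: nearW => n.
    by apply: rInt_eq => x; rewrite Im_mulC.
have pi0 : pi%:C != 0 :> R[i].
  by rewrite eq_complex /= negb_and gt_eqF// pi_gt0.
(* The limit of the resolvents does not vanish, so they can be inverted again and the Cauchy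
   transform itself converges. *)
have wt0 : pi%:C * w t != 0.
  rewrite mulf_neq0// invr_neq0// resolvent_neq0//; exact: piF.
have {}H := ccvgM (ccvg_cst pi%:C) (ccvgV H wt0).
have {}H : ccvg (fun n => 1 - 'i * cF f (t +i* y n)) (1 - 'i * (A t +i* (pi * f t))).
  have c2 (x : R[i]) : pi%:C * (pi%:C * x^-1)^-1 = x.
    by rewrite invfM invrK mulrA divff// mul1r.
  by rewrite -[X in ccvg _ X]c2; apply: ccvg_eq H => n; exact: c2.
have c : - complex.Im (1 - 'i * cF f (t +i* y n)) @[n --> \oo] -->
    - complex.Im (1 - 'i * (A t +i* (pi * f t))) by exact: cvgN H.2.
rewrite Im_resolvent opprK in c.
by apply: cvg_trans c; apply: near_eq_cvg; apply: nearW => n; rewrite Im_resolvent opprK.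
Qed.

Lemma Qf_lin f g h (a : R) y t : rint mu f -> rint mu g -> 0 < y ->
  (forall s, h s = f s + a * g s) -> Qf h y t = Qf f y t + a * Qf g y t.
Proof.
move=> fi gi y0 hE; rewrite /Qf (@cF_lin _ f g h a (t +i* y) fi gi y0 hE).
by case: (cF f _) (cF g _) => ? ? [] ? ? /=; rewrite mul0r subr0.
Qed.

Definition pospart f (x : R) := Num.max (f x) 0.

Lemma pospart_ge0 f x : 0 <= pospart f x.
Proof. by rewrite le_max lexx orbT. Qed.

Lemma pospart_le f x : pospart f x <= `|f x|.
Proof. by rewrite ge_max ler_norm normr_ge0. Qed.

Lemma pospartB f x : f x = pospart f x - pospart (fun s => - f s) x.
Proof.
by rewrite /pospart /Num.max; do ! case: ifPn; rewrite -?leNgt => *; lra.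
Qed.

Lemma rint_pospart f : rint mu f -> rint mu (pospart f).
Proof.
move=> fi; apply: rint_le (rint_norm fi) _.
  by apply: measurable_maxr; [exact: rint_measurable fi|exact: measurable_cst].
by move=> x; rewrite ger0_norm ?pospart_ge0 ?pospart_le.
Qed.

(* [hilb f = pi T(f)]; as for [seqlim], the value is meaningless where there is no limit. *)
Definition hilb f : R -> R := seqlim (fun n => Qf f n.+1%:R^-1).

Lemma measurable_hilb f : rint mu f -> measurable_fun setT (hilb f).
Proof.
by move=> fi; apply: measurable_seqlim => n; apply: measurable_Qf => //; rewrite invr_gt0.
Qed.

Lemma hilbE f t (l : R) : Qf f y t @[y --> (0 : R)^'+] --> l -> hilb f t = l.
Proof.
move=> /cvg_at_rightP h; apply: seqlimE; apply: h; split => [n|].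
  by rewrite invr_gt0.
exact: cvg_harmonic.
Qed.

Lemma ae_cvg_hilb f : rint mu f ->
  {ae mu, forall t : R, Qf f y t @[y --> (0 : R)^'+] --> hilb f t}.
Proof.
move=> fi; have pi_ := rint_pospart fi; have ni := rint_pospart (rintN fi).
have hp := ae_cvg_Qf_ge0 pi_ (pospart_ge0 f).
have hn := ae_cvg_Qf_ge0 ni (pospart_ge0 _).
apply: ae_imp2 hp hn _ => t [l hl] [k hk].
suff H : Qf f y t @[y --> (0 : R)^'+] --> l - k by rewrite (hilbE H).
apply: cvg_trans (cvgB hl hk); apply: near_eq_cvg; near=> y.
have y0 : 0 < y by near: y; exact: nbhs_right_gt.
by rewrite (@Qf_sub _ _ _ f y t pi_ ni y0 (pospartB f)).
Unshelve. all: by end_near. Qed.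

Lemma ae_hilb_lin f g h (a : R) : rint mu f -> rint mu g ->
  (forall s, h s = f s + a * g s) ->
  {ae mu, forall t : R, hilb h t = hilb f t + a * hilb g t}.
Proof.
move=> fi gi hE; apply: ae_imp2 (ae_cvg_hilb fi) (ae_cvg_hilb gi) _ => t hf hg.
apply: hilbE; apply: cvg_trans (cvgD hf (cvgM (cvg_cst a) hg)).
apply: near_eq_cvg; near=> y.
have y0 : 0 < y by near: y; exact: nbhs_right_gt.
by rewrite (Qf_lin t fi gi y0 hE).
Unshelve. all: by end_near. Qed.

Lemma rho_Qf_signed f (l e : R) : rint mu f -> 0 < l -> 0 < e ->
  rho (Qf f e) <= 2 * (pi * l + 4 * pi * (l^-1 * \int[mu]_s `|f s|)).
Proof.
move=> fi l0 e0; have pi_ := rint_pospart fi; have ni := rint_pospart (rintN fi).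
have E x : Qf f e x = Qf (pospart f) e x + - Qf (pospart (fun s => - f s)) e x.
  exact: Qf_sub pi_ ni e0 (pospartB f).
rewrite (rho_eq E); apply: le_trans (rhoD (measurable_Qf pi_ e0) _) _.
  by apply: measurable_funN; exact: measurable_Qf.
rewrite mulr_natl mulr2n.
have step g : rint mu g -> rho (Qf (pospart g) e) <=
    pi * l + 4 * pi * (l^-1 * \int[mu]_s `|g s|).
  move=> gi; apply: le_trans (rho_Qf (rint_pospart gi) (pospart_ge0 g) l0 e0) _.
  rewrite lerD2l ler_wpM2l ?mulr_ge0 ?pi_ge0// ler_wpM2l ?invr_ge0 ?(ltW l0)//.
  apply: rInt_le; [exact: rint_pospart|exact: rint_norm|exact: pospart_le].
apply: lerD; first exact: step.
rewrite (_ : rho _ = rho (Qf (pospart (fun s => - f s)) e)); last first.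
  by apply: rInt_eq => x; rewrite normrN.
apply: le_trans (step _ (rintN fi)) _.
by rewrite (rInt_eq mu (_ : _ =1 (fun s => `|f s|)))// => s; rewrite normrN.
Qed.

Lemma min1_dist (a b : R) : `|Num.min 1 `|a| - Num.min 1 `|b| | <= `|a - b|.
Proof.
apply: le_trans (ler_dist_dist a b).
rewrite /Num.min; have := normr_ge0 a; have := normr_ge0 b.
move: `|a| `|b| => p q p0 q0; rewrite ler_norml.
have := ler_norm (p - q); have := ler_norm (- (p - q)); rewrite normrN.
by do ! case: ifPn; rewrite -?leNgt => *; apply/andP; split; lra.
Qed.

Lemma rho_hilb f (l : R) : rint mu f -> 0 < l ->
  rho (hilb f) <= 2 * (pi * l + 4 * pi * (l^-1 * \int[mu]_s `|f s|)).
Proof.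
move=> fi l0.
have c : rho (Qf f y) @[y --> (0 : R)^'+] --> rho (hilb f).
  apply: (@rInt_dct_right R _ _ mu _ _ (@kap R)).
  - by move=> y y0; apply: rint_measurable (rint_min1_kap _); exact: measurable_Qf.
  - by apply: rint_measurable (rint_min1_kap _); exact: measurable_hilb.
  - exact: rint_kap.
  - move=> y x y0; rewrite normrM (ger0_norm (kap_ge0 x)) ler_piMl ?kap_ge0//.
    by rewrite ger0_norm ?le_min ?ler01//= ge_min lexx.
  - apply: ae_imp (ae_cvg_hilb fi) _ => x hx; apply: cvgM; last exact: cvg_cst.
    apply/cvgrPdist_le => r r0; move/cvgrPdist_le : hx => /(_ r r0).
    by apply: filterS => y; apply: le_trans; exact: min1_dist.
rewrite -(cvg_lim _ c)//; apply: limr_le; first exact: cvgP c.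
near=> y; have y0 : 0 < y by near: y; exact: nbhs_right_gt.
exact: rho_Qf_signed.
Unshelve. all: by end_near. Qed.

Lemma rho_trunc_bound (p a b : R) : 0 <= p -> a <= b ->
  2 * (p * b + 4 * p * a) <= 10 * p * b.
Proof. nra. Qed.

(** In the weak type inequality take l = 2^-k: an L1 error of 4^-k gives 4^-k / l = 2^-k, so the
    gauges of the errors are summable. *)
Lemma ae_hilb_trunc f (m : nat -> R) : rint mu f -> (forall k, 0 <= m k) ->
  (forall k, \int[mu]_x `|f x - trunc (m k) f x| <= 4^-1 ^+ k) ->
  {ae mu, forall t : R, hilb (trunc (m k) f) t @[k --> \oo] --> hilb f t}.
Proof.
move=> fi m0 hm.
have ti k : rint mu (trunc (m k) f) by exact: rint_trunc.
pose d k x := f x - trunc (m k) f x.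
have di k : rint mu (d k) by exact: rintB.
have H k : rho (hilb (d k)) <= 10 * pi * 2^-1 ^+ k.
  have l0 : 0 < (2^-1 : R) ^+ k by rewrite exprn_gt0// invr_gt0.
  apply: le_trans (rho_hilb (di k) l0) _.
  have h : (2^-1 ^+ k)^-1 * \int[mu]_s `|d k s| <= 2^-1 ^+ k.
    rewrite ler_pdivrMl// -exprMn.
    have -> : 2^-1 * 2^-1 = 4^-1 :> R by field.
    exact: hm.
  exact: rho_trunc_bound (pi_ge0 R) h.
have mh k : measurable_fun setT (hilb (d k)) by exact: measurable_hilb.
have C0 : 0 <= 10 * pi :> R by rewrite mulr_ge0// pi_ge0.
have h0 := ae_cvg0_rho C0 mh H.
have hl k : {ae mu, forall t : R, hilb (d k) t = hilb f t + (-1) * hilb (trunc (m k) f) t}.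
  by apply: ae_hilb_lin => // s; rewrite mulN1r.
apply: ae_imp2 h0 (ae_all hl) _ => t h0t ht.
have : hilb f t - hilb (d k) t @[k --> \oo] --> hilb f t - 0.
  by apply: cvgB => //; exact: cvg_cst.
rewrite subr0; apply: cvg_trans; apply: near_eq_cvg; apply: nearW => k.
by rewrite ht mulN1r opprD opprK addrA subrr add0r.
Qed.

End HilbertTransform.

Lemma half_sum (R : realFieldType) (a b c : R) : c <= a + b -> a < c / 2 -> c / 2 <= b.
Proof. lra. Qed.

Lemma add_thirds (R : realFieldType) (e a b c : R) :
  a <= e / 3 -> c <= e / 3 -> b <= e / 3 -> c + (a + b) <= e.
Proof. lra. Qed.

(** The jump is at least 19 eta / 40 - 8 eta / 40 = 11 eta / 40, more than the eta / 4 allowed for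
    two terms within eta / 8 of a common limit. This is what makes the tolerance eta / 20 small
    enough. *)
Lemma hump_arith (R : realFieldType) (eta l a b c : R) : 0 < eta ->
  `|l - a| < eta / 8 -> `|l - b| < eta / 8 -> (eta - eta / 20) / 2 <= `|c| ->
  `|a - b - c| <= 4 * (eta / 20) -> False.
Proof.
rewrite !ltr_norml !ler_norml => eta0 /andP[? ?] /andP[? ?] hc /andP[? ?].
by move: hc; case: (ger0P c) => ? ?; lra.
Qed.

(** * Nikodym's convergence theorem *)

Section Nikodym.
Context d (T : measurableType d) (R : realType) (nu : {measure set T -> \bar R}).
Variables (u : nat -> T -> R) (v : T -> R) (D : set T).
Hypotheses (mD : measurable D) (Dfin : (nu D < +oo)%E).
Hypothesis ui : forall k, rint nu (u k).
Hypothesis mv : measurable_fun setT v.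
Hypothesis uD : forall k x, ~ D x -> u k x = 0.
Hypothesis uv : {ae nu, forall x, u k x @[k --> \oo] --> v x}.

(* [exceed J] is where [sup_k |u k|] is larger than [J]. *)
Definition exceed (J : nat) : set T := [set x | exists k, J%:R < `|u k x|].

Local Notation E := exceed.
Local Notation ind A x := (\1_(A : set T) x : R).

Let mu_ k : measurable_fun setT (u k). Proof. exact: rint_measurable (ui k). Qed.

Lemma measurable_exceed J : measurable (E J).
Proof.
have -> : E J = \bigcup_k [set x | J%:R < `|u k x|].
  by apply/seteqP; split => x [k]; [exists k|move=> _; exists k].
apply: bigcupT_measurable => k.
rewrite -[X in measurable X]setTI.
have -> : [set x | J%:R < `|u k x|] = (fun x => `|u k x|) @^-1` `]J%:R, +oo[%classic.
  by apply/seteqP; split => x /=; rewrite in_itv/= andbT.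
by apply: measurableT_comp => //; exact: mu_.
Qed.

Lemma exceedS J J' x : (J <= J')%N -> E J' x -> E J x.
Proof. by move=> JJ [k hk]; exists k; apply: le_lt_trans hk; rewrite ler_nat. Qed.

Lemma indic_in (A : set T) x : A x -> ind A x = 1.
Proof. by move=> Ax; rewrite indicE mem_set. Qed.

Lemma indic_notin (A : set T) x : ~ A x -> ind A x = 0.
Proof. by move=> Ax; rewrite indicE memNset. Qed.

Lemma indic01 (A : set T) x : 0 <= ind A x <= 1.
Proof. by rewrite indicE; case: (_ \in _) => /=; rewrite ?lexx ?ler01. Qed.

Lemma rint_ind f (A : set T) : measurable A -> rint nu f ->
  rint nu (fun x => f x * ind A x).
Proof.
move=> mA fi; apply: (@rint_Mr _ _ _ nu 1 (fun x => ind A x)) => //.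
  exact: measurable_indic.
by move=> x; have /andP[h0 h1] := indic01 A x; rewrite ger0_norm.
Qed.

Lemma rint_indD : rint nu (fun x => ind D x).
Proof.
apply: rint_lty; first exact: measurable_indic.
under eq_integral => x _ do rewrite ger0_norm ?(proj1 (andP (indic01 D x)))//.
by rewrite integral_indic// setIT.
Qed.

Lemma ae_bounded : {ae nu, forall x, exists J : nat, forall J', (J <= J')%N -> ~ E J' x}.
Proof.
apply: ae_imp uv _ => x h.
have [M [_ hM]] := cvg_seq_bounded (cvgP _ h).
exists (Num.trunc (`|M| + 1)).+1 => J' JJ' [k]; apply/negP; rewrite -leNgt.
apply: (@le_trans _ _ (`|M| + 1)); first by apply: (hM (`|M| + 1)); rewrite ?(le_lt_trans (ler_norm M)) ?ltrDl.
by apply: le_trans (ltW (truncnS_gt _)) _; rewrite ler_nat.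
Qed.

(** Off [E J] the limit [v] is bounded by J only almost everywhere; truncating it gives a bound
    valid at every point, as the domination requires. *)
Local Notation inner J k x := (`|u k x - trunc J%:R v x| * ind (~` E J `&` D) x).

Lemma measurable_inside J : measurable (~` E J `&` D).
Proof. by apply: measurableI => //; apply: measurableC; exact: measurable_exceed. Qed.

Lemma rint_inner J k : rint nu (fun x => inner J k x).
Proof.
apply: (@rint_le _ _ _ nu _ (fun x => (2 * J%:R) * ind D x)).
- apply: measurable_funM; last by apply: measurable_indic; exact: measurable_inside.
  by apply: measurableT_comp => //; apply: measurable_funB => //; exact: measurable_trunc.
- by apply: rintZl; exact: rint_indD.
- move=> x; have [xA|xA] := pselect ((~` E J `&` D) x); last first.
    rewrite (indic_notin xA) mulr0 normr0.
    by apply: mulr_ge0; [exact: mulr_ge0|have /andP[] := indic01 D x].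
  case: (xA) => xE xD.
  rewrite (indic_in xA) (indic_in xD) !mulr1 normr_id.
  apply: le_trans (ler_normB _ _) _; rewrite mulr_natl mulr2n lerD ?trunc_bound//.
  by rewrite leNgt; apply/negP => h; apply: xE; exists k.
Qed.

Lemma cvg_inner J : \int[nu]_x inner J k x @[k --> \oo] --> (0 : R).
Proof.
rewrite [X in _ --> X](_ : (0 : R) = \int[nu]_x (fun=> 0 : R) x); last first.
  by rewrite /Rintegral integral0.
apply: (@rInt_dct_cvg _ _ _ nu (fun k x => inner J k x) _ (fun x => (2 * J%:R) * ind D x)).
- by move=> k; exact: rint_measurable (rint_inner J k).
- exact: measurable_cst.
- by apply: rintZl; exact: rint_indD.
- move=> k x; have [xA|xA] := pselect ((~` E J `&` D) x); last first.
    rewrite (indic_notin xA) mulr0 normr0.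
    by apply: mulr_ge0; [exact: mulr_ge0|have /andP[] := indic01 D x].
  case: (xA) => xE xD.
  rewrite (indic_in xA) (indic_in xD) !mulr1 normr_id.
  apply: le_trans (ler_normB _ _) _; rewrite mulr_natl mulr2n lerD ?trunc_bound//.
  by rewrite leNgt; apply/negP => h; apply: xE; exists k.
- apply: ae_imp uv _ => x h; have [xA|xA] := pselect ((~` E J `&` D) x); last first.
    by rewrite (indic_notin xA); under eq_fun do rewrite mulr0; exact: cvg_cst.
  rewrite (indic_in xA); under eq_fun do rewrite mulr1.
  have vJ : `|v x| <= J%:R.
    have hn := cvg_norm h; rewrite -(cvg_lim (@Rhausdorff R) (hn _)).
    apply: limr_le; first exact: cvgP (hn _).
    apply: nearW => k; rewrite leNgt; apply/negP => hk; apply: xA.1; exists k; exact: hk.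
  rewrite trunc_id// -(normr0 R) -(subrr (v x)).
  by apply: cvg_norm; apply: cvgB => //; exact: cvg_cst.
Qed.

Lemma cvg_exceed k : \int[nu]_x (`|u k x| * ind (E J) x) @[J --> \oo] --> (0 : R).
Proof.
rewrite [X in _ --> X](_ : (0 : R) = \int[nu]_x (fun=> 0 : R) x); last first.
  by rewrite /Rintegral integral0.
apply: (@rInt_dct_cvg _ _ _ nu (fun J x => `|u k x| * ind (E J) x) _ (fun x => `|u k x|)).
- move=> J; apply: measurable_funM; first exact: measurableT_comp.
  by apply: measurable_indic; exact: measurable_exceed.
- exact: measurable_cst.
- exact: rint_norm.
- move=> J x; have /andP[h0 h1] := indic01 (E J) x.
  by rewrite normrM normr_id (ger0_norm h0) ler_piMr.
- apply: ae_imp ae_bounded _ => x [J hJ]; apply: cvg_near_cst.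
  by exists J => // J' /= JJ'; rewrite (indic_notin (hJ _ JJ')) mulr0.
Qed.

Section SlidingHump.
Variables (eta : R) (eta0 : 0 < eta).
Hypothesis big : forall J k0, exists2 k, (k0 <= k)%N &
  eta < \int[nu]_x (`|u k x| * ind (E J) x).
Let e := eta / 20.

(** [s] holds the current level and the least admissible index, [r] the next level and the chosen
    index. That function has more than eta of its mass above the current level and at most e above
    the next one; from this index on, all functions are e-close to the limit below the current
    level. *)
Lemma hump_step (s : nat * nat) : exists r : nat * nat,
  [/\ (s.2 <= r.2)%N /\ (s.1 < r.1)%N,
   eta < \int[nu]_x (`|u r.2 x| * ind (E s.1) x),
   \int[nu]_x (`|u r.2 x| * ind (E r.1) x) <= e &
   forall k, (r.2 <= k)%N -> \int[nu]_x inner s.1 k x <= e].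
Proof.
have e0 : 0 < e by rewrite divr_gt0.
have /cvgrPdist_le /(_ _ e0) [n _ hn] := cvg_inner s.1.
have [k kn hk] := big s.1 (maxn n s.2).
have /cvgrPdist_le /(_ _ e0) [J _ hJ] := cvg_exceed k.
exists (maxn J s.1.+1, k); split => //=.
- split; last exact: leq_maxr.
  by apply: leq_trans kn; exact: leq_maxr.
- have := hJ (maxn J s.1.+1) (leq_maxl _ _); rewrite /= sub0r normrN.
  by apply: le_trans; exact: ler_norm.
- move=> l kl; have := hn l; rewrite /= sub0r normrN => /(_ _)/le_trans h.
  apply: le_trans (ler_norm _) _; apply: h => //.
  by apply: leq_trans kl; apply: leq_trans kn; exact: leq_maxl.
Qed.

Lemma hump_sequence : exists (J k : nat -> nat),
  [/\ forall i, (J i < J i.+1)%N, forall i, (k i < k i.+1)%N,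
   forall i, eta < \int[nu]_x (`|u (k i) x| * ind (E (J i)) x),
   forall i, \int[nu]_x (`|u (k i) x| * ind (E (J i.+1)) x) <= e &
   forall i l, (k i <= l)%N -> \int[nu]_x inner (J i) l x <= e].
Proof.
have /choice[next hnext] := hump_step.
(* The state is the level together with the least index allowed next; the successor makes the chosen
   indices strictly increasing. *)
pose st := fix st i := if i is i'.+1 then
  let r := next (st i') in (r.1, r.2.+1) else (0%N, 0%N).
exists (fun i => (st i).1), (fun i => (next (st i)).2); split => i.
- by have [[_ h] _ _ _] := hnext (st i).
- by have [[h _] _ _ _] := hnext (st i.+1).
- by have [_ h _ _] := hnext (st i).
- by have [_ _ h _] := hnext (st i).
- by have [_ _ _ h] := hnext (st i) => l; exact: h.
Qed.

Hypothesis cvgA : forall A, measurable A -> cvgn (fun k => \int[nu]_x (u k x * ind A x)).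

(* The rings [E (J i) \ E (J i.+1)] are disjoint. On the ring [i] the function
   [u (k i)] has most of its tail mass, half of it with the sign [sg i]. The set
   [A] collects these halves for even [i] only, so from [k i] to [k i.+1], with
   [i] odd, the integral over [A] jumps by a fixed amount. *)
Lemma sliding_hump : False.
Proof.
have e0 : 0 < e by rewrite divr_gt0.
have [J [k [Jlt klt P1 P3 P2]]] := hump_sequence.
have mE n := measurable_exceed n.
have Jle i j : (i <= j)%N -> (J i <= J j)%N.
  move=> /subnK <-; elim: (j - i)%N => [//|n IH].
  by rewrite addSn; apply: leq_trans IH (ltnW (Jlt _)).
have kle i : (i <= k i)%N.
  by elim: i => [//|i IH]; apply: leq_ltn_trans IH (klt i).
pose ring i : set T := E (J i) `&` ~` E (J i.+1).
have mring i : measurable (ring i) by apply: measurableI => //; exact: measurableC.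
have ring_inj i j x : ring i x -> ring j x -> i = j.
  move=> [iE niE] [jE njE]; apply/eqP; rewrite eqn_leq; apply/andP; split; rewrite leqNgt;
    apply/negP => h; [apply: njE|apply: niE]; exact: exceedS (Jle _ _ h) _.
pose uk i x := u (k i) x.
have uki i : rint nu (uk i) by exact: ui.
pose sg i : R := if (eta - e) / 2 <= \int[nu]_x (Num.max (uk i x) 0 * ind (ring i) x)
  then 1 else -1.
pose piece i : set T := ring i `&` [set x | 0 < sg i * uk i x].
have mpiece i : measurable (piece i).
  apply: measurableI => //; rewrite -[X in measurable X]setTI.
  have -> : [set x | 0 < sg i * uk i x] = (fun x => sg i * uk i x) @^-1` `]0, +oo[%classic.
    by apply/seteqP; split => x /=; rewrite in_itv/= andbT.
  have : measurable_fun setT (fun x => sg i * uk i x).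
    by apply: measurable_funM; [exact: measurable_cst|exact: mu_].
  by apply.
have maxi i s : rint nu (fun x => Num.max (s * uk i x) 0 * ind (ring i) x).
  apply: rint_ind => //; apply: (@rint_le _ _ _ nu _ (fun x => `|s| * `|uk i x|)).
  - apply: measurable_maxr; last exact: measurable_cst.
    by apply: measurable_funM; [exact: measurable_cst|exact: mu_].
  - by apply: rintZl; exact: rint_norm.
  - move=> x; rewrite -normrM [X in X <= _]ger0_norm; last by rewrite le_max lexx orbT.
    by rewrite ge_max ler_norm normr_ge0.
have half i : (eta - e) / 2 <= \int[nu]_x (Num.max (sg i * uk i x) 0 * ind (ring i) x).
  rewrite /sg; case: ifPn => [h|].
    by apply: le_trans h _; rewrite le_eqVlt; apply/orP; left; apply/eqP;
       apply: rInt_eq => x; rewrite mul1r.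
  rewrite -ltNge => h.
  have tot : eta - e <= \int[nu]_x (`|uk i x| * ind (ring i) x).
    have i1 : rint nu (fun x => `|uk i x| * ind (E (J i)) x).
      by apply: rint_ind => //; exact: rint_norm.
    have i2 : rint nu (fun x => `|uk i x| * ind (E (J i.+1)) x).
      by apply: rint_ind => //; exact: rint_norm.
    have -> : \int[nu]_x (`|uk i x| * ind (ring i) x) =
      \int[nu]_x (`|uk i x| * ind (E (J i)) x - `|uk i x| * ind (E (J i.+1)) x).
      apply: rInt_eq => x; rewrite -mulrBr; congr (_ * _).
      have [x1|x1] := pselect (E (J i.+1) x).
        rewrite (indic_in x1) (indic_in (exceedS (ltnW (Jlt i)) x1)) subrr.
        by rewrite indic_notin// => -[].
      rewrite (indic_notin x1) subr0; have [x2|x2] := pselect (E (J i) x).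
        by rewrite (indic_in x2) indic_in.
      by rewrite (indic_notin x2) indic_notin// => -[].
    by rewrite rIntB//; apply: lerB; [exact: ltW (P1 i)|exact: P3].
  have split_ : \int[nu]_x (`|uk i x| * ind (ring i) x) =
    \int[nu]_x (Num.max (uk i x) 0 * ind (ring i) x) +
    \int[nu]_x (Num.max (-1 * uk i x) 0 * ind (ring i) x).
    rewrite -rIntD; last exact: maxi.
      apply: rInt_eq => x; rewrite -mulrDl; congr (_ * _); rewrite mulN1r.
      by case: (ger0P (uk i x)) => h0; rewrite /Num.max; do ! case: ifPn; rewrite -?leNgt => *; lra.
    by apply: rint_eq (maxi i 1) => x; rewrite mul1r.
  by move: tot h; rewrite split_; exact: half_sum.
pose A := \bigcup_j piece j.*2.
have mA : measurable A by apply: bigcupT_measurable.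
have Aring j x : A x -> ring j x -> exists2 j', j = j'.*2 & piece j x.
  move=> [j' _ [rj hj]] rx; have jj := ring_inj _ _ _ rj rx.
  by exists j' => //; rewrite -jj; split.
have pieceE i : `|\int[nu]_x (uk i x * ind (piece i) x)| =
    \int[nu]_x (Num.max (sg i * uk i x) 0 * ind (ring i) x).
  have s2 : sg i * sg i = 1 by rewrite /sg; case: ifP => _; rewrite ?mulr1// mulrNN mulr1.
  have s1 : `|sg i| = 1 by rewrite /sg; case: ifP => _; rewrite ?normrN normr1.
  rewrite -[LHS]mul1r -s1 -normrM -rIntZl; last exact: rint_ind.
  rewrite ger0_norm.
    apply: rInt_eq => x; rewrite mulrA.
    have [xr|xr] := pselect (ring i x); last first.
      by rewrite (indic_notin xr) mulr0 indic_notin ?mulr0// => -[].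
    have [h|h] := ltP 0 (sg i * uk i x).
      by rewrite (indic_in xr) indic_in// max_l// ltW.
    rewrite indic_notin ?mulr0; last by move=> [_ /=]; rewrite ltNge h.
    by rewrite mul0r.
  apply: rInt_ge0 => x; rewrite mulrA.
  have [[xr xp]|xp] := pselect (piece i x).
    by rewrite indic_in// mulr1 ltW.
  by rewrite indic_notin// mulr0.
(* Below level J i the two functions are close to the same limit; ring i misses A since i is odd; on
   ring i + 1 the set A is exactly the piece subtracted, which leaves the tail of [uk i]; above
   level J (i + 2) both tails are small. Each of the four integrals involved is at most e. *)
have key i : ~~ odd i.+1 ->
    `|\int[nu]_x (uk i.+1 x * ind A x) - \int[nu]_x (uk i x * ind A x) -
      \int[nu]_x (uk i.+1 x * ind (piece i.+1) x)| <= 4 * e.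
  move=> oi.
  have ia := rint_ind mA (uki i.+1); have ib := rint_ind mA (uki i).
  have ic := rint_ind (mpiece i.+1) (uki i.+1).
  rewrite -(rIntB ia ib) -(rIntB (rintB ia ib) ic).
  have j1 := rint_inner (J i) (k i.+1); have j2 := rint_inner (J i) (k i).
  have j3 : rint nu (fun x => `|uk i x| * ind (E (J i.+1)) x).
    by apply: rint_ind => //; exact: rint_norm.
  have j4 : rint nu (fun x => `|uk i.+1 x| * ind (E (J i.+2)) x).
    by apply: rint_ind => //; exact: rint_norm.
  apply: (@le_trans _ _ (\int[nu]_x (inner (J i) (k i.+1) x + inner (J i) (k i) x +
      `|uk i x| * ind (E (J i.+1)) x + `|uk i.+1 x| * ind (E (J i.+2)) x))).
    apply: rInt_normle.
    - exact: rint_measurable (rintB (rintB ia ib) ic).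
    - exact: rintD (rintD (rintD j1 j2) j3) j4.
    move=> x.
    have n1 : 0 <= inner (J i) (k i.+1) x by rewrite mulr_ge0//; have /andP[] := indic01 (~` E (J i) `&` D) x.
    have n2 : 0 <= inner (J i) (k i) x by rewrite mulr_ge0//; have /andP[] := indic01 (~` E (J i) `&` D) x.
    have n3 : 0 <= `|uk i x| * ind (E (J i.+1)) x by rewrite mulr_ge0//; have /andP[] := indic01 (E (J i.+1)) x.
    have n4 : 0 <= `|uk i.+1 x| * ind (E (J i.+2)) x by rewrite mulr_ge0//; have /andP[] := indic01 (E (J i.+2)) x.
    have [xD|xD] := pselect (D x); last first.
      rewrite /uk !uD// !mul0r !subrr normr0 mul0r addr0.
      by rewrite addr_ge0// addr_ge0.
    have /andP[a0 a1] := indic01 A x.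
    have [x0|x0] := pselect (E (J i) x); last first.
      have x1 : ~ E (J i.+1) x by move=> /(exceedS (ltnW (Jlt i))).
      rewrite [ind (piece _) x]indic_notin; last by move=> [[]].
      rewrite mulr0 subr0 -mulrBl normrM (ger0_norm a0).
      rewrite (indic_in (conj x0 xD : (~` E (J i) `&` D) x)) !mulr1.
      apply: (@le_trans _ _ `|uk i.+1 x - uk i x|); first by rewrite ler_piMr.
      rewrite -addrA ler_wpDr ?addr_ge0//.
      have -> : uk i.+1 x - uk i x = (uk i.+1 x - trunc (J i)%:R v x) - (uk i x - trunc (J i)%:R v x).
        by ring.
      exact: ler_normB.
    have [x1|x1] := pselect (E (J i.+1) x); last first.
      have xA : ~ A x.
        move=> /(Aring i) /(_ (conj x0 x1)) [j' ij _].
        by move: oi; rewrite ij /= odd_double.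
      rewrite (indic_notin xA) [ind (piece _) x]indic_notin; last by move=> [[]].
      by rewrite !mulr0 !subrr normr0 !addr_ge0.
    have [x2|x2] := pselect (E (J i.+2) x); last first.
      have -> : ind A x = ind (piece i.+1) x.
        have [xp|xp] := pselect (piece i.+1 x).
          rewrite (indic_in xp) indic_in//; exists i.+1./2 => //.
          have -> : i.+1./2.*2 = i.+1 by rewrite -[RHS]odd_double_half (negbTE oi).
          exact: xp.
        rewrite (indic_notin xp) indic_notin// => /(Aring i.+1) /(_ (conj x1 x2)) [_ _].
        exact: xp.
      rewrite addrAC subrr sub0r normrN normrM.
      have /andP[p0 p1] := indic01 (piece i.+1) x.
      rewrite (ger0_norm p0) (indic_in x1) mulr1.
      apply: (@le_trans _ _ `|uk i x|); first by rewrite ler_piMr.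
      rewrite -addrA addrC -addrA lerDl addr_ge0//; rewrite mulr1 in n3.
    rewrite [ind (piece _) x]indic_notin; last by move=> [[_ h] _]; exact: h.
    rewrite mulr0 subr0 -mulrBl normrM (ger0_norm a0) (indic_in x1) (indic_in x2) !mulr1.
    apply: (@le_trans _ _ `|uk i.+1 x - uk i x|); first by rewrite ler_piMr.
    apply: le_trans (ler_normB _ _) _.
    by rewrite -addrA [X in X <= _]addrC ler_wpDl// addr_ge0.
  rewrite (rIntD (rintD (rintD j1 j2) j3) j4) (rIntD (rintD j1 j2) j3) (rIntD j1 j2).
  have -> : 4 * e = e + e + e + e by ring.
  by rewrite !lerD// ?P3 ?P2// ltnW.
have /cvg_ex[l /cvgrPdist_lt hl] := cvgA mA.
have eta8 : 0 < eta / 8 by rewrite divr_gt0.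
have [N _ hN] := hl _ eta8.
pose i := N.*2.+1.
have oi : ~~ odd i.+1 by rewrite /= odd_double.
have Ni : (N <= i)%N by rewrite /i -addnn ltnW// ltnS leq_addr.
have h1 := hN (k i.+1) (leq_trans Ni (leq_trans (leqnSn _) (kle i.+1))).
have h2 := hN (k i) (leq_trans Ni (kle i)).
have := key i oi; have := half i.+1; rewrite -pieceE.
move: h1 h2; rewrite /= -/(uk i.+1) -/(uk i) /uk.
move: (\int[nu]_x (u (k i.+1) x * ind A x)) (\int[nu]_x (u (k i) x * ind A x))
  (\int[nu]_x (u (k i.+1) x * ind (piece i.+1) x)) => a b c.
exact: hump_arith.
Qed.

End SlidingHump.

Hypothesis cvgA : forall A, measurable A -> cvgn (fun k => \int[nu]_x (u k x * ind A x)).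

Lemma uniform_tail (eta : R) : 0 < eta -> exists J k0, forall k, (k0 <= k)%N ->
  \int[nu]_x (`|u k x| * ind (E J) x) <= eta.
Proof.
move=> eta0; apply: contrapT => h; apply: (sliding_hump eta0 _ cvgA) => J k0.
apply: contrapT => h2; apply: h; exists J, k0 => k kk; rewrite leNgt; apply/negP => hk.
by apply: h2; exists k.
Qed.

Lemma ae_v_off : {ae nu, forall x, ~ D x -> v x = 0}.
Proof.
apply: ae_imp uv _ => x h xD; have := h; under eq_fun do rewrite uD//.
by move=> /(cvg_lim (@Rhausdorff R)) <-; rewrite lim_cst.
Qed.

Lemma ae_v_inside J : {ae nu, forall x, ~ E J x -> `|v x| <= J%:R}.
Proof.
apply: ae_imp uv _ => x h xA; have hn := cvg_norm h.
rewrite -(cvg_lim (@Rhausdorff R) (hn _)).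
apply: limr_le; first exact: cvgP (hn _).
by apply: nearW => k; rewrite leNgt; apply/negP => hk; apply: xA; exists k.
Qed.

Lemma rint_absE J k : rint nu (fun x => `|u k x| * ind (E J) x).
Proof. by apply: rint_ind; [exact: measurable_exceed|exact: rint_norm]. Qed.

(** On [D] and off [E J] each [u k] is bounded by J, so a bound on the tails bounds the whole L1
    norm by eta + J nu(D). Fatou's lemma passes both bounds to the limit. *)
Lemma tail_fatou eta J k0 :
  (forall k, (k0 <= k)%N -> \int[nu]_x (`|u k x| * ind (E J) x) <= eta) ->
  rint nu v /\ \int[nu]_x (`|v x| * ind (E J) x) <= eta.
Proof.
move=> tail.
have sh x : u k x @[k --> \oo] --> v x -> `|u (k + k0)%N x| @[k --> \oo] --> `|v x|.
  by move=> h; apply: cvg_norm; rewrite (cvg_shiftn k0 (fun k => u k x)).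
have [vi _] : rint nu (fun x => `|v x|) /\
    \int[nu]_x `|(`|v x|)| <= eta + \int[nu]_x (J%:R * ind D x).
  apply: (@rInt_fatou _ _ _ nu (fun k x => `|u (k + k0)%N x|)) => //.
  - by move=> k; exact: rint_norm.
  - exact: measurableT_comp.
  - by apply: ae_imp uv _ => x; exact: sh.
  move=> k; have iD : rint nu (fun x => J%:R * ind D x) by apply: rintZl; exact: rint_indD.
  apply: (@le_trans _ _ (\int[nu]_x (`|u (k + k0)%N x| * ind (E J) x + J%:R * ind D x))).
    apply: rInt_le; first exact: rint_norm.
      by apply: rintD => //; exact: rint_absE.
    move=> x; have [xD|xD] := pselect (D x); last first.
      by rewrite uD// normr0 mul0r add0r (indic_notin xD) mulr0.
    have [xE|xE] := pselect (E J x).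
      by rewrite (indic_in xE) mulr1 (indic_in xD) mulr1 lerDl.
    rewrite (indic_notin xE) mulr0 add0r (indic_in xD) mulr1.
    by rewrite leNgt; apply/negP => h; apply: xE; exists (k + k0)%N.
  rewrite (rIntD (rint_absE J _) iD) lerD2r; apply: tail; exact: leq_addl.
split.
  apply: (@rint_le _ _ _ nu _ (fun x => `|v x|)) => //.
have mE := measurable_exceed J.
have [_] : rint nu (fun x => `|v x| * ind (E J) x) /\
    \int[nu]_x `|(`|v x| * ind (E J) x)| <= eta.
  apply: (@rInt_fatou _ _ _ nu (fun k x => `|u (k + k0)%N x| * ind (E J) x)) => //.
  - by move=> k; exact: rint_absE.
  - by apply: measurable_funM; [exact: measurableT_comp|exact: measurable_indic].
  - apply: ae_imp uv _ => x h; apply: cvgM; [exact: sh|exact: cvg_cst].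
  - by move=> k; apply: tail; exact: leq_addl.
apply: le_trans; rewrite le_eqVlt; apply/orP; left; apply/eqP; apply: rInt_eq => x.
by rewrite [RHS]ger0_norm.
Qed.

(** Integrability of the limit is part of the conclusion. Off [E J] the convergence is dominated,
    [D] having finite measure; on [E J] the tails of the [u k] are uniformly small for large k, and
    so is that of [v] by Fatou's lemma. *)
Lemma nikodym : rint nu v /\ \int[nu]_x u k x @[k --> \oo] --> \int[nu]_x v x.
Proof.
have [J1 [k1 t1]] := uniform_tail ltr01.
have [vi _] := tail_fatou t1; split => //.
apply/cvgrPdist_le => eps eps0; have e3 : 0 < eps / 3 by rewrite divr_gt0.
have [J [k0 tail]] := uniform_tail e3.
have [_ vE] := tail_fatou tail.
have /cvgrPdist_le /(_ _ e3) [n _ hn] := cvg_inner J.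
have mE := measurable_exceed J.
have iv : rint nu (fun x => `|v x| * ind (E J) x) by apply: rint_ind => //; exact: rint_norm.
exists (maxn k0 n) => // k; rewrite /= geq_max => /andP[kk nk].
have hk : \int[nu]_x inner J k x <= eps / 3.
  by apply: le_trans (ler_norm _) _; have := hn k nk; rewrite /= sub0r normrN.
have iu := rint_absE J k; have ii := rint_inner J k.
have idiff := rint_norm (rintB vi (ui k)).
rewrite -rIntB//; apply: le_trans (rInt_norm (rintB vi (ui k))) _.
have -> : \int[nu]_x `|v x - u k x| =
    \int[nu]_x (inner J k x + `|v x - u k x| * ind (E J) x).
  apply: rInt_ae; first exact: rint_measurable idiff.
    exact: rint_measurable (rintD ii (rint_ind mE idiff)).
  apply: ae_imp2 ae_v_off (ae_v_inside J) _ => x h1 h2.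
  have [xE|xE] := pselect (E J x).
    by rewrite (indic_in xE) mulr1 indic_notin ?mulr0 ?add0r// => -[].
  rewrite (indic_notin xE) mulr0 addr0; have [xD|xD] := pselect (D x).
    by rewrite indic_in// mulr1 trunc_id ?h2// distrC.
  by rewrite indic_notin ?mulr0; [rewrite uD// h1// subrr normr0|case].
apply: (@le_trans _ _ (\int[nu]_x (inner J k x +
    (`|v x| * ind (E J) x + `|u k x| * ind (E J) x)))).
  apply: rInt_le; [exact: rintD ii (rint_ind mE idiff)|exact: rintD ii (rintD iv iu)|].
  move=> x; rewrite lerD2l -mulrDl ler_wpM2r ?ler_normB//.
rewrite (rIntD ii (rintD iv iu)) (rIntD iv iu).
have := tail k kk; move: vE hk.
move: (\int[nu]_x (`|v x| * _)) (\int[nu]_x (`|u k x| * _)) (\int[nu]_x inner J k x).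
exact: add_thirds.
Qed.
End Nikodym.

(** * Parseval's formula *)

Section Parseval.
Context (R : realType).
Notation mu := (@lebesgue_measure R).
Implicit Types (f g h : R -> R).

Lemma Qf_abs_bound f (e x : R) : rint mu f -> 0 < e ->
  `|Qf f e x| <= 2 * (e^-1 * \int[mu]_s `|f s|).
Proof.
by move=> fi e0; apply: le_trans (cabs_Re _) _; exact: (@cabs_cF R f (x +i* e)).
Qed.

(** Fatou's lemma in [Qf_L2_cauchy], as the second height runs through values below [d] that tend to
    0. *)
Lemma hilb_L2 f (M eta : R) : rint mu f -> (forall s, `|f s| <= M) -> 0 < eta ->
  exists2 d : R, 0 < d & forall e, 0 < e -> e < d ->
  rint mu (fun x => (Qf f e x - hilb f x) ^+ 2 * kap x) /\
  \int[mu]_x ((Qf f e x - hilb f x) ^+ 2 * kap x) <= eta.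
Proof.
move=> fi fM eta0; have [d d0 hd] := Qf_L2_cauchy fi fM eta0.
exists d => // e e0 ed.
pose y (n : nat) : R := d / 2 * n.+1%:R^-1.
have d2 : 0 < d / 2 by rewrite divr_gt0.
have y0 n : 0 < y n by rewrite mulr_gt0// invr_gt0.
have yd n : y n < d.
  apply: (@le_lt_trans _ _ (d / 2)); last by rewrite ltr_pdivrMr// ltr_pMr// ltrDl.
  by rewrite ler_piMr ?(ltW d2)// invf_le1// ler1n.
have yc : y n @[n --> \oo] --> (0 : R).
  rewrite -[X in _ --> X](mulr0 (d / 2)); apply: cvgM; first exact: cvg_cst.
  exact: cvg_harmonic.
have mk := rint_measurable (rint_kap R).
have [h1 h2] : rint mu (fun x => (Qf f e x - hilb f x) ^+ 2 * kap x) /\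
    \int[mu]_x `|(Qf f e x - hilb f x) ^+ 2 * kap x| <= eta.
  apply: (@rInt_fatou _ _ _ mu (fun n x => (Qf f e x - Qf f (y n) x) ^+ 2 * kap x)).
  - by move=> n; have [|] := Qf_L2 fi e0 (y0 n); first by exists M.
  - apply: measurable_funM => //; apply: measurable_funX; apply: measurable_funB.
      exact: measurable_Qf.
    exact: measurable_hilb.
  - by move=> n x; rewrite mulr_ge0 ?sqr_ge0 ?kap_ge0.
  - apply: ae_imp (ae_cvg_hilb fi) _ => x /cvg_at_rightP hx.
    apply: cvgM; last exact: cvg_cst.
    apply: (@cvgM _ _ _ eventually_filter); apply: cvgB;
      by [exact: cvg_cst|apply: hx].
  - by move=> n; exact: hd.
split => //; apply: le_trans h2; apply: rInt_le => //; first exact: rint_norm.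
by move=> x; exact: ler_norm.
Qed.

Lemma abs_le_sqr (l w : R) : 0 < l -> `|w| <= l + l^-1 * w ^+ 2.
Proof.
move=> l0; rewrite -(ler_pM2l l0) mulrDr mulrA divff ?lt0r_neq0// mul1r.
rewrite -(real_normK (num_real w)); have := sqr_ge0 (`|w| - l); have := normr_ge0 w.
nra.
Qed.

(** At one fixed height the function [Qf f] is bounded, and |w| <= 1 + w^2 bounds its distance to
    [hilb f] by a function integrable against [kap]. *)
Lemma rint_mul_hilb f h (M C : R) : rint mu f -> (forall s, `|f s| <= M) ->
  measurable_fun setT h -> (forall s, `|h s| <= C * kap s) ->
  rint mu (fun x => h x * hilb f x).
Proof.
move=> fi fM mh hC; have [d d0 hd] := hilb_L2 fi fM ltr01.
have d2 : 0 < d / 2 by rewrite divr_gt0.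
have d2d : d / 2 < d by rewrite ltr_pdivrMr// ltr_pMr// ltrDl.
have [i1 _] := hd _ d2 d2d; have mH := measurable_hilb fi.
pose K := 2 * ((d / 2)^-1 * \int[mu]_s `|f s|).
have C0 : 0 <= C.
  by have := le_trans (normr_ge0 _) (hC 0); rewrite pmulr_lge0// kap_gt0.
apply: (@rint_le _ _ _ mu _ (fun x => C * ((K + 1) * kap x + (Qf f (d / 2) x - hilb f x) ^+ 2 * kap x))).
- exact: measurable_funM.
- by apply: rintZl; apply: rintD => //; exact: rint_kapZ.
move=> x; rewrite normrM -mulrDl mulrA [C * _]mulrC -mulrA [X in _ <= X]mulrC.
apply: ler_pM => //.
have q := Qf_abs_bound x fi d2; have := @abs_le_sqr 1 (Qf f (d / 2) x - hilb f x) ltr01.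
rewrite invr1 mul1r => h1.
have -> : hilb f x = Qf f (d / 2) x - (Qf f (d / 2) x - hilb f x) by rewrite opprB addrC subrK.
apply: le_trans (ler_normB _ _) _; rewrite -addrA lerD//.
by rewrite subKr.
Qed.

Lemma eps_split (p C l e : R) : 0 <= p -> 0 <= C -> l = e / (2 * (C * p + 1)) -> 0 < e ->
  C * (p * l) <= e / 2.
Proof.
move=> p0 C0 -> e0; have h : 0 < 2 * (C * p + 1) by nra.
have -> : C * (p * (e / (2 * (C * p + 1)))) = (C * p * e) / (2 * (C * p + 1)) by ring.
by rewrite ler_pdivrMr//; nra.
Qed.

Lemma eps_split2 (C l e : R) : 0 <= C -> 0 < l -> 0 < e ->
  C * (l^-1 * (e * l / (2 * (C + 1)))) <= e / 2.
Proof.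
move=> C0 l0 e0; have h : 0 < 2 * (C + 1) by nra.
have -> : C * (l^-1 * (e * l / (2 * (C + 1)))) = (C * e) / (2 * (C + 1)).
  by field; rewrite (lt0r_neq0 l0) andbT; apply/eqP; lra.
by rewrite ler_pdivrMr//; nra.
Qed.

Lemma cvg_int_mul_hilb f h (M C : R) : rint mu f -> (forall s, `|f s| <= M) ->
  measurable_fun setT h -> (forall s, `|h s| <= C * kap s) ->
  \int[mu]_x (h x * Qf f y x) @[y --> (0 : R)^'+] --> \int[mu]_x (h x * hilb f x).
Proof.
move=> fi fM mh hC; apply/cvgrPdist_le => e e0.
have C0 : 0 <= C.
  by have := le_trans (normr_ge0 _) (hC 0); rewrite pmulr_lge0// kap_gt0.
(* The difference is split by |w| <= l + w^2 / l. This [l] makes the first term cost at most e / 2,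
   and the L2 tolerance below does the same for the second; the added 1 keeps the denominators
   positive when C = 0. *)
pose l := e / (2 * (C * pi + 1)).
have pi0 : 0 <= pi :> R by exact: pi_ge0.
have l0 : 0 < l by rewrite divr_gt0// mulr_gt0// ltr_wpDl// mulr_ge0.
have eta0 : 0 < e * l / (2 * (C + 1)) by rewrite divr_gt0// mulr_gt0// ltr_wpDl.
have [d d0 hd] := hilb_L2 fi fM eta0.
exists d => // y /=; rewrite sub0r normrN => yd y0.
rewrite gtr0_norm// in yd.
have [i1 b1] := hd _ y0 yd.
have ih := rint_mul_hilb fi fM mh hC.
have iq : rint mu (fun x => h x * Qf f y x).
  apply: (@rint_Mr _ _ _ mu (2 * (y^-1 * \int[mu]_s `|f s|))).
  - exact: measurable_Qf.
  - by move=> x; exact: Qf_abs_bound.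
  - by apply: rint_le (rint_kapZ C) hC.
rewrite -rIntB//.
apply: (@le_trans _ _ (\int[mu]_x (C * (l * kap x) + C * (l^-1 * ((Qf f y x - hilb f x) ^+ 2 * kap x))))).
  apply: rInt_normle.
  - exact: rint_measurable (rintB ih iq).
  - by apply: rintD; apply: rintZl; [exact: rint_kapZ|exact: rintZl].
  move=> x; rewrite -mulrBr normrM -mulrDr mulrA -mulrDl -[`|h x| * _]mulrC.
  rewrite [X in _ <= X]mulrCA distrC; apply: ler_pM => //.
  exact: abs_le_sqr.
rewrite rIntD; [|by apply: rintZl; exact: rint_kapZ|by apply: rintZl; exact: rintZl].
rewrite (rIntZl C (rint_kapZ l)) (rIntZl l (rint_kap R)).
rewrite (rIntZl C (rintZl l^-1 i1)) (rIntZl l^-1 i1) int_kap [l * pi]mulrC.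
have h1 := eps_split pi0 C0 erefl e0.
have h2 : C * (l^-1 * \int[mu]_x ((Qf f y x - hilb f x) ^+ 2 * kap x)) <= e / 2.
  apply: le_trans (eps_split2 C0 l0 e0); rewrite ler_wpM2l// ler_wpM2l// invr_ge0 ltW//.
by apply: le_trans (lerD h1 h2) _; rewrite -mulrDl -mulr2n -[e *+ 2]mulr_natr mulfK.
Qed.

Lemma cpois_antisym (x e s : R) : cpois x e s = - cpois s e x.
Proof. by rewrite /cpois -(opprB x s) sqrrN mulNr. Qed.

(** The conjugate Poisson kernel is antisymmetric in its two points and bounded for e > 0, so
    Fubini's theorem applies before any limit is taken. *)
Lemma Qf_antisym f g (e : R) : rint mu f -> rint mu g -> 0 < e ->
  \int[mu]_x (f x * Qf g e x) = - \int[mu]_x (g x * Qf f e x).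
Proof.
move=> fi gi e0.
have [hr _] := cint_cauchy_prod (cint_realC fi) (cint_realC gi) e0.
have i1 : rint (mu \x mu)%E (fun t : R * R => f t.1 * (g t.2 * cpois t.1 e t.2)).
  apply: rint_eq hr => -[x s] /=.
  by rewrite /cpois /= !addr0 !add0r sqrrN !mul0r !subr0.
have F := @rint_Fubini _ _ _ _ _ mu mu _ i1.
transitivity (\int[mu]_x \int[mu]_y (f x * (g y * cpois x e y))).
  by apply: rInt_eq => x; rewrite QfE -(rIntZl (f x) (rint_cF x gi e0).1).
rewrite [LHS]F -rIntN; last first.
  exact: (@rint_Mr _ _ _ mu _ (Qf f e) g (measurable_Qf fi e0) (fun x => Qf_abs_bound x fi e0) gi).
apply: rInt_eq => s; rewrite QfE -mulrN -rIntN; last by have [] := rint_cF s fi e0.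
rewrite -rIntZl; last by apply: rintN; have [] := rint_cF s fi e0.
by apply: rInt_eq => x; rewrite (cpois_antisym x) mulrCA mulrN.
Qed.

Definition supported (V : zmodType) (f : R -> V) := forall x, ~ I11 R x -> f x = 0.

Lemma I11E (x : R) : I11 R x <-> `|x| < 1.
Proof. by rewrite /I11 /= in_itv/= ltr_norml. Qed.

Lemma kap_I11 (x : R) : I11 R x -> 1 <= 2 * kap x.
Proof.
move=> /I11E x1; rewrite /kap ler_pdivlMr ?mul1r; last by rewrite ltr_pwDl// sqr_ge0.
have : x ^+ 2 <= 1 by rewrite -(real_normK (num_real x)) expr_le1// ltW.
lra.
Qed.

Lemma supported_kap f (M : R) : supported f -> (forall s, `|f s| <= M) ->
  forall s, `|f s| <= (2 * M) * kap s.
Proof.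
move=> fs fM s; have M0 : 0 <= M by exact: le_trans (fM 0).
have [sI|sI] := pselect (I11 R s).
  apply: le_trans (fM s) _; rewrite mulrAC -[leLHS]mul1r ler_wpM2r//.
  by rewrite kap_I11.
by rewrite fs// normr0 mulr_ge0 ?kap_ge0// mulr_ge0.
Qed.

Lemma rint_supported f (M : R) : measurable_fun setT f -> supported f ->
  (forall s, `|f s| <= M) -> rint mu f.
Proof. by move=> mf fs fM; apply: rint_le (rint_kapZ (2 * M)) (supported_kap fs fM). Qed.

Lemma parseval_bounded f g (M N : R) :
  measurable_fun setT f -> supported f -> (forall s, `|f s| <= M) ->
  measurable_fun setT g -> supported g -> (forall s, `|g s| <= N) ->
  rint mu (fun x => f x * hilb g x) /\
  \int[mu]_x (f x * hilb g x) = - \int[mu]_x (g x * hilb f x).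
Proof.
move=> mf fs fM mg gs gN; have fi := rint_supported mf fs fM.
have gi := rint_supported mg gs gN.
have fk := supported_kap fs fM; have gk := supported_kap gs gN.
split; first exact: rint_mul_hilb gi gN mf fk.
have c1 := cvg_int_mul_hilb gi gN mf fk.
have c2 : - (\int[mu]_x (g x * Qf f y x)) @[y --> (0 : R)^'+] --> - \int[mu]_x (g x * hilb f x).
  by apply: cvgN; exact: cvg_int_mul_hilb fi fM mg gk.
apply: (@cvg_unique _ _ _ _ _ _ c1); first exact: Rhausdorff.
apply: cvg_trans c2; apply: near_eq_cvg; near=> y.
have y0 : 0 < y by near: y; exact: nbhs_right_gt.
by rewrite [RHS]Qf_antisym// /= ?opprK.
Unshelve. all: by end_near. Qed.

(** Two rates are imposed: [k <= m k] gives pointwise convergence of the truncations, and the error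
    4^-k gives almost everywhere convergence of their transforms through [ae_hilb_trunc]. *)
Lemma trunc_levels f : rint mu f -> exists m : nat -> R,
  [/\ forall k, 0 <= m k, forall k, k%:R <= m k &
   forall k, \int[mu]_x `|f x - trunc (m k) f x| <= 4^-1 ^+ k].
Proof.
move=> fi.
have H k : exists n : nat, (k <= n)%N /\ \int[mu]_x `|f x - trunc n%:R f x| <= 4^-1 ^+ k.
  have e0 : 0 < (4^-1 : R) ^+ k by rewrite exprn_gt0.
  have /cvgrPdist_le /(_ _ e0) [n _ hn] := cvg_int_trunc fi.
  exists (maxn n k); split; first exact: leq_maxr.
  apply: le_trans (ler_norm _) _.
  by have := hn (maxn n k) (leq_maxl _ _); rewrite /= sub0r normrN.
have /choice[n hn] := H.
exists (fun k => (n k)%:R); split => k //; last by have [] := hn k.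
by rewrite ler_nat; have [] := hn k.
Qed.

Lemma cvg_trunc f (m : nat -> R) x : (forall k, k%:R <= m k) ->
  trunc (m k) f x @[k --> \oo] --> f x.
Proof.
move=> hm; apply: cvg_near_cst; exists (Num.trunc `|f x|).+1 => // k /= hk.
apply: trunc_id; apply: le_trans (hm k).
by apply: le_trans (ltW (truncnS_gt _)) _; rewrite ler_nat.
Qed.

Lemma measurable_I11 : measurable (I11 R).
Proof. exact: measurable_itv. Qed.

Lemma I11_fin : (mu (I11 R) < +oo)%E.
Proof. by rewrite /I11 lebesgue_measure_itv/=; case: ifP => _; rewrite ?ltry// -EFinD ltry. Qed.

(* For [g] in [L log L] this holds because [hilb h] is exponentially
   integrable when [h] is bounded. *)
Definition pairs_bounded g := forall h (M : R), measurable_fun setT h ->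
  supported h -> (forall s, `|h s| <= M) -> rint mu (fun x => g x * hilb h x).

Lemma supported_ind f (A : set R) : supported f ->
  supported (fun x => f x * (\1_A x : R)).
Proof. by move=> fs x xI; rewrite fs// mul0r. Qed.

(** For the truncations g_k the integral of f H(g_k) over A is minus that of g_k H(f 1_A). The
    latter is dominated by g H(f 1_A), integrable because f 1_A is bounded. So the integrals over
    every A converge, and Nikodym's theorem identifies the limit as that of f Hg. *)
Lemma parseval_half f g (M : R) :
  measurable_fun setT f -> supported f -> (forall s, `|f s| <= M) ->
  rint mu g -> supported g -> pairs_bounded g ->
  rint mu (fun x => f x * hilb g x) /\
  \int[mu]_x (f x * hilb g x) = - \int[mu]_x (g x * hilb f x).
Proof.
move=> mf fs fM gi gs gp.
have [m [m0 mk hm]] := trunc_levels gi; have mg := rint_measurable gi.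
pose gk k := trunc (m k) g.
have mgk k : measurable_fun setT (gk k) by exact: measurable_trunc.
have gks k : supported (gk k).
  by move=> x xI; rewrite /gk trunc_id gs// normr0.
have gkM k s : `|gk k s| <= m k by exact: trunc_bound.
pose fA (A : set R) x := f x * (\1_A x : R).
have mfA A : measurable A -> measurable_fun setT (fA A).
  by move=> mA; apply: measurable_funM => //; exact: measurable_indic.
have fAM A s : `|fA A s| <= M.
  have /andP[a0 a1] := @indic01 _ R R A s.
  by rewrite /fA normrM (ger0_norm a0); apply: le_trans (fM s); rewrite ler_piMr.
pose u k x := f x * hilb (gk k) x.
have ui k : rint mu (u k) by have [] := parseval_bounded mf fs fM (mgk k) (gks k) (gkM k).
have uA A : measurable A ->
    \int[mu]_x (u k x * (\1_A x : R)) @[k --> \oo] --> - \int[mu]_x (g x * hilb (fA A) x).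
  move=> mA.
  have E k : \int[mu]_x (u k x * (\1_A x : R)) = - \int[mu]_x (gk k x * hilb (fA A) x).
    have [_ <-] := parseval_bounded (mfA A mA) (supported_ind A fs) (fAM A) (mgk k) (gks k) (gkM k).
    by apply: rInt_eq => x; rewrite /u /fA mulrAC.
  under eq_fun do rewrite E.
  apply: cvgN; have gH := gp _ _ (mfA A mA) (supported_ind A fs) (fAM A).
  have mH := measurable_hilb (rint_supported (mfA A mA) (supported_ind A fs) (fAM A)).
  apply: (@rInt_dct_cvg _ _ _ mu (fun k x => gk k x * hilb (fA A) x) _
    (fun x => `|g x * hilb (fA A) x|)).
  - by move=> k; apply: measurable_funM; [exact: mgk|exact: mH].
  - by apply: measurable_funM; [exact: mg|exact: mH].
  - exact: rint_norm.
  - by move=> k x; rewrite !normrM ler_wpM2r// trunc_le.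
  - apply: aeW => x; apply: cvgM; last exact: cvg_cst.
    exact: cvg_trunc.
have [i1 c1] : rint mu (fun x => f x * hilb g x) /\
    \int[mu]_x u k x @[k --> \oo] --> \int[mu]_x (f x * hilb g x).
  apply: (@nikodym _ _ _ mu u _ (I11 R) measurable_I11 I11_fin ui).
  - by apply: measurable_funM; [exact: mf|exact: measurable_hilb].
  - by move=> k x xI; rewrite /u fs// mul0r.
  - apply: ae_imp (ae_hilb_trunc gi m0 hm) _ => x hx.
    by apply: cvgM => //; exact: cvg_cst.
  - by move=> A mA; apply: cvgP (uA A mA).
split => //.
have c2 := uA setT measurableT.
have fT : fA setT = f by apply/funext => x; rewrite /fA indicT mulr1.
rewrite fT in c2.
have uT k : \int[mu]_x (u k x * (\1_(setT : set R) x : R)) = \int[mu]_x u k x.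
  by apply: rInt_eq => x; rewrite indicT mulr1.
apply: (@cvg_unique _ _ _ _ _ _ c1); first exact: Rhausdorff.
by apply: cvg_trans c2; apply: near_eq_cvg; apply: nearW => k; rewrite uT.
Qed.

End Parseval.

Lemma divided_difference (K : fieldType) (f s z w : K) : s - z != 0 -> s - w != 0 ->
  w - z != 0 -> f / (s - z) / (s - w) = (w - z)^-1 * (f / (s - w) - f / (s - z)).
Proof. by move=> h1 h2 h3; field; rewrite h1 h2 h3. Qed.

Lemma ae_and d (T : measurableType d) (R : realType)
    (nu : {measure set T -> \bar R}) (P Q : T -> Prop) :
  {ae nu, forall x, P x} -> {ae nu, forall x, Q x} -> {ae nu, forall x, P x /\ Q x}.
Proof. by move=> hP hQ; apply: ae_imp2 hP hQ _ => x hx hx'; split. Qed.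

Lemma move_negative (V : zmodType) (a b c : V) : - b = a - c -> a + b = c.
Proof. by move=> h; rewrite -[b]opprK h opprB addrC subrK. Qed.

Lemma product_boundary (R : rcfType) (p hk k hf f hg g : R) :
  hk +i* k = (hf +i* (p * f)) * (hg +i* (p * g)) -> hk = hf * hg - p ^+ 2 * (f * g).
Proof. by move=> -[-> _]; ring. Qed.

(** * Parseval's formula for integrable functions and the product identity *)

Section Product.
Context (R : realType).
Notation mu := (@lebesgue_measure R).
Implicit Types (f g h : R -> R).

(** The scheme of [parseval_half] with the roles exchanged: now [f] is truncated and the indicator
    of A is moved onto [g]. The integral of g H(f_k) over A is minus that of f_k H(g 1_A), dominated
    by the function f H(g 1_A) that the hypothesis declares integrable. *)
Lemma parseval f g : rint mu f -> supported f -> rint mu g -> supported g ->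
  pairs_bounded g ->
  (forall A : set R, measurable A -> rint mu (fun x => f x * hilb (fun s => g s * (\1_A s : R)) x)) ->
  rint mu (fun x => g x * hilb f x) /\
  \int[mu]_x (g x * hilb f x) = - \int[mu]_x (f x * hilb g x).
Proof.
move=> fi fs gi gs gp fg.
have [m [m0 mk hm]] := trunc_levels fi; have mf := rint_measurable fi.
have mg := rint_measurable gi.
pose fk k := trunc (m k) f.
have mfk k : measurable_fun setT (fk k) by exact: measurable_trunc.
have fks k : supported (fk k).
  by move=> x xI; rewrite /fk trunc_id fs// normr0.
have fkM k s : `|fk k s| <= m k by exact: trunc_bound.
pose gA (A : set R) x := g x * (\1_A x : R).
have gAi A : measurable A -> rint mu (gA A) by move=> mA; exact: rint_ind.
have gAp A : measurable A -> pairs_bounded (gA A).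
  move=> mA h M mh hs hM; have hi : rint mu (fun x => g x * hilb h x * (\1_A x : R)).
    exact: (@rint_ind _ _ R mu (fun x => g x * hilb h x) A mA (gp h M mh hs hM)).
  by apply: rint_eq hi => x; rewrite /gA mulrAC.
pose u k x := g x * hilb (fk k) x.
have ui k : rint mu (u k) by exact: gp (mfk k) (fks k) (fkM k).
have uA A : measurable A ->
    \int[mu]_x (u k x * (\1_A x : R)) @[k --> \oo] --> - \int[mu]_x (f x * hilb (gA A) x).
  move=> mA.
  have E k : \int[mu]_x (u k x * (\1_A x : R)) = - \int[mu]_x (fk k x * hilb (gA A) x).
    have [_ ->] := parseval_half (mfk k) (fks k) (fkM k) (gAi A mA) (supported_ind A gs) (gAp A mA).
    by rewrite opprK; apply: rInt_eq => x; rewrite /u /gA mulrAC.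
  under eq_fun do rewrite E.
  apply: cvgN; have mH := measurable_hilb (gAi A mA).
  apply: (@rInt_dct_cvg _ _ _ mu (fun k x => fk k x * hilb (gA A) x) _
    (fun x => `|f x * hilb (gA A) x|)).
  - by move=> k; apply: measurable_funM; [exact: mfk|exact: mH].
  - by apply: measurable_funM; [exact: mf|exact: mH].
  - exact: rint_norm (fg A mA).
  - by move=> k x; rewrite !normrM ler_wpM2r// trunc_le.
  - apply: aeW => x; apply: cvgM; last exact: cvg_cst.
    exact: cvg_trunc.
have [i1 c1] : rint mu (fun x => g x * hilb f x) /\
    \int[mu]_x u k x @[k --> \oo] --> \int[mu]_x (g x * hilb f x).
  apply: (@nikodym _ _ _ mu u _ (I11 R) (@measurable_I11 R) (@I11_fin R) ui).
  - by apply: measurable_funM; [exact: mg|exact: measurable_hilb].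
  - by move=> k x xI; rewrite /u gs// mul0r.
  - apply: ae_imp (ae_hilb_trunc fi m0 hm) _ => x hx.
    by apply: cvgM => //; exact: cvg_cst.
  - by move=> A mA; apply: cvgP (uA A mA).
split => //.
have c2 := uA setT measurableT.
have gT : gA setT = g by apply/funext => x; rewrite /gA indicT mulr1.
rewrite gT in c2.
have uT k : \int[mu]_x (u k x * (\1_(setT : set R) x : R)) = \int[mu]_x u k x.
  by apply: rInt_eq => x; rewrite indicT mulr1.
apply: (@cvg_unique _ _ _ _ _ _ c1); first exact: Rhausdorff.
by apply: cvg_trans c2; apply: near_eq_cvg; apply: nearW => k; rewrite uT.
Qed.

Lemma kernel_eta (p q s : R) : (s%:C - (p +i* q))^-1 = cpois p q s +i* pois p q s.
Proof.
rewrite complex_invE /cpois /pois /=; congr (_ +i* _).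
  by rewrite sub0r sqrrN.
by rewrite sub0r sqrrN mulNr opprK.
Qed.

Lemma cpois_bound (p q s : R) : 0 < q -> `|cpois p q s| <= q^-1 /\ `|pois p q s| <= q^-1.
Proof.
move=> q0; have := @cabs_kernel_le R s (p +i* q) q0; rewrite kernel_eta => h; split.
  by apply: le_trans (cabs_Re _) h.
by apply: le_trans (cabs_Im _) h.
Qed.

Lemma measurable_cpois (p q : R) : measurable_fun setT (cpois p q).
Proof.
apply: measurable_funM; first exact: measurable_funB.
apply: measurable_inv_fun; apply: measurable_funD => //.
by apply: measurable_funX; exact: measurable_funB.
Qed.

Lemma rint_mul_kernel f (p q : R) : rint mu f -> 0 < q ->
  rint mu (fun s => f s * cpois p q s) /\ rint mu (fun s => f s * pois p q s).
Proof.
move=> fi q0; split; apply: (@rint_Mr _ _ _ mu q^-1) => //.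
- exact: measurable_cpois.
- by move=> x; have [] := cpois_bound p x q0.
- exact: measurable_pois.
- by move=> x; have [] := cpois_bound p x q0.
Qed.

Lemma sub_real_neq0 (s : R) (z : R[i]) : 0 < complex.Im z -> s%:C - z != 0.
Proof.
case: z => p q /= q0; rewrite eq_complex /=; apply/nandP; right.
by rewrite sub0r oppr_eq0 lt0r_neq0.
Qed.

(** The resolvent identity under the integral. The complex function f(s) / (s - z) is carried as the
    pair of [f * cpois] and [f * pois], its real and imaginary parts, because [cF] and [hilb] act on
    real functions. *)
Lemma cF_mul_kernel f (p q : R) (w : R[i]) : rint mu f -> 0 < q -> 0 < complex.Im w ->
  w - (p +i* q) != 0 ->
  cF (fun s => f s * cpois p q s) w + 'i * cF (fun s => f s * pois p q s) w =
  (w - (p +i* q))^-1 * (cF f w - cF f (p +i* q)).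
Proof.
move=> fi q0 w0 wz; have [ia ib] := rint_mul_kernel p fi q0.
have ja := cint_cauchy (cint_realC ia) w0; have jb := cint_cauchy (cint_realC ib) w0.
have jf := cint_cauchy (cint_realC fi) w0.
have jz := @cint_cauchy _ _ (p +i* q) (cint_realC fi) q0.
rewrite /cF /cauchy -(cIntZ 'i jb) -(cIntD ja (cintZ 'i jb)).
rewrite -(cIntB jf jz) -(cIntZ _ (cintB jf jz)).
apply: cInt_eq => s.
have h1 : s%:C - (p +i* q) != 0 by exact: sub_real_neq0.
have h2 := sub_real_neq0 s w0.
rewrite -[RHS](divided_difference _ h1 h2 wz) kernel_eta mulrA -mulrDl; congr (_ / _).
by congr (_ +i* _) => /=; ring.
Qed.

Lemma cvg_harmonic_neq (t : R) :
  [/\ forall n, 0 < (n.+1%:R^-1 : R) & n.+1%:R^-1 @[n --> \oo] --> (0 : R)].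
Proof. by split=> [n|]; [rewrite invr_gt0|exact: cvg_harmonic]. Qed.

Lemma ae_cF_boundary f : rint mu f ->
  {ae mu, forall t : R, ccvg (fun n => cF f (t +i* n.+1%:R^-1)) (hilb f t +i* (pi * f t))}.
Proof.
move=> fi; apply: ae_imp2 (ae_cvg_hilb fi) (cvg_ae_Pf fi) _ => t /cvg_at_rightP h1 /cvg_at_rightP h2.
have [y0 yc] := cvg_harmonic_neq 0.
by split; [apply: h1|apply: h2].
Qed.

Lemma ccvg_shift_line (t : R) : ccvg (fun n => t +i* (n.+1%:R^-1 : R)) t%:C.
Proof. by split; [exact: cvg_cst|exact: cvg_harmonic]. Qed.

Lemma boundary_algebra (ha hb h f a b pi_ : R) (F : R[i]) :
  (ha +i* (pi_ * (f * a))) + 'i * (hb +i* (pi_ * (f * b))) =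
    (a +i* b) * ((h +i* (pi_ * f)) - F) ->
  ha = h * a - (complex.Re F * a - complex.Im F * b) /\
  hb = h * b - (complex.Re F * b + complex.Im F * a).
Proof. by case: F => x y /= [e1 e2]; split; lra. Qed.

Lemma ae_hilb_mul_kernel f (p q : R) : rint mu f -> 0 < q ->
  {ae mu, forall t : R,
    hilb (fun s => f s * cpois p q s) t = hilb f t * cpois p q t -
      (Qf f q p * cpois p q t - Pf f q p * pois p q t) /\
    hilb (fun s => f s * pois p q s) t = hilb f t * pois p q t -
      (Qf f q p * pois p q t + Pf f q p * cpois p q t)}.
Proof.
move=> fi q0; have [ia ib] := rint_mul_kernel p fi q0.
apply: ae_imp2 (ae_cF_boundary fi) _ _.
  exact: ae_and (ae_cF_boundary ia) (ae_cF_boundary ib).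
move=> t hf [ha hb]; apply: (@boundary_algebra _ _ (hilb f t) (f t) _ _ pi (cF f (p +i* q))).
have tz : t%:C - (p +i* q) != 0 by exact: sub_real_neq0.
have l1 := ccvgD ha (ccvgM (ccvg_cst 'i) hb).
have l2 : ccvg (fun n => (t +i* n.+1%:R^-1 - (p +i* q))^-1 *
    (cF f (t +i* n.+1%:R^-1) - cF f (p +i* q)))
    ((t%:C - (p +i* q))^-1 * (hilb f t +i* (pi * f t) - cF f (p +i* q))).
  apply: ccvgM; last exact: ccvgD hf (ccvg_cst _).
  apply: ccvgV => //; exact: ccvgD (ccvg_shift_line t) (ccvg_cst _).
rewrite -kernel_eta.
(* The resolvent identity needs the approaching point to differ from z, which holds once its height
   is below q. *)
have [N hN] : exists N : nat, forall n, (N <= n)%N -> (n.+1%:R^-1 : R) < q.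
  have /cvgrPdist_lt /(_ q q0) [N _ hN] := @cvg_harmonic R.
  exists N => n Nn; have := hN n Nn; rewrite /= sub0r normrN.
  exact: le_lt_trans (ler_norm _).
have E n : (N <= n)%N -> cF (fun s => f s * cpois p q s) (t +i* n.+1%:R^-1) +
   'i * cF (fun s => f s * pois p q s) (t +i* n.+1%:R^-1) =
   (t +i* n.+1%:R^-1 - (p +i* q))^-1 * (cF f (t +i* n.+1%:R^-1) - cF f (p +i* q)).
  move=> Nn; apply: cF_mul_kernel => //=.
  rewrite eq_complex /=; apply/nandP; right; rewrite subr_eq0.
  by rewrite lt_eqF// hN.
apply: ccvg_unique l1 _; case: l2 => l2r l2i; split.
  apply: cvg_trans l2r; apply: near_eq_cvg; exists N => // n Nn; exact: (congr1 (@complex.Re R) (esym (E n Nn))).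
apply: cvg_trans l2i; apply: near_eq_cvg; exists N => // n Nn; exact: (congr1 (@complex.Im R) (esym (E n Nn))).
Qed.

(** Parseval's formula for f / (x - z) and g reads: the integral of g (Hf - F(z)) / (x - z) is minus
    that of f Hg / (x - z). Moving the term with F(z) to the other side gives F(z) G(z). The
    computation is done for the two real kernels separately. *)
Lemma cF_hilb_product f g (p q : R) : rint mu f -> supported f ->
  rint mu g -> supported g -> pairs_bounded g ->
  (forall A : set R, measurable A -> rint mu (fun x => f x * hilb (fun s => g s * (\1_A s : R)) x)) ->
  0 < q ->
  cF (fun x => g x * hilb f x + f x * hilb g x) (p +i* q) =
  cF f (p +i* q) * cF g (p +i* q).
Proof.
move=> fi fs gi gs gp fg q0.
have [gfi _] := parseval fi fs gi gs gp fg.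
have fgi : rint mu (fun x => f x * hilb g x).
  have := fg setT measurableT.
  by have -> : (fun s => g s * (\1_(setT : set R) s : R)) = g
    by apply/funext => s; rewrite indicT mulr1.
have ki := rintD gfi fgi.
have mfg A : measurable A -> measurable_fun setT (hilb (fun s => g s * (\1_A s : R))).
  by move=> mA; apply: measurable_hilb; exact: rint_ind.
(* A bounded factor [c] on [f] leaves the products with H(g 1_A) integrable, so Parseval's formula
   remains available for [f * c]. *)
have step (c : R -> R) : measurable_fun setT c -> (forall s, `|c s| <= q^-1) ->
    rint mu (fun x => g x * hilb (fun s => f s * c s) x) /\
    \int[mu]_x (g x * hilb (fun s => f s * c s) x) = - \int[mu]_x (f x * hilb g x * c x).
  move=> mc cq.
  have [|||h1 h2] := @parseval (fun s => f s * c s) g _ _ gi gs gp.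
  - exact: (@rint_Mr _ _ _ mu q^-1).
  - by move=> x xI; rewrite fs// mul0r.
  - move=> A mA; apply: rint_eq (@rint_Mr _ _ _ mu q^-1 c _ mc cq (fg A mA)) => x.
    by rewrite mulrAC.
  split => //; rewrite h2; congr (- _).
  by apply: rInt_eq => x; rewrite mulrAC.
have [ia Ea] := step _ (measurable_cpois p q) (fun s => (cpois_bound p s q0).1).
have [ib Eb] := step _ (measurable_pois p q0) (fun s => (cpois_bound p s q0).2).
have [gfa gfb] := rint_mul_kernel p gfi q0; have [fga fgb] := rint_mul_kernel p fgi q0.
have [ga gb] := rint_mul_kernel p gi q0.
have aeH := @ae_hilb_mul_kernel f p q fi q0.
have Ia : \int[mu]_x (g x * hilb (fun s => f s * cpois p q s) x) =
    \int[mu]_x (g x * hilb f x * cpois p q x - (Qf f q p * (g x * cpois p q x) - Pf f q p * (g x * pois p q x))).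
  apply: rInt_ae; first exact: rint_measurable ia.
    exact: rint_measurable (rintB gfa (rintB (rintZl (Qf f q p) ga) (rintZl (Pf f q p) gb))).
  by apply: ae_imp aeH _ => x [-> _]; ring.
have Ib : \int[mu]_x (g x * hilb (fun s => f s * pois p q s) x) =
    \int[mu]_x (g x * hilb f x * pois p q x - (Qf f q p * (g x * pois p q x) + Pf f q p * (g x * cpois p q x))).
  apply: rInt_ae; first exact: rint_measurable ib.
    exact: rint_measurable (rintB gfb (rintD (rintZl (Qf f q p) gb) (rintZl (Pf f q p) ga))).
  by apply: ae_imp aeH _ => x [_ ->]; ring.
rewrite Ea (rIntB gfa (rintB (rintZl (Qf f q p) ga) (rintZl (Pf f q p) gb)))
  (rIntB (rintZl (Qf f q p) ga) (rintZl (Pf f q p) gb)) (rIntZl _ ga) (rIntZl _ gb) in Ia.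
rewrite Eb (rIntB gfb (rintD (rintZl (Qf f q p) gb) (rintZl (Pf f q p) ga)))
  (rIntD (rintZl (Qf f q p) gb) (rintZl (Pf f q p) ga)) (rIntZl _ ga) (rIntZl _ gb) in Ib.
rewrite -(QfE g q p) -(PfE g q p) in Ia; rewrite -(QfE g q p) -(PfE g q p) in Ib.
have Qk : Qf (fun x => g x * hilb f x + f x * hilb g x) q p = Qf f q p * Qf g q p - Pf f q p * Pf g q p.
  rewrite QfE; transitivity (\int[mu]_x (g x * hilb f x * cpois p q x + f x * hilb g x * cpois p q x)).
    by apply: rInt_eq => x; rewrite mulrDl.
  by rewrite (rIntD gfa fga); exact: move_negative Ia.
have Pk : Pf (fun x => g x * hilb f x + f x * hilb g x) q p = Qf f q p * Pf g q p + Pf f q p * Qf g q p.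
  rewrite PfE; transitivity (\int[mu]_x (g x * hilb f x * pois p q x + f x * hilb g x * pois p q x)).
    by apply: rInt_eq => x; rewrite mulrDl.
  by rewrite (rIntD gfb fgb); exact: move_negative Ib.
by rewrite !cF_eta Qk Pk.
Qed.

Lemma hilb_product f g : rint mu f -> supported f ->
  rint mu g -> supported g -> pairs_bounded g ->
  (forall A : set R, measurable A -> rint mu (fun x => f x * hilb (fun s => g s * (\1_A s : R)) x)) ->
  {ae mu, forall t : R, hilb (fun x => g x * hilb f x + f x * hilb g x) t =
    hilb f t * hilb g t - pi ^+ 2 * (f t * g t)}.
Proof.
move=> fi fs gi gs gp fg; have [gfi _] := parseval fi fs gi gs gp fg.
have fgi : rint mu (fun x => f x * hilb g x).
  have := fg setT measurableT.
  by have -> : (fun s => g s * (\1_(setT : set R) s : R)) = g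
    by apply/funext => s; rewrite indicT mulr1.
apply: ae_imp2 (ae_cF_boundary (rintD gfi fgi)) _ _.
  exact: ae_and (ae_cF_boundary fi) (ae_cF_boundary gi).
move=> t hk [hf hg].
have l := ccvgM hf hg.
have E n : cF f (t +i* n.+1%:R^-1) * cF g (t +i* n.+1%:R^-1) =
    cF (fun x => g x * hilb f x + f x * hilb g x) (t +i* n.+1%:R^-1).
  by rewrite cF_hilb_product// invr_gt0.
exact: product_boundary (ccvg_unique hk (ccvg_eq E l)).
Qed.

End Product.

(** Presents multiplication by [c] in the shape f + a g accepted by [ae_hilb_lin]. *)
Lemma scale_split (K : fieldType) (c a : K) : c != 0 -> a = c^-1 * a + (c - 1) * (c^-1 * a).
Proof. by move=> c0; field. Qed.

(** * The space L log L *)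

Section Zygmund.
Context (R : realType).
Notation mu := (@lebesgue_measure R).
Implicit Types (f g h G : R -> R).

(* The index is shifted: [level G k] is the set where [G > k + 1]. *)
Definition level G (k : nat) : set R := [set x | k.+1%:R < G x].

Definition level_measure G k : R := fine (mu (level G k)).

(* [L log L] in terms of level sets. *)
Definition zygmund G := exists L : R, forall n,
  \sum_(k < n) level_measure G k * ln (2 * expR 1 / level_measure G k) <= L.

Lemma measurable_level G k : measurable_fun setT G -> measurable (level G k).
Proof.
move=> mG; rewrite -[X in measurable X]setTI.
have -> : level G k = G @^-1` `]k.+1%:R, +oo[%classic.
  by apply/seteqP; split => x /=; rewrite /level/= in_itv/= andbT.
exact: mG.
Qed.

Lemma level_I11 G k : supported G -> level G k `<=` I11 R.
Proof.
move=> Gs x; rewrite /level /= => hx; apply: contrapT => /Gs Gx0.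
by move: hx; rewrite Gx0 ltrn0.
Qed.

Lemma mu_I11 : mu (I11 R) = 2%:E.
Proof.
rewrite /I11 lebesgue_measure_itv/= lte_fin ifT; last by rewrite -subr_gt0 opprK addr_gt0.
by rewrite -EFinD opprK.
Qed.

Lemma level_measureE G k : measurable_fun setT G -> supported G ->
  mu (level G k) = (level_measure G k)%:E /\ 0 <= level_measure G k <= 2.
Proof.
move=> mG Gs; have mE := measurable_level k mG.
have le2 : (mu (level G k) <= 2%:E)%E.
  by rewrite -mu_I11; apply: le_measure; rewrite ?inE//; [exact: measurable_I11|exact: level_I11].
have E : mu (level G k) = (level_measure G k)%:E.
  by rewrite /level_measure fineK// ge0_fin_numE//; apply: le_lt_trans le2 _; rewrite ltry.
by split => //; rewrite -!lee_fin -E measure_ge0.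
Qed.

(** Young's inequality for the exponential, as the tangent line bound 1 + u <= exp u at u = x - ln
    l. *)
Lemma young_ln (l x : R) : 0 < l -> x <= ln l + l^-1 * expR x.
Proof.
move=> l0; have := expR_ge1Dx (x - ln l); rewrite expRD expRN lnK ?posrE// [expR x / l]mulrC.
by move: (l^-1 * _) => w; lra.
Qed.

Lemma ln_ge1 (a : R) : 0 < a -> a <= 2 -> 1 <= ln (2 * expR 1 / a).
Proof.
move=> a0 a2; rewrite -[X in X <= _](expRK 1) ler_ln ?posrE ?expR_gt0//.
  by rewrite ler_pdivlMr// mulrC ler_wpM2r// expR_ge0.
by rewrite divr_gt0// mulr_gt0// expR_gt0.
Qed.

Lemma young_constant (a C l : R) : 0 <= a -> 0 <= C -> 1 <= l ->
  a * l + (2 * expR 1 / a)^-1 * C <= (1 + C) * (a * l).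
Proof.
move=> a0 C0 l1; have e1 : 1 <= expR 1 :> R by rewrite -[X in X <= _]expR0 ler_expR.
have E : (2 * expR 1 / a)^-1 <= a.
  rewrite invf_div ler_pdivrMr; last by nra.
  by nra.
have h : (2 * expR 1 / a)^-1 * C <= a * C by rewrite ler_wpM2r.
apply: le_trans (lerD (lexx _) h) _; rewrite mulrDl mul1r lerD2l [C * _]mulrC.
by rewrite ler_wpM2r// ler_peMr.
Qed.

(* [young_ln] on the level set of measure [a], with [l = 2 e / a]. *)
Lemma int_exp_level G h k : measurable_fun setT G -> supported G ->
  measurable_fun setT h -> (forall x, 0 <= h x) ->
  rint mu (fun x => expR (h x) * kap x) ->
  rint mu (fun x => h x * (\1_(level G k) x : R)) /\
  \int[mu]_x (h x * (\1_(level G k) x : R)) <=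
    (1 + 2 * \int[mu]_x (expR (h x) * kap x)) *
    (level_measure G k * ln (2 * expR 1 / level_measure G k)).
Proof.
move=> mG Gs mh h0 ih; set E := level G k; set a := level_measure G k.
have [muE /andP[a0 a2]] := level_measureE k mG Gs.
rewrite -/E -/a in muE a0 a2.
have mE : measurable E by exact: measurable_level.
have ind0 x : 0 <= (\1_E x : R) by [].
have key (l : R) : 0 < l -> forall x,
    h x * (\1_E x : R) <= ln l * (\1_E x : R) + l^-1 * (2 * (expR (h x) * kap x)).
  move=> l0 x; have li : 0 <= l^-1 by rewrite invr_ge0 ltW.
  have ek : 0 <= 2 * (expR (h x) * kap x).
    by rewrite mulr_ge0// mulr_ge0 ?expR_ge0 ?kap_ge0.
  have [xE|xE] := pselect (E x); last first.
    by rewrite (indic_notin R xE) !mulr0 add0r mulr_ge0.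
  rewrite (indic_in R xE) !mulr1; apply: le_trans (young_ln (h x) l0) _.
  rewrite lerD2l ler_wpM2l// mulrCA ler_peMr ?expR_ge0//.
  by apply: kap_I11; exact: level_I11 xE.
have iE : rint mu (fun x => (\1_E x : R)).
  have Efin : (mu E < +oo)%E by rewrite muE ltry.
  exact: (@rint_indD _ _ R mu E mE Efin).
have inte : \int[mu]_x (\1_E x : R) = a.
  by rewrite /Rintegral integral_indic// setIT; exact: (congr1 fine muE).
have mhE : measurable_fun setT (fun x => h x * (\1_E x : R)).
  by apply: measurable_funM => //; exact: measurable_indic.
have bnd (l : R) : 0 < l -> rint mu (fun x => `|ln l| * (\1_E x : R) + l^-1 * (2 * (expR (h x) * kap x))).
  by move=> l0; apply: rintD; [exact: rintZl|apply: rintZl; exact: rintZl].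
have hi : rint mu (fun x => h x * (\1_E x : R)).
  apply: (@rint_le _ _ _ mu _ _ mhE (bnd 1 ltr01)) => x; rewrite ger0_norm ?mulr_ge0//.
  apply: le_trans (key 1 ltr01 x) _; rewrite lerD2r ler_wpM2r//; exact: ler_norm.
(* For a null level set the choice l = 2 e / a makes no sense, but both sides of the estimate are
   0. *)
split => //; have [a00|apos] := eqVneq a 0.
  rewrite a00 mul0r mulr0.
  rewrite (@rInt_ae _ _ _ mu _ (fun=> 0)) ?/Rintegral ?integral0//.
  exists E; split => //; first exact: etrans muE (congr1 EFin a00).
  move=> x /= hx; apply: contrapT => xE; apply: hx.
  by rewrite (indic_notin R xE) mulr0.
have ap : 0 < a by rewrite lt_def apos.
have l0 : 0 < 2 * expR 1 / a by rewrite divr_gt0// mulr_gt0// expR_gt0.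
apply: (@le_trans _ _ (\int[mu]_x (ln (2 * expR 1 / a) * (\1_E x : R) +
   (2 * expR 1 / a)^-1 * (2 * (expR (h x) * kap x))))).
  apply: rInt_le => //; last exact: key.
  by apply: rintD; [exact: rintZl|apply: rintZl; exact: rintZl].
rewrite (rIntD (rintZl _ iE) (rintZl _ (rintZl 2 ih))) (rIntZl _ iE)
  (rIntZl _ (rintZl 2 ih)) (rIntZl 2 ih) inte [ln _ * a]mulrC.
apply: young_constant => //; last exact: ln_ge1.
by rewrite mulr_ge0//; apply: rInt_ge0 => x; rewrite mulr_ge0 ?expR_ge0 ?kap_ge0.
Qed.

(** Layer cake with unit steps: [G x] exceeds the number of levels it passes by at most 1, up to the
    cut at n + 1. *)
Lemma min_levels G x n : Num.min (G x) n.+1%:R <= 1 + \sum_(k < n) (\1_(level G k) x : R).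
Proof.
elim: n => [|n IH]; first by rewrite big_ord0 addr0 ge_min lexx orbT.
rewrite big_ord_recr /=; have [xE|xE] := pselect (level G n x).
  rewrite (indic_in R xE) addrA; apply: (@le_trans _ _ (Num.min (G x) n.+1%:R + 1)); last by rewrite lerD2r.
  rewrite [Num.min (G x) n.+1%:R]min_r; last exact: ltW.
  by rewrite natr1 ge_min lexx orbT.
rewrite (indic_notin R xE) addr0; apply: le_trans IH.
move: xE; rewrite /level /= => /negP; rewrite -leNgt => h.
by rewrite !min_l// (le_trans h)// ler_nat.
Qed.

(** By [min_levels] the truncated [G] is at most 1 plus a sum of level indicators. The pairing of
    [h] with the k-th indicator is a constant times the k-th term of the series in [zygmund], so the
    bound is uniform and Fatou's lemma applies. *)
Lemma zygmund_rint G h : measurable_fun setT G -> supported G -> (forall x, 0 <= G x) ->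
  zygmund G -> measurable_fun setT h -> (forall x, 0 <= h x) ->
  rint mu (fun x => expR (h x) * kap x) -> rint mu (fun x => G x * h x).
Proof.
move=> mG Gs G0 [L hL] mh h0 ih.
set C := 1 + 2 * \int[mu]_x (expR (h x) * kap x).
have C0 : 0 <= C.
  rewrite addr_ge0// mulr_ge0//; apply: rInt_ge0 => x.
  by rewrite mulr_ge0 ?expR_ge0 ?kap_ge0.
have lev k := int_exp_level k mG Gs mh h0 ih.
have iI : rint mu (fun x => h x * (\1_(I11 R) x : R)).
  apply: (@rint_le _ _ _ mu _ (fun x => 2 * (expR (h x) * kap x))).
  - by apply: measurable_funM => //; apply: measurable_indic; exact: measurable_I11.
  - exact: rintZl.
  move=> x; rewrite ger0_norm ?mulr_ge0//.
  have [xE|xE] := pselect (I11 R x); last first.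
    by rewrite (indic_notin R xE) mulr0 mulr_ge0// mulr_ge0 ?expR_ge0 ?kap_ge0.
  rewrite (indic_in R xE) mulr1 mulrCA; apply: (@le_trans _ _ (expR (h x))).
    by apply: le_trans (expR_ge1Dx _); rewrite lerDr.
  by rewrite ler_peMr ?expR_ge0// kap_I11.
pose u n x := Num.min (G x) n.+1%:R * h x.
have S n := @rint_sum _ _ _ mu (fun k x => h x * (\1_(level G k) x : R)) n (fun k => (lev k).1).
have uE n x : 0 <= u n x <= h x * (\1_(I11 R) x : R) + \sum_(k < n) h x * (\1_(level G k) x : R).
  rewrite mulr_ge0 ?le_min ?G0 ?ler0n//=.
  have [xE|xE] := pselect (I11 R x); last first.
    rewrite /u Gs// min_l ?mul0r// addr_ge0 ?mulr_ge0// sumr_ge0// => k _.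
    by rewrite mulr_ge0.
  by rewrite (indic_in R xE) -mulr_sumr -mulrDr /u mulrC ler_wpM2l// min_levels.
have mu_ n : measurable_fun setT (u n).
  by apply: measurable_funM => //; apply: measurable_minr.
have ui n : rint mu (u n).
  apply: (@rint_le _ _ _ mu (u n) _ (mu_ n) (rintD iI (S n).1)) => x.
  by have /andP[p q] := uE n x; rewrite ger0_norm.
have [] // : rint mu (fun x => G x * h x) /\ \int[mu]_x `|G x * h x| <=
    \int[mu]_x (h x * (\1_(I11 R) x : R)) + C * L.
apply: (@rInt_fatou _ _ _ mu u) => //.
- by apply: measurable_funM.
- by move=> n x; have /andP[] := uE n x.
- apply: aeW => x; apply: cvgM; last exact: cvg_cst.
  apply: cvg_near_cst; exists (Num.trunc (G x)).+1 => // k /= hk.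
  rewrite min_l//; apply: le_trans (ltW (truncnS_gt _)) _.
  by rewrite ler_nat (leq_trans hk).
move=> n; apply: (@le_trans _ _ (\int[mu]_x (h x * (\1_(I11 R) x : R) +
    \sum_(k < n) h x * (\1_(level G k) x : R)))).
  apply: rInt_le => //; first exact: rintD iI (S n).1.
  by move=> x; have /andP[] := uE n x.
rewrite (rIntD iI (S n).1) (S n).2 lerD2l.
apply: (@le_trans _ _ (\sum_(k < n) C * (level_measure G k * ln (2 * expR 1 / level_measure G k)))).
  by apply: ler_sum => k _; exact: (lev k).2.
by rewrite -mulr_sumr ler_wpM2l.
Qed.

Lemma rint_expR_hilb f : rint mu f -> (forall s, `|f s| <= 4^-1) ->
  rint mu (fun x => expR `|hilb f x| * kap x).
Proof.
move=> fi f4; have [y0 yc] := cvg_harmonic_neq (0 : R).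
have [] // : rint mu (fun x => expR `|hilb f x| * kap x) /\
    \int[mu]_x `|expR `|hilb f x| * kap x| <= 4 * pi * expR (2 * \int[mu]_s `|f s|).
apply: (@rInt_fatou _ _ _ mu (fun n x => expR `|Qf f n.+1%:R^-1 x| * kap x)).
- by move=> n; have [] := expR_Qf fi (y0 n) f4.
- apply: measurable_funM; last exact: rint_measurable (rint_kap R).
  apply: (measurableT_comp (@measurable_expR R)).
  by apply: (measurableT_comp (@normr_measurable R setT)); exact: measurable_hilb.
- by move=> n x; rewrite mulr_ge0 ?expR_ge0 ?kap_ge0.
- apply: ae_imp (ae_cvg_hilb fi) _ => t /cvg_at_rightP h.
  apply: cvgM; last exact: cvg_cst.
  have hn : `|Qf f n.+1%:R^-1 t| @[n --> \oo] --> `|hilb f t| by apply: cvg_norm; apply: h.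
  by apply: (@cvg_comp _ _ _ _ expR _ _ _ hn); exact: continuous_expR.
- by move=> n; have [] := expR_Qf fi (y0 n) f4.
Qed.

Lemma zygmund_pairs g G : measurable_fun setT g -> measurable_fun setT G ->
  supported G -> (forall x, `|g x| <= G x) -> zygmund G -> pairs_bounded g.
Proof.
move=> mg mG Gs gG Gz h M mh hs hM.
have hi := rint_supported mh hs hM.
have M0 : 0 <= M by exact: le_trans (hM 0).
(* The exponential estimate asks for functions bounded by 1/4, so [h] is divided by K; the added 1
   keeps K positive when M = 0. *)
pose K := 4 * (M + 1); have K0 : 0 < K by rewrite mulr_gt0// ltr_wpDl.
pose h0 s := K^-1 * h s.
have h0i : rint mu h0 by exact: rintZl.
have h04 s : `|h0 s| <= 4^-1.
  rewrite normrM gtr0_norm ?invr_gt0// mulrC ler_pdivrMr// mulrA mulVf// mul1r.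
  by apply: le_trans (hM s) _; rewrite lerDl.
have E : {ae mu, forall x : R, hilb h x = K * hilb h0 x}.
  have := @ae_hilb_lin R h0 h0 h (K - 1) h0i h0i _.
  move=> /(_ _)/ae_imp; apply => [s|x ->]; last by ring.
  exact: scale_split (lt0r_neq0 K0).
have mH := measurable_hilb h0i.
have i1 : rint mu (fun x => G x * `|hilb h0 x|).
  apply: zygmund_rint => //.
  - by move=> x; apply: le_trans (gG x).
  - exact: measurableT_comp.
  - exact: rint_expR_hilb.
apply: (@rint_ae _ _ _ mu (fun x => K * (g x * hilb h0 x))).
- by apply: measurable_funM; [exact: mg|exact: measurable_hilb].
- apply: rintZl; apply: rint_le i1 _; first by apply: measurable_funM; [exact: mg|exact: mH].
  by move=> x; rewrite normrM ler_wpM2r.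
- by apply: ae_imp E _ => x ->; ring.
Qed.

(** The pairing with the constant 1, whose exponential is integrable against [kap]. *)
Lemma zygmund_integrable G : measurable_fun setT G -> supported G ->
  (forall x, 0 <= G x) -> zygmund G -> rint mu G.
Proof.
move=> mG Gs G0 Gz.
have i1 : rint mu (fun x => G x * 1).
  apply: (@zygmund_rint G (fun=> 1)) => //; exact: rint_kapZ.
by apply: rint_eq i1 => x; rewrite mulr1.
Qed.

End Zygmund.

(** * Truncated principal values *)

Section TruncatedPV.
Context (R : realType).
Notation mu := (@lebesgue_measure R).
Implicit Types (f h : R -> R).

Definition reflect_at (c x : R) : R := c - x.

Lemma lebesgue_measure_reflect (c : R) (A : set R) : measurable A ->
  pushforward mu (reflect_at c : _ -> measurableTypeR R) A = mu A.
Proof.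
move=> mA.
have mphi : measurable_fun setT (reflect_at c : measurableTypeR R -> measurableTypeR R).
  exact: measurable_funB.
apply/esym/lebesgue_measure_unique => //= _ [[a b]] _ <-.
rewrite /pushforward.
have -> : [set` `]a, b]] = `]a, b]%classic by [].
have -> : reflect_at c @^-1` `]a, b]%classic = `[c - b, c - a[%classic.
  by apply/seteqP; split => x /=; rewrite /reflect_at !in_itv/= => /andP[? ?]; apply/andP; split; lra.
rewrite !lebesgue_measure_itv/= !lte_fin ltrD2l ltrN2.
by case: ifP => // _; rewrite -!EFinD; congr EFin; ring.
Qed.

Lemma rInt_odd h (c : R) : rint mu h -> (forall x, h (c - x) = - h x) ->
  \int[mu]_x h x = 0.
Proof.
move=> hi ho.
have mphi : measurable_fun setT (reflect_at c : measurableTypeR R -> measurableTypeR R).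
  exact: measurable_funB.
suff E : \int[mu]_x h x = \int[mu]_x h (c - x).
  have := E; rewrite (rInt_eq mu ho) rIntN// => /eqP.
  by rewrite -addr_eq0 -mulr2n mulrn_eq0 => /eqP.
congr fine.
transitivity (\int[pushforward mu (reflect_at c : _ -> measurableTypeR R)]_x (h x)%:E)%E.
  by apply: eq_measure_integral => A mA _; exact/esym/lebesgue_measure_reflect.
rewrite integral_pushforward//.
- exact: measurable_int hi.
- rewrite preimage_setT; apply/integrableP; split.
    by apply/measurable_EFinP; apply: measurableT_comp => //; exact: rint_measurable hi.
  move: hi => /integrableP[_]; apply: le_lt_trans.
  rewrite le_eqVlt; apply/orP; left; apply/eqP; apply: eq_integral => x _ /=.
  by rewrite ho normrN.
Qed.

Definition pvker (t e x : R) : R := if e < `|x - t| then (x - t)^-1 else 0.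

Lemma measurable_pvker (t e : R) : measurable_fun setT (pvker t e).
Proof.
apply: measurable_fun_ifT => //.
- apply: measurable_fun_ltr => //; apply: measurableT_comp => //; exact: measurable_funB.
- apply: measurable_inv_fun; exact: measurable_funB.
Qed.

Lemma pvker_bound (t e x : R) : 0 < e -> `|pvker t e x| <= e^-1.
Proof.
move=> e0; rewrite /pvker; case: ifPn => h; last by rewrite normr0 invr_ge0 ltW.
by rewrite normfV lef_pV2 ?posrE ?ltW// (lt_trans e0).
Qed.

(** Put u = x - t. Where the truncated kernel vanishes, |u| <= e bounds |u| / (u^2 + e^2) by the
    Poisson kernel; elsewhere the difference is e / u times the Poisson kernel, and |e / u| < 1. *)
Lemma pvker_sub_cpois (t e x : R) : 0 < e -> `|pvker t e x - cpois t e x| <= pois t e x.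
Proof.
move=> e0; rewrite /pvker /cpois /pois; set u := x - t.
have p : 0 < u ^+ 2 + e ^+ 2 by rewrite ltr_wpDl ?sqr_ge0// exprn_gt0.
case: ifPn => [h|]; last first.
  rewrite -leNgt => h; rewrite sub0r normrN normrM normfV (gtr0_norm p).
  by rewrite ler_wpM2r// invr_ge0 ltW.
have u0 : 0 < `|u| by exact: lt_trans h.
have un : u != 0 by rewrite -normr_gt0.
have -> : u^-1 - u / (u ^+ 2 + e ^+ 2) = e / u * (e / (u ^+ 2 + e ^+ 2)).
  by field; rewrite un andbT gt_eqF.
have d0 : 0 <= e / (u ^+ 2 + e ^+ 2) by apply: divr_ge0; exact: ltW.
rewrite normrM (ger0_norm d0) ler_piMl//.
by rewrite normrM normfV (gtr0_norm e0) ler_pdivrMr// mul1r ltW.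
Qed.

Lemma pv_sub_odd (t e x : R) :
  pvker t e (2 * t - x) - cpois t e (2 * t - x) = - (pvker t e x - cpois t e x).
Proof.
have E : 2 * t - x - t = - (x - t) by ring.
rewrite /pvker /cpois E normrN sqrrN mulNr opprK.
by case: ifP => _; rewrite ?invrN; ring.
Qed.

(* The difference of the two kernels is odd about [t] and dominated by the Poisson
   kernel: at a Lebesgue point its integral against [f] vanishes in the limit. *)
Lemma cvg_pv_sub f t : rint mu f -> lebesgue_pt f t ->
  \int[mu]_x (f x * pvker t e x) - Qf f e t @[e --> (0 : R)^'+] --> (0 : R).
Proof.
move=> fi ft; have mf := rint_measurable fi.
have h := cvg_dev_pois (rint_kap_of_rint fi) ft.
apply/cvgrPdist_le => eta eta0; move/cvgrPdist_le : h => /(_ eta eta0) h.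
near=> e; have e0 : 0 < e by near: e; exact: nbhs_right_gt.
have h2 : \int[mu]_x (`|f x - f t| * pois t e x) <= eta.
  apply: le_trans (ler_norm _) _; rewrite -normrN -[- _]sub0r.
  by near: e; exact: h.
rewrite sub0r normrN QfE.
have i1 : rint mu (fun x => f x * pvker t e x).
  apply: (@rint_Mr _ _ _ mu e^-1) => //; first exact: measurable_pvker.
  by move=> x; exact: pvker_bound.
have [i2 _] := rint_cF t fi e0.
have mD : measurable_fun setT (fun x => pvker t e x - cpois t e x).
  by apply: measurable_funB; [exact: measurable_pvker|exact: measurable_cpois].
have iD : rint mu (fun x => pvker t e x - cpois t e x).
  apply: (@rint_le _ _ _ mu _ (pois t e) mD (rint_pois t e0)) => x.
  exact: pvker_sub_cpois.
have odd0 := rInt_odd iD (pv_sub_odd t e).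
have idev : rint mu (fun x => `|f x - f t| * pois t e x).
  have := rint_mul_pois t (rint_kap_of_rint fi) e0 => /rintB /(_ (rintZl (f t) (rint_pois t e0))).
  move=> /rint_norm; apply: rint_eq => x.
  by rewrite -mulrBl normrM [`|pois _ _ _|]gtr0_norm// pois_gt0.
rewrite -(rIntB i1 i2).
have -> : \int[mu]_x (f x * pvker t e x - f x * cpois t e x) =
    \int[mu]_x ((f x - f t) * (pvker t e x - cpois t e x)).
  transitivity (\int[mu]_x (f x * pvker t e x - f x * cpois t e x) -
     f t * \int[mu]_x (pvker t e x - cpois t e x)).
    by rewrite odd0 mulr0 subr0.
  rewrite -(rIntZl _ iD) -(rIntB (rintB i1 i2) (rintZl (f t) iD)).
  by apply: rInt_eq => x; ring.
apply: le_trans h2; apply: rInt_normle => //.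
  by apply: measurable_funM => //; exact: measurable_funB.
by move=> x; rewrite normrM ler_wpM2l// pvker_sub_cpois.
Unshelve. all: by end_near. Qed.

Lemma ae_cvg_pv f : rint mu f ->
  {ae mu, forall t : R, \int[mu]_x (f x * pvker t e x) @[e --> (0 : R)^'+] --> hilb f t}.
Proof.
move=> fi; apply: ae_imp2 (ae_cvg_hilb fi) (ae_lebesgue_pt (rint_kap_of_rint fi)) _ => t h1 h2.
rewrite -[X in _ --> X]add0r.
apply: cvg_trans (cvgD (cvg_pv_sub fi h2) h1); apply: near_eq_cvg; apply: nearW => e.
by rewrite /= subrK.
Qed.

End TruncatedPV.

(** * From Borel to Lebesgue measurable functions *)

Section Transfer.
Context (R : realType).
Notation mu := (@lebesgue_measure R).
Notation I11 := (I11 R).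
Implicit Types (f g h : R -> R).

Lemma measurable_leb (A : set R) :
  @measurable _ (measurableTypeR R) A -> @measurable _ (lebesgueTypeR R) A.
Proof. exact: sub_caratheodory. Qed.

Lemma ae_leb (P : R -> Prop) : {ae mu, forall x, P x} -> {ae leb R, forall x, P x}.
Proof. by move=> [A [mA A0 PA]]; exists A; split => //; exact: measurable_leb. Qed.

Lemma measurable_leb_fun d (T : measurableType d) (D : set R) (h : R -> T) :
  @measurable _ (measurableTypeR R) D ->
  @measurable_fun _ _ (measurableTypeR R) T setT h ->
  @measurable_fun _ _ (lebesgueTypeR R) T D h.
Proof.
move=> mD mh _ B mB; apply: measurable_leb; apply: measurableI => //.
by rewrite -[X in measurable X]setTI; exact: mh.
Qed.

(** Borel Lebesgue measure is the image of its completion under the identity map, which is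
    measurable from the larger sigma-algebra to the smaller one. *)
Lemma ge0_integral_leb (D : set R) (f : R -> \bar R) :
  @measurable _ (measurableTypeR R) D ->
  @measurable_fun _ _ (measurableTypeR R) _ setT f -> (forall x, 0 <= f x)%E ->
  (\int[leb R]_(x in D) f x = \int[mu]_(x in D) f x)%E.
Proof.
move=> mD mf f0.
have mid : @measurable_fun _ _ (lebesgueTypeR R) (measurableTypeR R) setT idfun.
  by move=> _ B mB; rewrite setTI; exact: measurable_leb.
have := @ge0_integral_pushforward _ _ _ _ _ _ mid (leb R) D f mD (measurable_funTS mf) (fun x _ => f0 x).
rewrite preimage_id => <-.
by apply: (@eq_measure_integral _ (measurableTypeR R)).
Qed.

Lemma integral_leb (D : set R) (f : R -> \bar R) :
  @measurable _ (measurableTypeR R) D ->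
  @measurable_fun _ _ (measurableTypeR R) _ setT f ->
  (\int[leb R]_(x in D) f x = \int[mu]_(x in D) f x)%E.
Proof.
move=> mD mf; rewrite integralE [RHS]integralE.
rewrite !ge0_integral_leb//.
- exact: measurable_funeneg.
- exact: measurable_funepos.
Qed.

Lemma Rintegral_leb (D : set R) h : @measurable _ (measurableTypeR R) D ->
  measurable_fun setT h -> \int[leb R]_(x in D) h x = \int[mu]_(x in D) h x.
Proof.
by move=> mD mh; congr fine; apply: integral_leb => //; exact/measurable_EFinP.
Qed.

Lemma leb_split (A : set R) : @measurable _ (lebesgueTypeR R) A ->
  exists X N : set R, [/\ @measurable _ (measurableTypeR R) X,
    @measurable _ (measurableTypeR R) N, mu N = 0%E & forall x, ~ N x -> (A x <-> X x)].
Proof.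
move=> mA; have : (completed_algebra_gen mu).-sigma.-measurable A.
  by rewrite completed_caratheodory_measurable.
rewrite g_sigma_completed_algebra_genE => -[X mX [N0 [N [mN N00 NN]] <-]].
exists X, N; split => // x xN; split; last by left.
by case=> // /NN.
Qed.

Lemma rat_between (a b : R) : a < b -> exists n : nat, a < ratr (odflt 0 (unpickle n) : rat) /\ ratr (odflt 0 (unpickle n) : rat) < b.
Proof.
move=> ab; have [q] := rat_in_itvoo ab; rewrite in_itv/= => /andP[h1 h2].
by exists (pickle q); rewrite pickleK /=.
Qed.

(** Each set h > q with q rational agrees with a Borel set off a Borel null set; [N] is the union of
    these countably many null sets. Every larger Borel set [M] is allowed, so that the real and
    imaginary parts of a function can share one exceptional set. *)
Lemma borel_version h : @measurable_fun _ _ (lebesgueTypeR R) (measurableTypeR R) I11 h ->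
  exists N : set R, [/\ @measurable _ (measurableTypeR R) N, mu N = 0%E &
    forall M : set R, @measurable _ (measurableTypeR R) M -> N `<=` M ->
      measurable_fun setT (fun x => h x * (\1_(I11 `\` M) x : R))].
Proof.
(* An enumeration of the rationals; an index that encodes no rational gives 0. *)
move=> mh; pose q n : R := ratr (odflt 0 (unpickle n) : rat).
pose A n : set R := I11 `&` [set x | q n < h x].
have mA n : @measurable _ (lebesgueTypeR R) (A n).
  have -> : A n = I11 `&` h @^-1` `]q n, +oo[%classic.
    by congr (_ `&` _); apply/seteqP; split => x /=; rewrite in_itv/= andbT.
  by apply: mh; [apply: measurable_leb; exact: measurable_I11|exact: measurable_itv].
have /choice[X hX] := fun n => leb_split (mA n).
have /choice[N hN] := hX.
exists (\bigcup_n N n); split.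
- by apply: bigcupT_measurable => n; have [] := hN n.
- apply/eqP; rewrite -measure_le0//.
  have /negligibleP : mu.-negligible (\bigcup_n N n).
    by apply: negligible_bigcup => n; have [_ mN N0 _] := hN n; exists (N n); split.
  by move=> ->//; apply: bigcupT_measurable => n; have [] := hN n.
move=> M mM NM.
(* Off [I11] and on [M] the product is 0, and there it exceeds [q n] exactly when [q n] is
   negative. *)
pose B n : set R := (X n `&` (I11 `\` M)) `|` [set x | q n < 0 /\ ~ (I11 `\` M) x].
have mIM : @measurable _ (measurableTypeR R) (I11 `\` M).
  by apply: measurableD => //; exact: measurable_I11.
have mB n : @measurable _ (measurableTypeR R) (B n).
  apply: measurableU; first by apply: measurableI => //; have [] := hN n.
  have [q0|q0] := ltP (q n) 0.
    rewrite (_ : [set x | _] = ~` (I11 `\` M)); first exact: measurableC.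
    by apply/seteqP; split => x /=; [case|].
  by rewrite (_ : [set x | _] = set0)//; apply/seteqP; split => x //= -[].
have BE n : [set x | q n < h x * (\1_(I11 `\` M) x : R)] = B n.
  apply/seteqP; split => x /=.
    have [xI|xI] := pselect ((I11 `\` M) x).
      rewrite (indic_in R xI) mulr1 => hx; left; split => //.
      have [_ _ _ h3] := hN n; apply/(h3 x); last by split => //; case: xI.
      by move=> Nx; apply: xI.2; apply: NM; exists n.
    by rewrite (indic_notin R xI) mulr0 => hx; right.
  case=> [[Xx xI]|[q0 xI]]; last by rewrite (indic_notin R xI) mulr0.
  rewrite (indic_in R xI) mulr1.
  have [_ _ _ h3] := hN n; have [|//] := (h3 x _).2 Xx.
  by move=> Nx; apply: xI.2; apply: NM; exists n.
apply: (@measurability _ _ (measurableTypeR R) (measurableTypeR R) _ _ _ (RGenOInfty.measurableE R)) => _ [_ [r ->] <-].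
have -> : setT `&` (fun x => h x * (\1_(I11 `\` M) x : R)) @^-1` `]r, +oo[%classic =
    \bigcup_(n in [set n | r < q n]) B n.
  apply/seteqP; split => x /=.
    rewrite in_itv/= andbT => -[_ /rat_between[n [h1 h2]]].
    by exists n => //; rewrite -BE.
  by move=> [n /= rn]; rewrite -BE /= in_itv/= andbT => h1; split => //; exact: lt_trans h1.
by apply: bigcup_measurable => n _; exact: mB.
Qed.

End Transfer.

(** * The finite Hilbert transform as a limit of principal values *)

Section FiniteHilbert.
Context (R : realType).
Notation mu := (@lebesgue_measure R).
Notation I11 := (I11 R).
Implicit Types (f g h : R -> R) (F k : R -> R[i]).

(* [chilb F = T(F)] almost everywhere on (-1, 1). *)
Definition chilb F (x : R) : R[i] :=
  (pi^-1)%:C * (hilb (fun s => complex.Re (F s)) x +i* hilb (fun s => complex.Im (F s)) x).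

Lemma cvg_complex (T : Type) (S : set_system T) (u : T -> R[i]) (l : R[i]) : Filter S ->
  complex.Re (u n) @[n --> S] --> complex.Re l ->
  complex.Im (u n) @[n --> S] --> complex.Im l ->
  (u n : R[i]^o) @[n --> S] --> (l : R[i]^o).
Proof.
move=> FS /cvgrPdist_lt hr /cvgrPdist_lt hi; apply/cvgrPdist_lt => eps.
(* In the order of [R[i]] a positive eps has zero imaginary part, so it is a positive real number
   [a]. *)
case: eps => a b; rewrite ltcE /= => /andP[/eqP b0 a0].
have a2 : 0 < a / 2 by rewrite divr_gt0.
near=> n; rewrite ltcE /= b0 eqxx /=; change (cabs (l - u n) < a).
apply: le_lt_trans (cabs_sum _) _.
have -> : complex.Re (l - u n) = complex.Re l - complex.Re (u n) by case: (l) (u n) => ? ? [].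
have -> : complex.Im (l - u n) = complex.Im l - complex.Im (u n) by case: (l) (u n) => ? ? [].
rewrite [a]splitr; apply: ltrD; near: n; [exact: hr|exact: hi].
Unshelve. all: by end_near. Qed.

Lemma cvg_complex_right (u : R -> R[i]) (v w : R -> R) (p a b : R) :
  (forall e, 0 < e -> u e = (p * v e) +i* (p * w e)) ->
  v e @[e --> (0 : R)^'+] --> a -> w e @[e --> (0 : R)^'+] --> b ->
  (u e : R[i]^o) @[e --> (0 : R)^'+] --> (p%:C * (a +i* b) : R[i]^o).
Proof.
move=> uE va wb.
have c1 : p * v e @[e --> (0 : R)^'+] --> p * a by apply: cvgM => //; exact: cvg_cst.
have c2 : p * w e @[e --> (0 : R)^'+] --> p * b by apply: cvgM => //; exact: cvg_cst.
apply: cvg_complex => /=.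
  rewrite mul0r subr0; apply: cvg_trans c1; apply: near_eq_cvg; near=> e.
  by rewrite uE//; near: e; exact: nbhs_right_gt.
rewrite mul0r addr0; apply: cvg_trans c2; apply: near_eq_cvg; near=> e.
by rewrite uE//; near: e; exact: nbhs_right_gt.
Unshelve. all: by end_near. Qed.

Lemma pv_split h (t e : R) : rint mu h -> supported h -> I11 t -> 0 < e ->
  \int[leb R]_(x in `]-1, t - e[) (h x * (x - t)^-1) +
  \int[leb R]_(x in `]t + e, 1[) (h x * (x - t)^-1) =
  \int[mu]_x (h x * pvker t e x).
Proof.
move=> hi hs It e0.
have mh := rint_measurable hi.
have mk : measurable_fun setT (fun x => h x * (x - t)^-1).
  by apply: measurable_funM => //; apply: measurable_inv_fun; exact: measurable_funB.
have i1 : rint mu (fun x => h x * pvker t e x).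
  apply: (@rint_Mr _ _ _ mu e^-1) => //; first exact: measurable_pvker.
  by move=> x; exact: pvker_bound.
have part (D : set R) : measurable D -> (forall x, D x -> e < `|x - t|) ->
    \int[leb R]_(x in D) (h x * (x - t)^-1) = \int[mu]_x (h x * pvker t e x * (\1_D x : R)).
  move=> mD De; rewrite Rintegral_leb// Rintegral_mkcond; apply: rInt_eq => x.
  rewrite patchE; case: ifPn => xD.
    move/set_mem in xD; rewrite (indic_in R xD) mulr1 /pvker ifT//; exact: De.
  by rewrite indic_notin ?mulr0//; move/negP: xD; apply: contra_not => /mem_set.
have m1 : measurable (`]-1, t - e[%classic : set R) by exact: measurable_itv.
have m2 : measurable (`]t + e, 1[%classic : set R) by exact: measurable_itv.
rewrite part//; last first.
  move=> x /=; rewrite in_itv/= => /andP[_ h1]; rewrite distrC.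
  by apply: lt_le_trans (ler_norm _); lra.
rewrite part//; last first.
  move=> x /=; rewrite in_itv/= => /andP[h1 _].
  by apply: lt_le_trans (ler_norm _); lra.
have j1 := @rint_ind _ _ R mu (fun x => h x * pvker t e x) _ m1 i1.
have j2 := @rint_ind _ _ R mu (fun x => h x * pvker t e x) _ m2 i1.
rewrite -(rIntD j1 j2); apply: rInt_eq => x.
rewrite -mulrDr; have [xI|xI] := pselect (I11 x); last by rewrite hs// !mul0r.
move: xI It; rewrite /I11 /= !in_itv/= => /andP[x1 x2] /andP[t1 t2].
rewrite /pvker; case: ifPn => [|_]; last by rewrite mulr0 mul0r.
rewrite lter_normr => /orP[hx|hx].
  have n1 : ~ `]-1, t - e[%classic x by rewrite /= in_itv/= => /andP[_ h']; lra.
  have p1 : `]t + e, 1[%classic x by rewrite /= in_itv/=; apply/andP; split; lra.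
  by rewrite (indic_notin R n1) (indic_in R p1) add0r mulr1.
have n1 : ~ `]t + e, 1[%classic x by rewrite /= in_itv/= => /andP[h' _]; lra.
have p1 : `]-1, t - e[%classic x by rewrite /= in_itv/=; apply/andP; split; lra.
by rewrite (indic_notin R n1) (indic_in R p1) addr0 mulr1.
Qed.

Lemma div_realE (z : R[i]) (r : R) :
  z / r%:C = (complex.Re z * r^-1) +i* (complex.Im z * r^-1).
Proof. by rewrite -[_^-1](fmorphV (@real_complex R)); case: z => a b; congr (_ +i* _) => /=; ring. Qed.

Lemma cintegral_div (D : set R) F (t : R) :
  cintegral D (fun x => F x / (x - t)%:C) =
  (\int[leb R]_(x in D) (complex.Re (F x) * (x - t)^-1)) +i*
  (\int[leb R]_(x in D) (complex.Im (F x) * (x - t)^-1)).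
Proof.
rewrite /cintegral; congr (_ +i* _).
  by apply: eq_Rintegral => x _; rewrite div_realE.
by apply: eq_Rintegral => x _; rewrite div_realE.
Qed.

Lemma finite_hilbert_cvg F t : cint mu F -> supported F -> I11 t ->
  \int[mu]_x (complex.Re (F x) * pvker t e x) @[e --> (0 : R)^'+] -->
    hilb (fun s => complex.Re (F s)) t ->
  \int[mu]_x (complex.Im (F x) * pvker t e x) @[e --> (0 : R)^'+] -->
    hilb (fun s => complex.Im (F s)) t ->
  finite_hilbert F t = chilb F t.
Proof.
move=> [Fr Fi] Fs It hr hi.
have sr : supported (fun s => complex.Re (F s)) by move=> x xI; rewrite Fs.
have si : supported (fun s => complex.Im (F s)) by move=> x xI; rewrite Fs.
have E e : 0 < e -> (pi^-1)%:C *
   (cintegral `](-1), t - e[%classic (fun x => F x / (x - t)%:C) +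
    cintegral `]t + e, 1[%classic (fun x => F x / (x - t)%:C)) =
   (pi^-1 * \int[mu]_x (complex.Re (F x) * pvker t e x)) +i*
   (pi^-1 * \int[mu]_x (complex.Im (F x) * pvker t e x)).
  move=> e0; rewrite !cintegral_div -(pv_split Fr sr It e0) -(pv_split Fi si It e0).
  by move: (pi^-1) => p; congr (_ +i* _) => /=; ring.
exact: (cvg_lim (@norm_hausdorff _ R[i]^o) (cvg_complex_right E hr hi)).
Qed.

Lemma ae_finite_hilbert F : cint mu F -> supported F ->
  {ae mu, forall t : R, I11 t -> finite_hilbert F t = chilb F t}.
Proof.
move=> Fi Fs; apply: ae_imp2 (ae_cvg_pv Fi.1) (ae_cvg_pv Fi.2) _ => t h1 h2 It.
exact: (finite_hilbert_cvg Fi Fs It h1 h2).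
Qed.

Lemma measurable_leb_I11 : @measurable _ (lebesgueTypeR R) I11.
Proof. by apply: measurable_leb; exact: measurable_I11. Qed.

Lemma Rintegral_leb_ae (D : set R) f g :
  @measurable _ (measurableTypeR R) D -> D `<=` I11 ->
  @measurable_fun _ _ (lebesgueTypeR R) (measurableTypeR R) I11 f ->
  @measurable_fun _ _ (lebesgueTypeR R) (measurableTypeR R) I11 g ->
  {ae leb R, forall x, I11 x -> f x = g x} ->
  forall h, measurable_fun setT h ->
  \int[leb R]_(x in D) (f x * h x) = \int[leb R]_(x in D) (g x * h x).
Proof.
move=> mD DI mf mg fg h mh; have mDl := measurable_leb mD.
have mfD := measurable_funS measurable_leb_I11 DI mf.
have mgD := measurable_funS measurable_leb_I11 DI mg.
have mhD : @measurable_fun _ _ (lebesgueTypeR R) (measurableTypeR R) D h.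
  exact: measurable_leb_fun.
congr fine; apply: ae_eq_integral.
- exact: mDl.
- by apply/measurable_EFinP; exact: measurable_funM.
- by apply/measurable_EFinP; exact: measurable_funM.
- by apply: ae_imp fg _ => x hx xD /=; rewrite hx//; exact: DI.
Qed.

(** The two image filters coincide, so [lim] takes the same value on both, its default value
    included; convergence is not involved. *)
Lemma lim_near_eq (T : ptopologicalType) (U : Type) (S : set_system U) (u v : U -> T) :
  Filter S -> (\near S, u S = v S) -> lim (u x @[x --> S]) = lim (v x @[x --> S]).
Proof.
move=> FS uv; congr (lim _); apply/seteqP; split => A SA.
  apply: (@filterS2 U S FS (fun x => u x = v x) (fun x => A (u x)) (fun x => A (v x)) _ uv SA) => x /= e; rewrite e; exact.
apply: (@filterS2 U S FS (fun x => u x = v x) (fun x => A (v x)) (fun x => A (u x)) _ uv SA) => x /= e; rewrite e; exact.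
Qed.

(** For each e > 0 the truncated integrals of [F] and [k] are equal, so the transforms agree at
    every point [t] of the interval, whether or not the limit exists there. *)
Lemma finite_hilbert_ae F k (t : R) : cmeasurable F -> cmeasurable k ->
  {ae leb R, forall x, I11 x -> F x = k x} -> I11 t ->
  finite_hilbert F t = finite_hilbert k t.
Proof.
move=> [mFr mFi] [mkr mki] Fk It; rewrite /finite_hilbert; apply: (@lim_near_eq R[i]^o); near=> e.
have e0 : 0 < e by near: e; exact: nbhs_right_gt.
have mh : measurable_fun setT (fun x : R => (x - t)^-1).
  by apply: measurable_inv_fun; exact: measurable_funB.
have rk : {ae leb R, forall x, I11 x -> complex.Re (F x) = complex.Re (k x)}.
  by apply: ae_imp Fk _ => x h /h ->.
have ik : {ae leb R, forall x, I11 x -> complex.Im (F x) = complex.Im (k x)}.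
  by apply: ae_imp Fk _ => x h /h ->.
move: It; rewrite /I11 /= in_itv/= => /andP[t1 t2].
have D1 : `]-1, t - e[%classic `<=` I11.
  by move=> x; rewrite /I11 /= !in_itv/= => /andP[? ?]; apply/andP; split; lra.
have D2 : `]t + e, 1[%classic `<=` I11.
  by move=> x; rewrite /I11 /= !in_itv/= => /andP[? ?]; apply/andP; split; lra.
have m1 : measurable (`]-1, t - e[%classic : set R) by exact: measurable_itv.
have m2 : measurable (`]t + e, 1[%classic : set R) by exact: measurable_itv.
rewrite !cintegral_div.
rewrite (Rintegral_leb_ae m1 D1 mFr mkr rk mh) (Rintegral_leb_ae m1 D1 mFi mki ik mh).
by rewrite (Rintegral_leb_ae m2 D2 mFr mkr rk mh) (Rintegral_leb_ae m2 D2 mFi mki ik mh).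
Unshelve. all: by end_near. Qed.

(** This rests on the completeness of the measure: a function that agrees almost everywhere with a
    measurable one is measurable. *)
Lemma cmeasurable_ae F k : cmeasurable F -> {ae leb R, forall x, I11 x -> F x = k x} ->
  cmeasurable k.
Proof.
move=> [mr mi] Fk; split; apply/measurable_EFinP.
  apply: (ae_measurable_fun (@completed_lebesgue_measure_is_complete R)
    (f := fun x => (complex.Re (F x))%:E)); last exact/measurable_EFinP.
  by apply: ae_imp Fk _ => x h /h /= ->.
apply: (ae_measurable_fun (@completed_lebesgue_measure_is_complete R)
  (f := fun x => (complex.Im (F x))%:E)); last exact/measurable_EFinP.
by apply: ae_imp Fk _ => x h /h /= ->.
Qed.

Lemma cmeas_cmeasurable F : cmeas F -> cmeasurable F.
Proof. by move=> [mr mi]; split; apply: measurable_leb_fun => //; exact: measurable_I11. Qed.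

End FiniteHilbert.

(** * From the rearrangement norm to level sets *)

Section LlogLToZygmund.
Context (R : realType).
Notation mu := (@lebesgue_measure R).
Notation I11 := (I11 R).

(* No measurability: the integral of a nonnegative function is a supremum over
   the simple functions below it. *)
Lemma ge0_le_integral_sup d (T : measurableType d) (nu : {measure set T -> \bar R})
    (D E : set T) (f1 f2 : T -> \bar R) :
  (forall x, D x -> 0 <= f1 x)%E -> (forall x, E x -> 0 <= f2 x)%E ->
  (forall x, D x -> E x /\ (f1 x <= f2 x)%E) ->
  (\int[nu]_(x in D) f1 x <= \int[nu]_(x in E) f2 x)%E.
Proof.
move=> h1 h2 h12; rewrite (ge0_integralE _ h1) (ge0_integralE _ h2).
apply: le_ereal_sup => _ [h hle <-]; exists h => // x.
apply: le_trans (hle x) _; rewrite !patchE.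
case: ifPn => [/set_mem Dx|_].
  by have [Ex f12] := h12 x Dx; rewrite mem_set.
by case: ifPn => // /set_mem /h2.
Qed.

Lemma Rintegral_indic_setT d (T : measurableType d) (nu : {measure set T -> \bar R})
    (A : set T) : measurable A -> \int[nu]_x (\1_A x : R) = fine (nu A).
Proof. by move=> mA; rewrite /Rintegral integral_indic// setIT. Qed.

Lemma rearrangement_ge (g : R -> R[i]) (t : R) (k : nat) :
  (t%:E < leb R [set x | I11 x /\ (k.+1%:R < cabs (g x))%R])%E ->
  (k.+1%:R%:E <= rearrangement g t)%E.
Proof.
move=> ht; apply: le_ereal_inf_tmp => _ [l [l0 hl] <-]; rewrite lee_fin leNgt.
apply/negP => lk; move: ht; rewrite ltNge; apply/negP; rewrite negbK.
apply: le_trans hl; apply: le_outer_measure => x [xI hx]; split => //.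
exact: lt_trans lk hx.
Qed.

Lemma rearrangement_ge0 (g : R -> R[i]) (t : R) : (0 <= rearrangement g t)%E.
Proof. by apply: le_ereal_inf_tmp => _ [l [l0 _] <-]; rewrite lee_fin. Qed.

(** Let a_k be the measure of the set where G > k + 1. For t < a_k the rearrangement of [g] at t is
    at least k + 1, so it dominates the sum of the indicators of the intervals (0, a_k). On (0, a_k)
    also ln (2 e / t) >= ln (2 e / a_k) >= 0. Integrating the product of the two bounds gives the
    partial sums in [zygmund]. *)
Lemma LlogL_zygmund (g : R -> R[i]) (G : R -> R) : (LlogL_norm g < +oo)%E ->
  measurable_fun setT G -> supported G -> (forall x, G x <= cabs (g x)) -> zygmund G.
Proof.
move=> gL mG Gs Gg.
pose a k := level_measure G k.
have aE k : mu (level G k) = (a k)%:E /\ 0 <= a k <= 2 by exact: level_measureE.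
have levS k : ((a k)%:E <= leb R [set x | I11 x /\ (k.+1%:R < cabs (g x))%R])%E.
  rewrite -(aE k).1; apply: le_outer_measure => x hx; split.
    exact: level_I11 hx.
  exact: lt_le_trans hx (Gg x).
pose J k : set R := `]0, a k[%classic.
pose c k : R := ln (2 * expR 1 / a k).
have mJ k : measurable (J k) by exact: measurable_itv.
have muJ k : mu (J k) = (a k)%:E.
  rewrite /J lebesgue_measure_itv/= lte_fin; have [_ /andP[a0 _]] := aE k.
  rewrite lt_neqAle a0 andbT; case: eqP => [<-//|_] /=.
  by rewrite -EFinD subr0.
have iJ k : rint mu (fun x => c k * (\1_(J k) x : R)).
  have Jf : (mu (J k) < +oo)%E by rewrite muJ ltry.
  by apply: rintZl; exact: (@rint_indD _ _ R mu _ (mJ k) Jf).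
have Jint k : \int[mu]_x (c k * (\1_(J k) x : R)) = a k * c k.
  have iJ1 : rint mu (fun x => (\1_(J k) x : R)).
    have Jf : (mu (J k) < +oo)%E by rewrite muJ ltry.
    exact: (@rint_indD _ _ R mu _ (mJ k) Jf).
  rewrite (rIntZl _ iJ1) mulrC; congr (_ * _).
  by rewrite (Rintegral_indic_setT mu (mJ k)); exact: (congr1 fine (muJ k)).
have c0 k x : J k x -> 0 <= c k <= ln (2 * expR 1 / x).
  rewrite /J /= in_itv/= => /andP[x0 xa]; have [_ /andP[_ a2]] := aE k.
  have ak : 0 < a k by exact: lt_trans xa.
  have e2 : 0 < 2 * expR 1 :> R by rewrite mulr_gt0// expR_gt0.
  apply/andP; split; first by apply: le_trans (ln_ge1 ak a2).
  rewrite ler_ln ?posrE ?divr_gt0// ler_wpM2l ?(ltW e2)// lef_pV2 ?posrE//.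
  exact: ltW.
pose s n x := \sum_(k < n) c k * (\1_(J k) x : R).
have s_eq0 n x : (forall k, ~ J k x) -> s n x = 0.
  by move=> h; rewrite /s big1// => k _; rewrite (indic_notin R (h k)) mulr0.
have s0 n x : 0 <= s n x.
  apply: sumr_ge0 => k _; have [xJ|xJ] := pselect (J k x).
    by rewrite (indic_in R xJ) mulr1; have /andP[] := c0 k x xJ.
  by rewrite (indic_notin R xJ) mulr0.
have I02 x k : J k x -> `]0%R, 2%R[%classic x.
  rewrite /J /= !in_itv/= => /andP[-> xa] /=; have [_ /andP[_ a2]] := aE k.
  exact: lt_le_trans xa a2.
have w0 x : `]0%R, 2%R[%classic x -> 0 <= ln (2 * expR 1 / x) :> R.
  by rewrite /= in_itv/= => /andP[x0 x2]; apply: le_trans (ln_ge1 x0 (ltW x2)).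
have key n x : `]0%R, 2%R[%classic x ->
    ((s n x)%:E <= rearrangement g x * (ln (2 * expR 1 / x))%:E)%E.
  move=> x02; have wx := w0 x x02.
  have : (((\sum_(k < n) (\1_(J k) x : R)) * ln (2 * expR 1 / x))%:E <=
      rearrangement g x * (ln (2 * expR 1 / x))%:E)%E.
    rewrite EFinM; apply: lee_wpmul2r; first by rewrite lee_fin.
    elim: n => [|n IH]; first by rewrite big_ord0 rearrangement_ge0.
    rewrite big_ord_recr /=; have [xJ|xJ] := pselect (J n x); last first.
      by rewrite (indic_notin R xJ) addr0.
    rewrite (indic_in R xJ); apply: (@le_trans _ _ n.+1%:R%:E).
      rewrite lee_fin -natr1 lerD2r.
      apply: (@le_trans _ _ (\sum_(k < n) (1 : R))); last by rewrite sumr_const card_ord.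
      by apply: ler_sum => k _; have /andP[] := @indic01 _ R R (J k) x.
    apply: rearrangement_ge; apply: lt_le_trans (levS n).
    by move: xJ; rewrite /J /= in_itv/= lte_fin => /andP[].
  apply: le_trans; rewrite lee_fin mulr_suml; apply: ler_sum => k _.
  have [xJ|xJ] := pselect (J k x).
    by rewrite (indic_in R xJ) mulr1 mul1r; have /andP[] := c0 k x xJ.
  by rewrite (indic_notin R xJ) mulr0 mul0r.
have Lfin : LlogL_norm g \is a fin_num.
  rewrite ge0_fin_numE//; apply: integral_ge0 => x x02.
  by apply: mule_ge0; [exact: rearrangement_ge0|rewrite lee_fin; exact: w0].
exists (fine (LlogL_norm g)) => n.
have [si sE] := @rint_sum _ _ _ mu (fun k x => c k * (\1_(J k) x : R)) n iJ.
have -> : \sum_(k < n) level_measure G k * ln (2 * expR 1 / level_measure G k) =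
    \int[mu]_x s n x.
  by rewrite sE; apply: eq_bigr => k _; rewrite Jint.
have sI : rint mu (s n) by exact: si.
rewrite -lee_fin (fineK Lfin) -(rintE sI) -integral_leb//; last first.
  by apply/measurable_EFinP; exact: rint_measurable sI.
apply: (@le_trans _ _ (\int[leb R]_(x in `]0%R, 2%R[%classic) (s n x)%:E)%E).
  rewrite [leRHS]integral_mkcond le_eqVlt; apply/orP; left; apply/eqP.
  apply: eq_integral => x _; rewrite patchE; case: ifPn => // xD.
  rewrite -[s n x]/(s n x) s_eq0// => k /I02 xk; move: xD; rewrite mem_set//.
apply: ge0_le_integral_sup.
- by move=> x _; rewrite lee_fin.
- by move=> x x02; apply: mule_ge0; [exact: rearrangement_ge0|rewrite lee_fin; exact: w0].
- by move=> x x02; split => //; exact: key.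
Qed.

End LlogLToZygmund.

Section Algebra.
Context (K : fieldType).
Implicit Types (p a b x y : K).

Lemma scale_sub p a b x y : a * (p * x) - b * (p * y) = p * (a * x - b * y).
Proof. by ring. Qed.

Lemma scale_add p a b x y : a * (p * y) + b * (p * x) = p * (a * y + b * x).
Proof. by ring. Qed.

Lemma combine_scaled a b x y : x + (a - 1) * x + b * y = a * x + b * y.
Proof. by ring. Qed.

Lemma regroup_Re p (f1 f2 g1 g2 hf1 hf2 hg1 hg2 : K) :
  p * (g1 * hf1 - g2 * hf2) + p * (f1 * hg1 - f2 * hg2) =
  p * (g1 * hf1 + f1 * hg1) + - p * (g2 * hf2 + f2 * hg2).
Proof. by ring. Qed.

Lemma regroup_Im p (f1 f2 g1 g2 hf1 hf2 hg1 hg2 : K) :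
  p * (g1 * hf2 + g2 * hf1) + p * (f1 * hg2 + f2 * hg1) =
  p * (g2 * hf1 + f1 * hg2) + p * (g1 * hf2 + f2 * hg1).
Proof. by ring. Qed.

End Algebra.

(** * From real to complex functions *)

Section Assembly.
Context (R : realType).
Notation mu := (@lebesgue_measure R).
Notation I11 := (I11 R).
Implicit Types (F G k : R -> R[i]).

Local Notation Re := (@complex.Re R).
Local Notation Im := (@complex.Im R).

Lemma measurable_cabs_leb F : cmeasurable F ->
  @measurable_fun _ _ (lebesgueTypeR R) (measurableTypeR R) I11 (fun x => cabs (F x)).
Proof.
move=> [mr mi]; under eq_fun do rewrite cabs_normc.
have ms : measurable_fun setT (@Num.sqrt R : measurableTypeR R -> measurableTypeR R).
  by apply: continuous_measurable_fun; exact: sqrt_continuous.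
apply: (measurableT_comp ms); apply: measurable_funD; exact: measurable_funX.
Qed.

Lemma integral_cabs_ae F k : cmeasurable F -> cmeasurable k ->
  {ae leb R, forall x, I11 x -> k x = F x} ->
  (\int[leb R]_(x in I11) (cabs (k x))%:E = \int[leb R]_(x in I11) (cabs (F x))%:E)%E.
Proof.
move=> mF mk kF; apply: ge0_ae_eq_integral.
- exact: measurable_leb_I11.
- by apply/measurable_EFinP; exact: measurable_cabs_leb.
- by apply/measurable_EFinP; exact: measurable_cabs_leb.
- by move=> x _; rewrite lee_fin cabs_ge0.
- by move=> x _; rewrite lee_fin cabs_ge0.
- by apply: ae_imp kF _ => x h /h ->.
Qed.

Lemma integral_cabs_supported F : cmeas F -> supported F ->
  (\int[leb R]_(x in I11) (cabs (F x))%:E = \int[mu]_x (cabs (F x))%:E)%E.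
Proof.
move=> mF Fs; rewrite integral_leb; last 2 first.
- exact: measurable_I11.
- by apply/measurable_EFinP; exact: measurable_cabs.
rewrite integral_mkcond; apply: eq_integral => x _; rewrite patchE; case: ifPn => // xI.
rewrite Fs ?cabs_real ?normr0// => /mem_set xI'; by rewrite xI' in xI.
Qed.

Lemma cint_of_L1 F k : cmeas F -> supported F -> L1 k ->
  {ae leb R, forall x, I11 x -> k x = F x} -> cint mu F.
Proof.
move=> mF Fs [mk ki] kF.
rewrite (integral_cabs_ae (cmeas_cmeasurable mF) mk kF) (integral_cabs_supported mF Fs) in ki.
apply: (@cint_le _ _ _ mu F (fun x => cabs (F x))) => //.
apply: rint_lty; first exact: measurable_cabs.
by under eq_integral do rewrite ger0_norm ?cabs_ge0//.
Qed.

Lemma L1_of_cint F k : cint mu F -> supported F ->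
  {ae leb R, forall x, I11 x -> F x = k x} -> L1 k.
Proof.
move=> Fi Fs Fk; have mF := cint_cmeas Fi; have mFl := cmeas_cmeasurable mF.
have mk := cmeasurable_ae mFl Fk; split => //.
rewrite (integral_cabs_ae mFl mk); last by apply: ae_imp Fk _ => x h /h ->.
by rewrite (integral_cabs_supported mF Fs) (rintE (cint_cabs Fi)) ltry.
Qed.

Lemma ae_hilb_comb (f g h : R -> R) (a b : R) : rint mu f -> rint mu g ->
  (forall s, h s = a * f s + b * g s) ->
  {ae mu, forall t : R, hilb h t = a * hilb f t + b * hilb g t}.
Proof.
move=> fi gi hE; pose f' s := a * f s.
have f'i : rint mu f' by exact: rintZl.
have e1 : forall s, h s = f' s + b * g s by [].
have e2 : forall s, f' s = f s + (a - 1) * f s by move=> s; rewrite /f'; ring.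
apply: ae_imp2 (ae_hilb_lin f'i gi e1) (ae_hilb_lin fi fi e2) _ => t -> ->.
exact: combine_scaled.
Qed.

Lemma Re_mul (z w : R[i]) : Re (z * w) = Re z * Re w - Im z * Im w.
Proof. by case: z w => ? ? []. Qed.

Lemma Im_mul (z w : R[i]) : Im (z * w) = Re z * Im w + Im z * Re w.
Proof. by case: z w => ? ? [] ? ? /=; rewrite addrC. Qed.

Lemma Re_chilb F x : Re (chilb F x) = pi^-1 * hilb (fun s => Re (F s)) x.
Proof. by rewrite Re_mul /= mul0r subr0. Qed.

Lemma Im_chilb F x : Im (chilb F x) = pi^-1 * hilb (fun s => Im (F s)) x.
Proof. by rewrite Im_mul /= mul0r addr0. Qed.

Lemma Re_mul_chilb (z : R[i]) F x : Re (z * chilb F x) =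
  pi^-1 * (Re z * hilb (fun s => Re (F s)) x - Im z * hilb (fun s => Im (F s)) x).
Proof.
have -> := Re_mul z (chilb F x); have -> := Re_chilb F x; have -> := Im_chilb F x.
exact: scale_sub.
Qed.

Lemma Im_mul_chilb (z : R[i]) F x : Im (z * chilb F x) =
  pi^-1 * (Re z * hilb (fun s => Im (F s)) x + Im z * hilb (fun s => Re (F s)) x).
Proof.
have -> := Im_mul z (chilb F x); have -> := Re_chilb F x; have -> := Im_chilb F x.
exact: scale_add.
Qed.

Lemma Re_add (z w : R[i]) : Re (z + w) = Re z + Re w. Proof. by case: z w => ? ? []. Qed.
Lemma Im_add (z w : R[i]) : Im (z + w) = Im z + Im w. Proof. by case: z w => ? ? []. Qed.
Lemma Re_sub (z w : R[i]) : Re (z - w) = Re z - Re w. Proof. by case: z w => ? ? []. Qed.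
Lemma Im_sub (z w : R[i]) : Im (z - w) = Im z - Im w. Proof. by case: z w => ? ? []. Qed.

Lemma Re_sum_chilb (z w : R[i]) F G x : Re (z * chilb F x + w * chilb G x) =
  pi^-1 * (Re z * hilb (fun s => Re (F s)) x + Re w * hilb (fun s => Re (G s)) x) +
  - pi^-1 * (Im z * hilb (fun s => Im (F s)) x + Im w * hilb (fun s => Im (G s)) x).
Proof.
apply: etrans (Re_add _ _) _.
apply: etrans (congr2 +%R (Re_mul_chilb z F x) (Re_mul_chilb w G x)) _.
exact: regroup_Re.
Qed.

Lemma Im_sum_chilb (z w : R[i]) F G x : Im (z * chilb F x + w * chilb G x) =
  pi^-1 * (Im z * hilb (fun s => Re (F s)) x + Re w * hilb (fun s => Im (G s)) x) +
  pi^-1 * (Re z * hilb (fun s => Im (F s)) x + Im w * hilb (fun s => Re (G s)) x).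
Proof.
apply: etrans (Im_add _ _) _.
apply: etrans (congr2 +%R (Im_mul_chilb z F x) (Im_mul_chilb w G x)) _.
exact: regroup_Im.
Qed.

Lemma cmeas_chilb F : cint mu F -> cmeas (chilb F).
Proof.
move=> [Fr Fi]; split.
  by under eq_fun do rewrite Re_chilb; apply: measurable_funM => //; exact: measurable_hilb.
by under eq_fun do rewrite Im_chilb; apply: measurable_funM => //; exact: measurable_hilb.
Qed.

Lemma supported_Re F : supported F -> supported (fun x => Re (F x)).
Proof. by move=> Fs x /Fs ->. Qed.

Lemma supported_Im F : supported F -> supported (fun x => Im (F x)).
Proof. by move=> Fs x /Fs ->. Qed.

(** Used with [f] a component of the complex function and [h] the transform of a component of g 1_A:
    their product is at most pi |f| |T(g 1_A)|. *)
Lemma rint_of_cabs_mul (f h : R -> R) (z w : R -> R[i]) :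
  measurable_fun setT f -> measurable_fun setT h ->
  rint mu (fun x => cabs (z x) * cabs (w x)) ->
  (forall x, `|f x| <= cabs (z x)) -> (forall x, `|h x| <= pi * cabs (w x)) ->
  rint mu (fun x => f x * h x).
Proof.
move=> mf mh zw fz hw; apply: rint_le (rintZl pi zw) _; first exact: measurable_funM.
by move=> x; rewrite normrM mulrCA; apply: ler_pM.
Qed.

Lemma pi_Vmul (p a : R) : 0 < p -> `|a| = p * `|p^-1 * a|.
Proof.
move=> p0; rewrite normrM (gtr0_norm (_ : 0 < p^-1)) ?invr_gt0//.
by rewrite mulrA mulfV ?mul1r// lt0r_neq0.
Qed.

Lemma hilb_Re_le F x : `|hilb (fun s => Re (F s)) x| <= pi * cabs (chilb F x).
Proof.
rewrite (pi_Vmul _ (pi_gt0 R)) ler_wpM2l ?pi_ge0// -Re_chilb; exact: cabs_Re.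
Qed.

Lemma hilb_Im_le F x : `|hilb (fun s => Im (F s)) x| <= pi * cabs (chilb F x).
Proof.
rewrite (pi_Vmul _ (pi_gt0 R)) ler_wpM2l ?pi_ge0// -Im_chilb; exact: cabs_Im.
Qed.

Lemma product_Re (p f1 f2 g1 g2 hf1 hf2 hg1 hg2 : R) : p != 0 ->
  p^-1 * (p^-1 * (hf1 * hg1 - p ^+ 2 * (f1 * g1)) + - p^-1 * (hf2 * hg2 - p ^+ 2 * (f2 * g2))) =
  p^-1 * hf1 * (p^-1 * hg1) - p^-1 * hf2 * (p^-1 * hg2) - (f1 * g1 - f2 * g2).
Proof. by move=> p0; field. Qed.

Lemma product_Im (p f1 f2 g1 g2 hf1 hf2 hg1 hg2 : R) : p != 0 ->
  p^-1 * (p^-1 * (hf1 * hg2 - p ^+ 2 * (f1 * g2)) + p^-1 * (hf2 * hg1 - p ^+ 2 * (f2 * g1))) =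
  p^-1 * hf1 * (p^-1 * hg2) + p^-1 * hf2 * (p^-1 * hg1) - (f1 * g2 + f2 * g1).
Proof. by move=> p0; field. Qed.

(** Combines the four real product formulas. The number k_ij stands for the transform of g_j Hf_i +
    f_i Hg_j, where the indices 1 and 2 denote real and imaginary parts; p is pi. *)
Lemma product_complex (p : R) (cF cG cK zF zG : R[i])
    (hf1 hf2 hg1 hg2 hk1 hk2 k11 k12 k21 k22 : R) : p != 0 ->
  Re cF = p^-1 * hf1 -> Im cF = p^-1 * hf2 -> Re cG = p^-1 * hg1 -> Im cG = p^-1 * hg2 ->
  Re cK = p^-1 * hk1 -> Im cK = p^-1 * hk2 ->
  hk1 = p^-1 * k11 + - p^-1 * k22 -> hk2 = p^-1 * k12 + p^-1 * k21 ->
  k11 = hf1 * hg1 - p ^+ 2 * (Re zF * Re zG) -> k12 = hf1 * hg2 - p ^+ 2 * (Re zF * Im zG) ->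
  k21 = hf2 * hg1 - p ^+ 2 * (Im zF * Re zG) -> k22 = hf2 * hg2 - p ^+ 2 * (Im zF * Im zG) ->
  cK = cF * cG - zF * zG.
Proof.
move=> p0; case: cF cG cK zF zG => ? ? [? ?] [? ?] [? ?] [? ?] /= -> -> -> -> -> -> -> -> -> -> -> ->.
by congr (_ +i* _); [exact: product_Re|exact: product_Im].
Qed.

Lemma cint_ind F (A : set R) : measurable A -> cint mu F ->
  cint mu (fun s => F s * (\1_A s : R)%:C).
Proof.
move=> mA [Fr Fi]; split.
  by apply: rint_eq (@rint_ind _ _ R mu _ A mA Fr) => x; rewrite Re_mulC.
by apply: rint_eq (@rint_ind _ _ R mu _ A mA Fi) => x; rewrite Im_mulC.
Qed.

(** As the kernel is real, the transforms of Re (g 1_A) and Im (g 1_A) are bounded by pi |T(g 1_A)|.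
    The complex hypothesis therefore implies that of [parseval] for each of the four real pairs, and
    bilinearity recombines the results. *)
Lemma poincare_bertrand_borel F G : cint mu F -> supported F -> cint mu G -> supported G ->
  pairs_bounded (fun x => Re (G x)) -> pairs_bounded (fun x => Im (G x)) ->
  (forall A : set R, measurable A ->
    cint mu (fun x => F x * chilb (fun s => G s * (\1_A s : R)%:C) x)) ->
  cint mu (fun x => G x * chilb F x) /\
  {ae mu, forall t : R,
    chilb (fun x => G x * chilb F x + F x * chilb G x) t =
    chilb F t * chilb G t - F t * G t}.
Proof.
move=> Fi Fs Gi Gs Gr Gim FG.
have [F1i F2i] := Fi; have [G1i G2i] := Gi.
have F1s := supported_Re Fs; have F2s := supported_Im Fs.
have G1s := supported_Re Gs; have G2s := supported_Im Gs.
have mF1 := rint_measurable F1i; have mF2 := rint_measurable F2i.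
have cab A : measurable A ->
    rint mu (fun x => cabs (F x) * cabs (chilb (fun s => G s * (\1_A s : R)%:C) x)).
  by move=> mA; apply: rint_eq (cint_cabs (FG A mA)) => x; rewrite cabsM.
have mh1 A : measurable A -> measurable_fun setT (hilb (fun s => Re (G s) * (\1_A s : R))).
  by move=> mA; apply: measurable_hilb; exact: (@rint_ind _ _ R mu _ A mA G1i).
have mh2 A : measurable A -> measurable_fun setT (hilb (fun s => Im (G s) * (\1_A s : R))).
  by move=> mA; apply: measurable_hilb; exact: (@rint_ind _ _ R mu _ A mA G2i).
have h1 A x : `|hilb (fun s => Re (G s) * (\1_A s : R)) x| <=
    pi * cabs (chilb (fun s => G s * (\1_A s : R)%:C) x).
  have -> : (fun s => Re (G s) * (\1_A s : R)) = (fun s => Re (G s * (\1_A s : R)%:C)).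
    by apply/funext => s; rewrite Re_mulC.
  exact: (hilb_Re_le (fun s => G s * (\1_A s : R)%:C)).
have h2 A x : `|hilb (fun s => Im (G s) * (\1_A s : R)) x| <=
    pi * cabs (chilb (fun s => G s * (\1_A s : R)%:C) x).
  have -> : (fun s => Im (G s) * (\1_A s : R)) = (fun s => Im (G s * (\1_A s : R)%:C)).
    by apply/funext => s; rewrite Im_mulC.
  exact: (hilb_Im_le (fun s => G s * (\1_A s : R)%:C)).
have c11 A (mA : measurable A) := rint_of_cabs_mul mF1 (mh1 A mA) (cab A mA) (fun x => cabs_Re (F x)) (h1 A).
have c12 A (mA : measurable A) := rint_of_cabs_mul mF1 (mh2 A mA) (cab A mA) (fun x => cabs_Re (F x)) (h2 A).
have c21 A (mA : measurable A) := rint_of_cabs_mul mF2 (mh1 A mA) (cab A mA) (fun x => cabs_Im (F x)) (h1 A).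
have c22 A (mA : measurable A) := rint_of_cabs_mul mF2 (mh2 A mA) (cab A mA) (fun x => cabs_Im (F x)) (h2 A).
have [i11 _] := parseval F1i F1s G1i G1s Gr c11.
have [i12 _] := parseval F1i F1s G2i G2s Gim c12.
have [i21 _] := parseval F2i F2s G1i G1s Gr c21.
have [i22 _] := parseval F2i F2s G2i G2s Gim c22.
have GT (g : R -> R) : (fun s => g s * (\1_(setT : set R) s : R)) = g.
  by apply/funext => s; rewrite indicT mulr1.
have := c11 _ measurableT; rewrite (GT (fun s => Re (G s))) => j11.
have := c12 _ measurableT; rewrite (GT (fun s => Im (G s))) => j12.
have := c21 _ measurableT; rewrite (GT (fun s => Re (G s))) => j21.
have := c22 _ measurableT; rewrite (GT (fun s => Im (G s))) => j22.
have p11 := hilb_product F1i F1s G1i G1s Gr c11.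
have p12 := hilb_product F1i F1s G2i G2s Gim c12.
have p21 := hilb_product F2i F2s G1i G1s Gr c21.
have p22 := hilb_product F2i F2s G2i G2s Gim c22.
split.
  split.
    by apply: rint_eq (rintZl pi^-1 (rintB i11 i22)) => x; rewrite (Re_mul_chilb (G x) F x).
  apply: rint_eq (rintZl pi^-1 (rintD i21 i12)) => x; rewrite (Im_mul_chilb (G x) F x) //.
have q1 := ae_hilb_comb (h := fun s => Re (G s * chilb F s + F s * chilb G s))
  (a := pi^-1) (b := - pi^-1) (rintD i11 j11) (rintD i22 j22) _.
have q2 := ae_hilb_comb (h := fun s => Im (G s * chilb F s + F s * chilb G s))
  (a := pi^-1) (b := pi^-1) (rintD i12 j12) (rintD i21 j21) _.
apply: ae_imp2 (ae_and (ae_and p11 p12) (ae_and p21 p22)) (ae_and (q1 _) (q2 _)) _.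
- by move=> s; exact: Re_sum_chilb.
- by move=> s; exact: Im_sum_chilb.
move=> t [[e11 e12] [e21 e22]] [r1 r2].
have pi0 : pi != 0 :> R by rewrite lt0r_neq0// pi_gt0.
exact: (product_complex pi0 (Re_chilb F t) (Im_chilb F t) (Re_chilb G t) (Im_chilb G t)
  (Re_chilb (fun x => G x * chilb F x + F x * chilb G x) t)
  (Im_chilb (fun x => G x * chilb F x + F x * chilb G x) t) r1 r2 e11 e12 e21 e22).
Qed.

End Assembly.

Lemma mul0_add (K : fieldType) (a b : K) : 0 * a + 0 * b = 0.
Proof. by rewrite !mul0r addr0. Qed.

(** * Borel representatives and the conclusion *)

Section Representatives.
Context (R : realType).
Notation mu := (@lebesgue_measure R).
Notation I11 := (I11 R).

(** [F] is [f] cut off to 0 outside the interval and on a Borel null set. The comparison of moduli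
    therefore holds at every point, as required by [LlogL_zygmund], where the norm of [g] has to
    control the level sets of its representative. *)
Lemma borel_representative (f : R -> R[i]) : cmeasurable f ->
  exists F : R -> R[i], [/\ cmeas F, supported F,
    {ae leb R, forall x, I11 x -> f x = F x} & forall x, cabs (F x) <= cabs (f x)].
Proof.
move=> [fr fi].
have [N1 [m1 z1 h1]] := borel_version fr; have [N2 [m2 z2 h2]] := borel_version fi.
pose M := N1 `|` N2.
have mM : @measurable _ (measurableTypeR R) M by exact: measurableU.
exists (fun x => f x * (\1_(I11 `\` M) x : R)%:C); split.
- split; first by under eq_fun do rewrite Re_mulC; apply: h1 => // x; left.
  by under eq_fun do rewrite Im_mulC; apply: h2 => // x; right.
- by move=> x xI; rewrite indic_notin ?mulr0// => -[].
- apply: ae_leb.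
  have neg N : @measurable _ (measurableTypeR R) N -> mu N = 0%E -> mu.-negligible N.
    by move=> mN N0; exists N; split.
  have : mu.-negligible M by apply: negligibleU; exact: neg.
  apply: negligibleS => x /= h; apply: contrapT => xM; apply: h => xI.
  by rewrite indic_in ?mulr1.
- move=> x; rewrite cabsM cabs_real ler_piMr ?cabs_ge0//.
  by have /andP[b0 b1] := @indic01 _ R R (I11 `\` M) x; rewrite ger0_norm.
Qed.

Lemma finite_hilbert_chilb (k K : R -> R[i]) : cmeasurable k -> cint mu K -> supported K ->
  {ae leb R, forall x, I11 x -> k x = K x} ->
  {ae leb R, forall x, I11 x -> finite_hilbert k x = chilb K x}.
Proof.
move=> mk Ki Ks kK; apply: ae_imp (ae_leb (ae_finite_hilbert Ki Ks)) _ => x h xI.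
by rewrite -(h xI); exact: finite_hilbert_ae mk (cmeas_cmeasurable (cint_cmeas Ki)) kK xI.
Qed.

Lemma poincare_bertrand_transfer (f g F G : R -> R[i]) :
  cmeasurable f -> cmeasurable g ->
  cint mu F -> supported F -> cint mu G -> supported G ->
  {ae leb R, forall x, I11 x -> f x = F x} -> {ae leb R, forall x, I11 x -> g x = G x} ->
  pairs_bounded (fun x => complex.Re (G x)) -> pairs_bounded (fun x => complex.Im (G x)) ->
  (forall A : set R, @measurable _ (measurableTypeR R) A -> A `<=` I11 ->
     L1 (fun x => f x * finite_hilbert (fun y => g y * (\1_A y)%:C) x)) ->
  L1 (fun x => g x * finite_hilbert f x) /\
  {ae leb R, forall x, I11 x ->
    finite_hilbert (fun x => g x * finite_hilbert f x + f x * finite_hilbert g x) x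
    = finite_hilbert f x * finite_hilbert g x - f x * g x}.
Proof.
move=> mf mg Fi Fs Gi Gs fF gG Gr Gim hfg.
have hilbF := @finite_hilbert_chilb f F mf Fi Fs fF; have hilbG := @finite_hilbert_chilb g G mg Gi Gs gG.
have FG A : measurable A ->
    cint mu (fun x => F x * chilb (fun s => G s * (\1_A s : R)%:C) x).
  move=> mA; pose GA s := G s * (\1_A s : R)%:C.
  have mAI : measurable (A `&` I11) by apply: measurableI => //; exact: measurable_I11.
  have GAi : cint mu GA := cint_ind mA Gi.
  have GAs : supported GA by move=> x xI; rewrite /GA Gs// mul0r.
  (* The hypothesis speaks of Borel subsets of (-1, 1) only; intersecting A with the interval does
     not change the function at points of the interval. *)
  pose gA s := g s * (\1_(A `&` I11) s : R)%:C.
  have gGA : {ae leb R, forall x, I11 x -> gA x = GA x}.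
    apply: ae_imp gG _ => x h xI; rewrite /gA /GA (h xI); congr (_ * _%:C).
    have [xA|xA] := pselect (A x); first by rewrite !indic_in.
    by rewrite !indic_notin// => -[].
  have mgA : cmeasurable gA.
    apply: (cmeasurable_ae (cmeas_cmeasurable (cint_cmeas GAi))).
    by apply: ae_imp gGA _ => x h /h ->.
  have hgA := @finite_hilbert_chilb gA GA mgA GAi GAs gGA.
  apply: (@cint_of_L1 R (fun x => F x * chilb GA x) _ _ _ (hfg _ mAI (@subIsetr _ A I11))).
  - by apply: cmeasM (cint_cmeas Fi) _; exact: cmeas_chilb.
  - by move=> x xI; rewrite Fs// mul0r.
  - apply: ae_imp2 fF hgA _ => x h1 h2 xI.
    exact: (congr2 (@GRing.mul R[i]) (h1 xI) (h2 xI)).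
have [GFi PB] := poincare_bertrand_borel Fi Fs Gi Gs Gr Gim FG.
have FGi : cint mu (fun x => F x * chilb G x).
  have := FG setT measurableT.
  by have -> : (fun s => G s * (\1_(setT : set R) s : R)%:C) = G
    by apply/funext => s; rewrite indicT mulr1.
have GFs : supported (fun x => G x * chilb F x) by move=> x xI; rewrite Gs// mul0r.
have gF : {ae leb R, forall x, I11 x -> G x * chilb F x = g x * finite_hilbert f x}.
  apply: ae_imp2 gG hilbF _ => x h1 h2 xI.
  exact: (congr2 (@GRing.mul R[i]) (esym (h1 xI)) (esym (h2 xI))).
split; first exact: L1_of_cint GFi GFs gF.
pose K x := G x * chilb F x + F x * chilb G x.
pose k x := g x * finite_hilbert f x + f x * finite_hilbert g x.
have Ki : cint mu K := cintD GFi FGi.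
have Ks : supported K.
  move=> x xI; apply: etrans (_ : 0 * chilb F x + 0 * chilb G x = 0).
    exact: (congr2 (fun a b => a * chilb F x + b * chilb G x) (Gs x xI) (Fs x xI)).
  exact: mul0_add.
have Kk : {ae leb R, forall x, I11 x -> K x = k x}.
  apply: ae_imp2 gF (ae_and fF hilbG) _ => x h1 [h2 h3] xI.
  exact: (congr2 +%R (h1 xI) (congr2 (@GRing.mul R[i]) (esym (h2 xI)) (esym (h3 xI)))).
have mk := cmeasurable_ae (cmeas_cmeasurable (cint_cmeas Ki)) Kk.
have hilbK := @finite_hilbert_chilb k K mk Ki Ks (ae_imp Kk (fun x h xI => esym (h xI))).
apply: ae_imp2 (ae_and hilbK (ae_leb PB)) (ae_and (ae_and fF gG) (ae_and hilbF hilbG)) _.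
move=> x [h1 h2] [[h3 h4] [h5 h6]] xI.
apply: etrans (etrans (h1 xI) h2) _.
exact: (congr2 (fun a b : R[i] => a - b)
  (congr2 (@GRing.mul R[i]) (esym (h5 xI)) (esym (h6 xI)))
  (congr2 (@GRing.mul R[i]) (esym (h3 xI)) (esym (h4 xI)))).
Qed.

End Representatives.

Theorem theorem3p2 (R : realType) (f g : R -> R[i])
    (hf : L1 f) (hg : LlogL g)
    (hfg : forall A : set R, @measurable _ (measurableTypeR R) A ->
       A `<=` I11 R ->
       L1 (fun x => f x * finite_hilbert (fun y => g y * (\1_A y)%:C) x)) :
  L1 (fun x => g x * finite_hilbert f x) /\
  finite_hilbert (fun x => g x * finite_hilbert f x + f x * finite_hilbert g x)
  = (fun x => finite_hilbert f x * finite_hilbert g x - f x * g x)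
  %[ae (leb R) in (I11 R)].
Proof.
have [mf _] := hf; have [mg gL] := hg.
have [F [mF Fs fF _]] := borel_representative mf.
have [G [mG Gs gG Gg]] := borel_representative mg.
have cGs : supported (fun x => cabs (G x)).
  by move=> x xI; rewrite Gs// (cabs_real 0) normr0.
have mcG : measurable_fun setT (fun x => cabs (G x)) := measurable_cabs mG.
have Gz := LlogL_zygmund gL mcG cGs Gg.
have cG0 x : 0 <= cabs (G x) := cabs_ge0 (G x).
have cGi := zygmund_integrable mcG cGs cG0 Gz.
have Gi : cint (@lebesgue_measure R) G by
  exact: (@cint_le _ _ _ (@lebesgue_measure R) G (fun x => cabs (G x)) mG cGi (fun x => lexx _)).
apply: (poincare_bertrand_transfer mf mg (cint_of_L1 mF Fs hf fF) Fs Gi Gs fF gG _ _ hfg).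
  exact: zygmund_pairs mG.1 mcG cGs (fun x => cabs_Re (G x)) Gz.
exact: zygmund_pairs mG.2 mcG cGs (fun x => cabs_Im (G x)) Gz.
Qed.
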